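(* Let $1\leq m<n$ be natural numbers. (1) If $m\equiv1\bmod 2$, then $P^{2n}_{2m-1}\cong\Sigma^{2m-3}A_{n-m,0}$ if $n-m\equiv2,3\bmod 4$, and $P^{2n}_{2m-1}\cong\Sigma^{2m-3}A_{n-m,1}$ if $n-m\equiv0,1\bmod4$. (2) If $m\equiv0\bmod2$, then $P^{2n}_{2m-1}\cong\Sigma^{2m-3}(\Omega^{-1}\Sigma^3)A_{n-m,0}$ if $n-m\equiv0,3\bmod4$, and $P^{2n}_{2m-1}\cong\Sigma^{2m-3}(\Omega^{-1}\Sigma^3)A_{n-m,1}$ if $n-m\equiv1,2\bmod4$. (These are isomorphisms of $\mathscr{A}(1)$-modules.)
   Context: $\mathbb{F}=\mathbb{F}_2$; $\mathscr{A}(1)$ is the sub-Hopf algebra of the mod 2 Steenrod algebra generated by $Sq^1,Sq^2$. Modules are $\mathbb{Z}$-graded, operations raise degree, $\otimes$ is over $\mathbb{F}$ with the diagonal action, $(\Sigma M)^n=M^{n-1}$. $P_{-\infty}=\mathbb{F}[u^{\pm1}]$, $|u|=1$, with $Sq^iu^n=\binom{n}{i}u^{n+i}$ for $i=1,2$; $P^b_a$ is the subquotient of $P_{-\infty}$ of elements in degrees $[a,b]$ (the mod 2 cohomology of truncated projective space $\mathbb{R}P^b_a$). A module is reduced if $Sq^2Sq^2Sq^2$ acts trivially; every bounded-below module is the direct sum of a free module and a reduced module $M^{\mathrm{red}}$. $\Omega\mathbb{F}$ is the augmentation ideal of $\mathscr{A}(1)$, $\Omega^{-1}\mathbb{F}$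 its dual; $\Omega^nM=((\Omega\mathbb{F})^{\otimes n}\otimes M)^{\mathrm{red}}$ for $n\geq0$ and $((\Omega^{-1}\mathbb{F})^{\otimes|n|}\otimes M)^{\mathrm{red}}$ for $n<0$. $J=\Sigma^{-2}\big(\mathscr{A}(1)/\mathscr{A}(1)Sq^1Sq^2\big)$ (the Joker). For $k\geq1$, $\epsilon\in\{0,1\}$, the module $\Sigma^{-(k+1)}\Omega^{k+1}J^{\otimes\epsilon}$ is concentrated in degrees $\geq0$, is one-dimensional in degree $0$, and has a unique non-trivial morphism to $\mathbb{F}$; $A_{k,\epsilon}$ is the kernel of this morphism. *)

(* Defs.v *)
From HB Require Import structures.
From Stdlib Require Import ClassicalEpsilon.
From mathcomp Require Import all_boot all_order all_algebra finmap.
From mathcomp.multinomials Require Import monalg.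
From mathcomp Require Import zify.

Set Implicit Arguments.
Unset Strict Implicit.
Unset Printing Implicit Defensive.

Import GRing.Theory.
Local Open Scope ring_scope.

(* F<Sq^1, Sq^2, ...>; the letter i stands for Sq^i, and Sq^0 = 1, so that the
   letter 0 is never used. *)
Definition freealg := {malg 'F_2[{fmonom nat}]}.

Definition Sq (i : nat) : freealg := if i is 0%N then 1 else << fmu i >>.

Inductive adem : freealg -> Prop :=
  Adem (a b : nat) : (0 < a)%N -> (a < 2 * b)%N ->
  adem (Sq a * Sq b -
        \sum_(j < (a./2).+1)
           ('C(b - j - 1, a - 2 * j))%:R *: (Sq (a + b - j) * Sq j)).

Inductive ideal (rel : freealg -> Prop) : freealg -> Prop :=
| ideal0 : ideal rel 0
| idealD p q : ideal rel p -> ideal rel q -> ideal rel (p + q)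
| ideal_gen x r y : rel r -> ideal rel (x * r * y).

(* [steenrod0 p]: p vanishes in the Steenrod algebra F<Sq^i> / (Adem). *)
Definition steenrod0 : freealg -> Prop := ideal adem.

(* [on12 p]: p lies in the subalgebra F<Sq^1, Sq^2>, whose image in the
   Steenrod algebra is A(1). *)
Definition on12 (p : freealg) : Prop :=
  forall w : {fmonom nat}, w \in msupp p -> all (mem [:: 1; 2]%N) w.

Section Evaluation.
Variables (V : vectType 'F_2) (sq : nat -> 'End(V)).

Definition evw (w : seq nat) : 'End(V) := foldr (fun i f => (sq i \o f)%VF) \1%VF w.
Definition ev (p : freealg) : 'End(V) := \sum_(w <- msupp p) p@_w *: evw w.

Lemma evw_cat u v : evw (u ++ v) = (evw u \o evw v)%VF.
Proof.
elim: u => [|i u IH] /=; first by rewrite comp_lfun1l.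
by rewrite IH comp_lfunA.
Qed.

Lemma evEw (d : {fset {fmonom nat}}) p : (msupp p `<=` d)%fset ->
  ev p = \sum_(w <- d) p@_w *: evw w.
Proof.
move=> le; rewrite /ev (big_fset_incl _ le) //= => x xd /mcoeff_outdom ->.
by rewrite scale0r.
Qed.

Lemma ev0 : ev 0 = 0.
Proof. by rewrite /ev msupp0 big_seq_fset0. Qed.

Lemma evD : {morph ev : p q / p + q}.
Proof.
move=> p q; rewrite (evEw (msuppD_le p q)).
rewrite (evEw (fsubsetUl (msupp p) (msupp q))).
rewrite (evEw (fsubsetUr (msupp p) (msupp q))) -big_split /=.
by apply: eq_bigr => w _; rewrite mcoeffD scalerDl.
Qed.

Lemma evU c w : ev << c *g w >> = c *: evw w.
Proof. by rewrite (evEw msuppU_le) big_seq_fset1 mcoeffUU. Qed.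

Lemma ev_sum I (r : seq I) (F : I -> freealg) :
  ev (\sum_(i <- r) F i) = \sum_(i <- r) ev (F i).
Proof. exact: (big_morph ev evD ev0). Qed.

Lemma evZ c p : ev (c *: p) = c *: ev p.
Proof.
rewrite (evEw (msuppZ_le c p)) /ev scaler_sumr.
by apply: eq_bigr => w _; rewrite mcoeffZ scalerA.
Qed.

Lemma evN p : ev (- p) = - ev p.
Proof. by rewrite -scaleN1r evZ scaleN1r. Qed.

Lemma evM p q : ev (p * q) = (ev p \o ev q)%VF.
Proof.
rewrite malgME ev_sum [in RHS]/ev.
have cs (I : Type) (r : seq I) (F : I -> 'End(V)) (g : 'End(V)) :
    ((\sum_(i <- r) F i) \o g = \sum_(i <- r) (F i \o g))%VF.
  by apply: (big_morph (fun f => (f \o g)%VF)) => [f f'|];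
    rewrite ?comp_lfunDl ?comp_lfun0l.
have cs' (I : Type) (r : seq I) (F : I -> 'End(V)) (g : 'End(V)) :
    (g \o (\sum_(i <- r) F i) = \sum_(i <- r) (g \o F i))%VF.
  by apply: (big_morph (fun f => (g \o f)%VF)) => [f f'|];
    rewrite ?comp_lfunDr ?comp_lfun0r.
rewrite cs; apply: eq_bigr => u _; rewrite ev_sum cs'; apply: eq_bigr => v _.
by rewrite evU fmM evw_cat -comp_lfunZl -comp_lfunZr scalerA mulrC.
Qed.

Lemma ev1 : ev 1 = \1%VF.
Proof. by rewrite evU fm1 scale1r. Qed.

Lemma ev_ideal rel p : (forall r, rel r -> ev r = 0) -> ideal rel p -> ev p = 0.
Proof.
move=> h; elim=> [|{}p q _ hp _ hq|x r y /h hr]; first exact: ev0.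
  by rewrite evD hp hq addr0.
by rewrite !evM hr comp_lfun0r comp_lfun0l.
Qed.

End Evaluation.

(* The monomial basis of A(1): 1, Sq1, Sq2, Sq1Sq2, Sq2Sq1, Sq1Sq2Sq1 = Sq2Sq2,
   Sq2Sq1Sq2, Sq1Sq2Sq1Sq2 = Sq2Sq2Sq2; [A1deg] lists the degrees, and the basis
   element with index k is sent by Sq^i to the one with index [A1tab i k], if
   any, and to 0 otherwise. *)
Definition A1word (k : nat) : seq nat :=
  nth [::] [:: [::]; [:: 1]; [:: 2]; [:: 1; 2]; [:: 2; 1]; [:: 1; 2; 1];
               [:: 2; 1; 2]; [:: 1; 2; 1; 2]]%N k.

Definition A1deg (k : nat) : int := (sumn (A1word k))%:Z.

Definition A1tab (i k : nat) : option nat :=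
  match i, k with
  | 1, 0 => Some 1 | 1, 2 => Some 3 | 1, 4 => Some 5 | 1, 6 => Some 7
  | 2, 0 => Some 2 | 2, 1 => Some 4 | 2, 2 => Some 5 | 2, 3 => Some 6
  | 2, 5 => Some 7
  | _, _ => None
  end%N.

Definition pmx n (f : nat -> option nat) : 'M['F_2]_n :=
  \matrix_(i, j) (f i == Some (j : nat))%:R.

(* An operator on row vectors whose matrix has the coordinates of the image of
   the i-th basis vector as its i-th row. *)
Definition mxop n (S : 'M['F_2]_n) : 'End('rV['F_2]_n) := linfun (mulmxr S).

Lemma mxopE n (S : 'M['F_2]_n) x : mxop S x = x *m S.
Proof. by rewrite lfunE. Qed.

Lemma mxop_comp n (S T : 'M['F_2]_n) : (mxop S \o mxop T)%VF = mxop (T *m S).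
Proof. by apply/lfunP => x; rewrite comp_lfunE !mxopE mulmxA. Qed.

Lemma mxopD n (S T : 'M['F_2]_n) : mxop (S + T) = mxop S + mxop T.
Proof. by apply/lfunP => x; rewrite add_lfunE !mxopE mulmxDr. Qed.

Lemma mxopZ n c (S : 'M['F_2]_n) : mxop (c *: S) = c *: mxop S.
Proof. by apply/lfunP => x; rewrite scale_lfunE !mxopE scalemxAr. Qed.

Lemma mxop0 n : mxop (0 : 'M['F_2]_n) = 0.
Proof. by apply/lfunP => x; rewrite zero_lfunE mxopE mulmx0. Qed.

Lemma mxop1 n : mxop (1%:M : 'M['F_2]_n) = \1%VF.
Proof. by apply/lfunP => x; rewrite id_lfunE mxopE mulmx1. Qed.

Lemma mxop_sum n I (r : seq I) (F : I -> 'M['F_2]_n) :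
  mxop (\sum_(i <- r) F i) = \sum_(i <- r) mxop (F i).
Proof. exact: (big_morph (@mxop n) (@mxopD n) (@mxop0 n)). Qed.

Lemma natrF2 (k : nat) : (k%:R : 'F_2) = (odd k)%:R.
Proof. by apply/val_inj; rewrite /= val_Fp_nat // modn2; case: (odd k). Qed.

Lemma pmxM n f g : (forall i j, (i < n)%N -> f i = Some j -> (j < n)%N) ->
  pmx n f *m pmx n g = pmx n (fun i => obind g (f i)).
Proof.
move=> fn; apply/matrixP => i k; rewrite !mxE.
case fi: (f i) => [j|] /=; last first.
  by rewrite big1 // => j _; rewrite !mxE fi mul0r.
have jn : (j < n)%N := fn _ _ (ltn_ord i) fi.
rewrite (bigD1 (Ordinal jn)) //= !mxE fi eqxx mul1r big1 ?addr0 // => l lj.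
rewrite !mxE fi (_ : (Some j == Some (l : nat)) = false) ?mul0r //.
by apply/eqP => -[jl]; move/negP: lj; apply; apply/eqP/val_inj.
Qed.

(* An extension of the action of A(1) on itself to the whole Steenrod algebra. *)
Definition Atab (i k : nat) : option nat :=
  match i, k with
  | 0, _ => Some k
  | 3, 0 => Some 3 | 3, 1 => Some 5 | 3, 3 => Some 7
  | 4, 1 => Some 6 | 5, 1 => Some 7 | 6, 0 => Some 7
  | _, _ => A1tab i k
  end%N.

Lemma Atab_lt i k j : (k < 8)%N -> Atab i k = Some j -> (j < 8)%N.
Proof.
case: i => [|i]; first by move=> ? [<-].
by move: i k => [|[|[|[|[|[|i]]]]]] [|[|[|[|[|[|[|[|k]]]]]]]] //= _ [<-].
Qed.

Lemma Atab_ge7 i k : (6 < i)%N -> Atab i k = None.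
Proof. by move: i => [|[|[|[|[|[|[|i]]]]]]]. Qed.

Definition Aop (i : nat) := mxop (pmx 8 (Atab i)).

Lemma Aop_comp a b : (Aop a \o Aop b)%VF =
  mxop (pmx 8 (fun k => obind (Atab a) (Atab b k))).
Proof. by rewrite mxop_comp pmxM //; apply: Atab_lt. Qed.

Lemma ev_Sq i : ev Aop (Sq i) = Aop i.
Proof.
case: i => [|i]; last by rewrite evU fmU scale1r /= comp_lfun1r.
rewrite ev1 /Aop (_ : pmx 8 (Atab 0) = 1%:M) ?mxop1 //.
by apply/matrixP => i j; rewrite !mxE.
Qed.

Lemma adem_check (a b k l : nat) : (a < 7)%N -> (b < 7)%N -> (k < 8)%N -> (l < 8)%N ->
  (0 < a)%N -> (a < 2 * b)%N ->
  odd ((obind (Atab a) (Atab b k) == Some l) +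
   sumn [seq ('C(b - j - 1, a - 2 * j) *
         (obind (Atab (a + b - j)) (Atab j k) == Some l))%N | j <- iota 0 (a./2).+1])
  = false.
Proof.
have H : all (fun a => all (fun b => all (fun k => all (fun l =>
   (0 < a)%N ==> (a < 2 * b)%N ==> ~~ 
  odd ((obind (Atab a) (Atab b k) == Some l) +
   sumn [seq ('C(b - j - 1, a - 2 * j) *
         (obind (Atab (a + b - j)) (Atab j k) == Some l))%N | j <- iota 0 (a./2).+1]))
  (iota 0 8)) (iota 0 8)) (iota 0 7)) (iota 0 7) by vm_compute.
move=> a7 b7 k8 l8 a0 ab.
move/allP: H => /(_ a); rewrite mem_iota add0n => /(_ a7).
move/allP => /(_ b); rewrite mem_iota add0n => /(_ b7).
move/allP => /(_ k); rewrite mem_iota add0n => /(_ k8).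
move/allP => /(_ l); rewrite mem_iota add0n => /(_ l8).
by rewrite a0 ab /= => /negbTE.
Qed.

Lemma Aop_adem r : adem r -> ev Aop r = 0.
Proof.
case=> a b a0 ab.
rewrite evD evN evM !ev_Sq ev_sum.
under eq_bigr => j _ do rewrite evZ evM !ev_Sq Aop_comp -mxopZ.
rewrite -mxop_sum Aop_comp -scaleN1r -mxopZ -mxopD -[RHS](mxop0 8); congr mxop.
apply/matrixP => k l; rewrite !mxE summxE.
rewrite (_ : -1 = 1 :> 'F_2) ?mul1r; last exact/val_inj.
under eq_bigr => j _ do rewrite !mxE -natrM.
rewrite -natr_sum -natrD natrF2 -(big_mkord xpredT (fun j =>
  ('C(b - j - 1, a - 2 * j) *
    (obind (Atab (a + b - j)) (Atab j k) == Some (l : nat)))%N)).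
have [/andP[a7 b7]|] := boolP ((a < 7)%N && (b < 7)%N).
  by rewrite -(big_map _ xpredT id) -sumnE /index_iota subn0 adem_check.
rewrite negb_and -!leqNgt => h.
have obN f : obind (fun _ : nat => @None nat) f = None by case: f.
have T7 i f : (6 < i)%N -> obind (Atab i) f = None.
  by move=> i7; case: f => //= x; apply: Atab_ge7.
rewrite big_nat big1 => [|j /andP[_ ja]]; last first.
  rewrite T7 ?muln0 //; lia.
case/orP: h => [a7|b7]; first by rewrite T7.
by rewrite Atab_ge7.
Qed.

Lemma ideal_mull rel x p : ideal rel p -> ideal rel (x * p).
Proof.
elim=> [|{}p q _ hp _ hq|u r v hr]; first by rewrite mulr0; apply: ideal0.
  by rewrite mulrDr; apply: idealD.
by rewrite !mulrA; apply: ideal_gen.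
Qed.

Lemma ideal_mulr rel x p : ideal rel p -> ideal rel (p * x).
Proof.
elim=> [|{}p q _ hp _ hq|u r v hr]; first by rewrite mul0r; apply: ideal0.
  by rewrite mulrDl; apply: idealD.
by rewrite -mulrA; apply: ideal_gen.
Qed.

Lemma idealN rel p : ideal rel p -> ideal rel (- p).
Proof. by move=> hp; rewrite -mulN1r; apply: ideal_mull. Qed.

Lemma ideal_rel (rel : freealg -> Prop) r : rel r -> ideal rel r.
Proof. by move=> h; rewrite -[r]mul1r -[_ * r]mulr1; apply: ideal_gen. Qed.

Lemma ideal_sum rel (I : eqType) (s : seq I) (F : I -> freealg) :
  (forall i, i \in s -> ideal rel (F i)) -> ideal rel (\sum_(i <- s) F i).
Proof.
move=> h; rewrite big_seq; elim/big_rec: _ => [|i p si hp]; first exact: ideal0.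
by apply: idealD hp; apply: h.
Qed.

Lemma ideal_sub (rel rel' : freealg -> Prop) p :
  (forall r, rel r -> ideal rel' r) -> ideal rel p -> ideal rel' p.
Proof.
move=> h; elim=> [|{}p q _ hp _ hq|x r y /h hr]; first exact: ideal0.
  exact: idealD.
by apply: ideal_mulr; apply: ideal_mull.
Qed.

(* The relations Sq1 Sq1 = 0 and Sq2 Sq2 = Sq1 Sq2 Sq1 present A(1). *)
Definition rel12 (r : freealg) : Prop :=
  r = Sq 1 * Sq 1 \/ r = Sq 2 * Sq 2 - Sq 1 * Sq 2 * Sq 1.

Lemma rel12_steenrod0 p : ideal rel12 p -> steenrod0 p.
Proof.
have h11 := @Adem 1 1 isT isT; have h12 := @Adem 1 2 isT isT.
have h22 := @Adem 2 2 isT isT.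
rewrite big_ord1 (_ : 'C(_, _) = 0%N) // mulr0n scale0r subr0 in h11.
rewrite big_ord1 (_ : 'C(_, _) = 1%N) // mulr1n scale1r [Sq (ord0 : 'I_1)]/= mulr1 in h12.
rewrite big_ord_recl big_ord1 (_ : 'C(_, _) = 0%N) // mulr0n scale0r add0r in h22.
rewrite (_ : 'C(_, _) = 1%N) // mulr1n scale1r in h22.
apply: ideal_sub => r [] ->; first exact: ideal_rel.
rewrite (_ : _ - _ = (Sq 2 * Sq 2 - Sq 3 * Sq 1) - (Sq 1 * Sq 2 - Sq 3) * Sq 1).
  apply: idealD; first exact: ideal_rel.
  by apply: idealN; apply: ideal_mulr; apply: ideal_rel.
by rewrite mulrBl opprB addrA subrK.
Qed.

Definition basis12 (k : nat) : freealg := foldr (fun i p => Sq i * p) 1 (A1word k).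
Definition nf (o : option nat) : freealg := oapp basis12 0 o.

Lemma tab_ring (R : nzRingType) (I : R -> Prop) (s : nat -> R) (B : nat -> R) i k :
  I 0 -> (forall p q, I p -> I q -> I (p + q)) -> (forall p, I p -> I (- p)) ->
  (forall x p y, I p -> I (x * p * y)) ->
  I (s 1%N * s 1%N) -> I (s 2 * s 2 - s 1%N * s 2 * s 1%N) ->
  (forall k, B k = foldr (fun i p => s i * p) 1 (A1word k)) ->
  i \in [:: 1; 2]%N -> (k < 8)%N -> I (s i * B k - oapp B 0 (A1tab i k)).
Proof.
move=> I0 ID IN IM; set a := s 1%N; set b := s 2%N => haa hbb HB.
have aa x y : I (x * (a * a) * y) by apply: IM.
have bb x y : I (x * (b * b - a * b * a) * y) by apply: IM.
have triv p : I (p - p) by rewrite subrr.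
have aax p : I (a * (a * p) - 0) by have := aa 1 p; rewrite mul1r subr0 mulrA.
rewrite !inE => /orP[] /eqP ->; rewrite HB -/a -/b.
  by move: k => [|[|[|[|[|[|[|[|k]]]]]]]] // _;
     rewrite [oapp _ _ _]/= ?HB [foldr _ _ _]/= -/a -/b.
move: k => [|[|[|[|[|[|[|[|k]]]]]]]] // _;
  rewrite [oapp _ _ _]/= ?HB ![foldr _ _ _]/= -/a -/b ?mulr1 //.
- by have := bb 1 1; rewrite mul1r mulr1 mulrA.
- rewrite subr0 (_ : _ * _ = (1 * (b * b - a * b * a) * a) + a * b * (a * a) * 1).
    exact: ID.
  by rewrite mul1r mulr1 mulrBl !mulrA subrK.
- rewrite (_ : _ - _ = - (b * (b * b - a * b * a) * 1) + 1 * (b * b - a * b * a) * b).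
    by apply: ID => //; apply: IN.
  by rewrite mulr1 mul1r mulrBr mulrBl !mulrA opprB addrA subrK.
- rewrite subr0 (_ : _ * _ = 1 * (b * b - a * b * a) * (a * b) + a * b * (a * a) * b).
    exact: ID.
  by rewrite mul1r mulrBl !mulrA subrK.
rewrite subr0 (_ : _ * _ = - (b * (b * b - a * b * a) * b)
   + 1 * (b * b - a * b * a) * (b * b) + a * b * a * (b * b - a * b * a) * 1
   + a * b * (a * a) * (b * a)).
  by apply: (ID) => //; apply: (ID) => //; apply: (ID) => //; apply: IN.
by rewrite mulr1 mul1r !(mulrBr, mulrBl) !mulrA opprB !addrA !subrK.
Qed.

Lemma tab12 i k : i \in [:: 1; 2]%N -> (k < 8)%N ->
  ideal rel12 (Sq i * basis12 k - nf (A1tab i k)).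
Proof.
apply: (@tab_ring freealg (ideal rel12) Sq basis12) => //.
- exact: ideal0.
- exact: idealD.
- exact: idealN.
- by move=> x p y hp; apply: ideal_mulr; apply: ideal_mull.
- by apply: ideal_rel; left.
- by apply: ideal_rel; right.
Qed.

Definition run12 (w : seq nat) : option nat := foldr (fun i => obind (A1tab i)) (Some 0%N) w.

Lemma run12_lt w k : run12 w = Some k -> (k < 8)%N.
Proof.
elim: w k => [|i w IH] k /=; first by move=> [<-].
case: (run12 w) IH => //= l _.
by move: i l => [|[|[|i]]] [|[|[|[|[|[|[|[|l]]]]]]]] //= [<-].
Qed.

Lemma word12 (w : {fmonom nat}) : all (mem [:: 1; 2]%N) w ->
  ideal rel12 (<< w >> - nf (run12 w)).
Proof.
case: w => w /=; elim: w => [|i w IH] /=.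
  by move=> _; rewrite /nf /= -fmoneE subrr; apply: ideal0.
case/andP=> i12 /IH {}IH.
have -> : << FMonom (i :: w) >> = Sq i * << FMonom w >> :> freealg.
  case: i i12 => [//|i] _ /=; rewrite malgM_def fgmulUU mulr1; congr (<< _ >>).
  by rewrite /mmul /= fmmulE fmU.
rewrite (_ : _ - _ = Sq i * (<< FMonom w >> - nf (run12 w))
    + (Sq i * nf (run12 w) - nf (obind (A1tab i) (run12 w)))); last first.
  by rewrite mulrBr addrA subrK.
apply: idealD; first exact: ideal_mull.
case E: (run12 w) => [k|] /=; last by rewrite mulr0 subrr; apply: ideal0.
by apply: tab12 => //; apply: run12_lt E.
Qed.

Lemma nfE o : (forall k, o = Some k -> (k < 8)%N) ->
  nf o = \sum_(k < 8) (o == Some (k : nat))%:R *: basis12 k.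
Proof.
case: o => [k|] h /=; last by rewrite big1 // => k _; rewrite scale0r.
rewrite (bigD1 (Ordinal (h _ erefl))) //= eqxx scale1r big1 ?addr0 // => l lk.
rewrite (_ : (Some k == Some (l : nat)) = false) ?scale0r //.
by apply/eqP => -[kl]; move/negP: lk; apply; apply/eqP/val_inj.
Qed.

Lemma nf_ideal p : on12 p ->
  (forall k : 'I_8, \sum_(w <- msupp p) p@_w * (run12 w == Some (k : nat))%:R = 0) ->
  ideal rel12 p.
Proof.
move=> hp h0; have h : ideal rel12
    (\sum_(w <- msupp p) p@_w *: (<< w >> - nf (run12 w))).
  apply: ideal_sum => w wp; rewrite -mul_malgC; apply: ideal_mull.
  by apply: word12; apply: hp.
have e : \sum_(w <- msupp p) p@_w *: nf (run12 w) = 0.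
  under eq_bigr => w _ do rewrite (nfE (@run12_lt w)) scaler_sumr.
  rewrite exchange_big /= big1 // => k _.
  under eq_bigr => w _ do rewrite scalerA.
  by rewrite -scaler_suml h0 scale0r.
have mE : p = \sum_(w <- msupp p) p@_w *: << w >>.
  rewrite {1}[p]monalgE; apply: eq_bigr => w _.
  by rewrite -mul_malgC malgM_def fgmulUU mulr1 mul1m.
suff -> : p = \sum_(w <- msupp p) p@_w *: (<< w >> - nf (run12 w)) by [].
transitivity (\sum_(w <- msupp p) (p@_w *: << w >> - p@_w *: nf (run12 w))).
  by rewrite big_split /= -mE sumrN e oppr0 addr0.
by apply: eq_bigr => w _; rewrite scalerBr.
Qed.

(* The image of the basis vector 1 under a word acting by operators which agree
   with the action of A(1) on itself. *)
Lemma evw_run (T : nat -> nat -> option nat) (w : seq nat) :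
  (forall i k, i \in [:: 1; 2]%N -> T i k = A1tab i k) ->
  all (mem [:: 1; 2]%N) w ->
  evw (fun i => mxop (pmx 8 (T i))) w (delta_mx 0 0) =
    \row_l (run12 w == Some (l : nat))%:R.
Proof.
move=> hT; elim: w => [|i w IH] /=.
  move=> _; rewrite id_lfunE; apply/rowP => l; rewrite !mxE eqxx /=; congr (_%:R).
  by rewrite (_ : (Some 0 == Some (l : nat)) = (0%N == l)) // eq_sym.
case/andP=> i12 /IH {}IH; rewrite comp_lfunE IH mxopE.
apply/rowP => l; rewrite !mxE.
case E: (run12 w) => [k|] /=; last by rewrite big1 // => j _; rewrite mxE mul0r.
rewrite (bigD1 (Ordinal (run12_lt E))) //= !mxE eqxx mul1r big1 ?addr0 ?hT //.
move=> j jk; rewrite mxE (_ : (Some k == Some (j : nat)) = false) ?mul0r //.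
by apply/eqP => -[kj]; move/negP: jk; apply; apply/eqP/val_inj.
Qed.

Lemma ev_run (T : nat -> nat -> option nat) p (k : 'I_8) :
  (forall i k, i \in [:: 1; 2]%N -> T i k = A1tab i k) -> on12 p ->
  (ev (fun i => mxop (pmx 8 (T i))) p (delta_mx 0 0) : 'rV_8) 0 k =
    \sum_(w <- msupp p) p@_w * (run12 w == Some (k : nat))%:R.
Proof.
move=> hT hp; rewrite /ev sum_lfunE summxE !big_seq; apply: eq_bigr => w wp.
by rewrite scale_lfunE evw_run ?mxE //; apply: hp.
Qed.

Lemma steenrod0_rel12 p : on12 p -> steenrod0 p -> ideal rel12 p.
Proof.
move=> hp h0; apply: nf_ideal => // k.
have hT i l : i \in [:: 1; 2]%N -> Atab i l = A1tab i l.
  by rewrite !inE => /orP[] /eqP ->.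
rewrite -(ev_run k hT hp) -/Aop (_ : ev _ p = 0) ?zero_lfunE ?mxE //.
exact: ev_ideal Aop_adem h0.
Qed.

Lemma ev_rel12 (V : vectType 'F_2) (sq : nat -> 'End(V)) p :
  (sq 1 \o sq 1 = 0)%VF -> (sq 2 \o sq 2 = sq 1 \o sq 2 \o sq 1)%VF ->
  on12 p -> steenrod0 p -> ev sq p = 0.
Proof.
move=> h11 h22 hp h0; apply: ev_ideal (steenrod0_rel12 hp h0).
have evS i : ev sq (Sq i.+1) = sq i.+1.
  by rewrite evU fmU scale1r /= comp_lfun1r.
rewrite /rel12 => r; move: (Sq 1) (Sq 2) (evS 0%N) (evS 1%N) => a b ea eb.
case=> ->; first by rewrite evM ea.
rewrite (evD _ (b * b)).
rewrite (evN _ (a * b * a)).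
apply/eqP; rewrite subr_eq0; apply/eqP.
apply: etrans (evM _ b b) _; apply: etrans _ (esym (evM _ (a * b) a)).
by rewrite ea eb h22 evM ea eb.
Qed.

Definition sqfam (V : vectType 'F_2) (s1 s2 : 'End(V)) (i : nat) : 'End(V) :=
  if i == 1%N then s1 else if i == 2 then s2 else 0.

(* Finite-dimensional Z-graded left A(1)-modules.  The grading is given by the
   projections [pr d] onto the homogeneous components, which vanish for d
   outside of the finite list [degs]; the action of A(1) is that of the
   subalgebra of the Steenrod algebra generated by Sq1 and Sq2. *)
Record amod := AMod {
  car :> vectType 'F_2;
  degs : seq int;
  pr : int -> 'End(car);
  sq1 : 'End(car);
  sq2 : 'End(car);
  degs_uniq : uniq degs;
  pr_comp : forall d e, (pr d \o pr e)%VF = if d == e then pr d else 0;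
  pr_sum : \sum_(d <- degs) pr d = \1%VF;
  pr_sq1 : forall d, (pr (d + 1) \o sq1 = sq1 \o pr d)%VF;
  pr_sq2 : forall d, (pr (d + 2) \o sq2 = sq2 \o pr d)%VF;
  sq_rel : forall p, on12 p -> steenrod0 p -> ev (sqfam sq1 sq2) p = 0
}.

Definition sqop (M : amod) : nat -> 'End(M) := sqfam (sq1 M) (sq2 M).

Definition amod_of (V : vectType 'F_2) (D : seq int) (p : int -> 'End(V))
    (s1 s2 : 'End(V)) (uD : uniq D)
    (pC : forall d e, (p d \o p e)%VF = if d == e then p d else 0)
    (pS : \sum_(d <- D) p d = \1%VF)
    (p1 : forall d, (p (d + 1) \o s1 = s1 \o p d)%VF)
    (p2 : forall d, (p (d + 2) \o s2 = s2 \o p d)%VF)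
    (h11 : (s1 \o s1 = 0)%VF) (h22 : (s2 \o s2 = s1 \o s2 \o s1)%VF) : amod :=
  AMod uD pC pS p1 p2 (fun q => @ev_rel12 V (sqfam s1 s2) q h11 h22).

Lemma on12M p q : on12 p -> on12 q -> on12 (p * q).
Proof.
move=> hp hq w /msuppM_le[u [v [up vq ->]]].
by rewrite fmM all_cat hp //= hq.
Qed.

Lemma on12B p q : on12 p -> on12 q -> on12 (p - q).
Proof.
move=> hp hq w /(fsubsetP (msuppB_le _ _)); rewrite inE.
by case/orP => [/hp|/hq].
Qed.

Lemma on12_Sq1 : on12 (Sq 1).
Proof. by move=> w; rewrite msuppU1 inE => /eqP ->; rewrite fmU. Qed.

Lemma on12_Sq2 : on12 (Sq 2).
Proof. by move=> w; rewrite msuppU1 inE => /eqP ->; rewrite fmU. Qed.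

Lemma ev_Sq12 (V : vectType 'F_2) (sq : nat -> 'End(V)) i :
  ev sq (Sq i.+1) = sq i.+1.
Proof. by rewrite evU fmU scale1r /= comp_lfun1r. Qed.

Lemma sq1sq1 (M : amod) : (sq1 M \o sq1 M = 0)%VF.
Proof.
have h : steenrod0 (Sq 1 * Sq 1).
  by apply: rel12_steenrod0; apply: ideal_rel; left.
have := sq_rel M (on12M on12_Sq1 on12_Sq1) h.
by move=> e; apply: etrans e; apply: etrans _ (esym (evM _ _ _)); rewrite ev_Sq12.
Qed.

Lemma sq2sq2 (M : amod) : (sq2 M \o sq2 M = sq1 M \o sq2 M \o sq1 M)%VF.
Proof.
have h : steenrod0 (Sq 2 * Sq 2 - Sq 1 * Sq 2 * Sq 1).
  by apply: rel12_steenrod0; apply: ideal_rel; right.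
have o := on12B (on12M on12_Sq2 on12_Sq2)
  (on12M (on12M on12_Sq1 on12_Sq2) on12_Sq1).
have := sq_rel M o h; move: (ev_Sq12 (sqop M) 0) (ev_Sq12 (sqop M) 1).
rewrite -/(sqop M); move: (Sq 1) (Sq 2) => a b ea eb e.
apply/eqP; rewrite -subr_eq0; apply/eqP; apply: etrans e.
apply: etrans _ (esym (evD _ _ _)); congr (_ + _).
  by apply: etrans _ (esym (evM _ _ _)); rewrite eb.
apply: etrans _ (esym (evN _ _)); congr (- _).
apply: etrans _ (esym (evM _ _ _)); rewrite ea; congr (_ \o _)%VF.
by apply: etrans _ (esym (evM _ _ _)); rewrite ea eb.
Qed.

Record ahom (M N : amod) := AHom {
  hfun :> 'Hom(M, N);
  hom_pr : forall d, (hfun \o pr M d = pr N d \o hfun)%VF;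
  hom_sq1 : (hfun \o sq1 M = sq1 N \o hfun)%VF;
  hom_sq2 : (hfun \o sq2 M = sq2 N \o hfun)%VF
}.

Definition iso (M N : amod) : Prop := exists f : ahom M N, bijective f.

Lemma hom0_proof (M N : amod) (f : 'End(M)) (g : 'End(N)) :
  ((0 : 'Hom(M, N)) \o f = g \o 0)%VF.
Proof. by rewrite comp_lfun0l comp_lfun0r. Qed.

Definition hom0 (M N : amod) : ahom M N :=
  @AHom M N 0 (fun d => hom0_proof _ _) (hom0_proof _ _) (hom0_proof _ _).

Section Based.
Variables (n : nat) (deg : 'I_n -> int) (S1 S2 : 'M['F_2]_n).
Hypothesis deg1 : forall i j, S1 i j != 0 -> deg j = deg i + 1.
Hypothesis deg2 : forall i j, S2 i j != 0 -> deg j = deg i + 2.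
Hypothesis S11 : S1 *m S1 = 0.
Hypothesis S22 : S2 *m S2 = S1 *m S2 *m S1.

Let prx (d : int) : 'M['F_2]_n := diag_mx (\row_i (deg i == d)%:R).

Lemma based_pr_comp d e :
  (mxop (prx d) \o mxop (prx e))%VF = if d == e then mxop (prx d) else 0.
Proof.
rewrite mxop_comp mulmx_diag; have [<-|de] := eqVneq d e.
  congr (mxop (diag_mx _)); apply/rowP => i; rewrite !mxE.
  by case: eqP; rewrite ?mul1r ?mul0r.
rewrite -[RHS](mxop0 n); congr mxop; apply/matrixP => i j; rewrite !mxE.
case: (eqVneq (deg i) e) => [->|]; last by rewrite mul0r mul0rn.
by rewrite eq_sym (negPf de) mulr0 mul0rn.
Qed.

Lemma based_pr_sum :
  \sum_(d <- undup [seq deg i | i <- enum 'I_n]) mxop (prx d) = \1%VF.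
Proof.
rewrite -mxop_sum -(mxop1 n); congr mxop; apply/matrixP => i j.
rewrite summxE mxE (bigD1_seq (deg i)) ?undup_uniq //=; last first.
  by rewrite mem_undup map_f ?mem_enum.
rewrite !mxE eqxx big1 ?addr0 => [|d di]; first by case: eqP.
by rewrite !mxE eq_sym (negPf di) mul0rn.
Qed.

Lemma based_pr_sq (S : 'M['F_2]_n) (k : int) :
  (forall i j, S i j != 0 -> deg j = deg i + k) ->
  forall d, (mxop (prx (d + k)) \o mxop S = mxop S \o mxop (prx d))%VF.
Proof.
move=> h d; rewrite !mxop_comp; congr mxop; apply/matrixP => i j.
rewrite mul_diag_mx mul_mx_diag !mxE.
have [->|/h ->] := eqVneq (S i j) 0; first by rewrite mulr0 mul0r.
by rewrite mulrC (inj_eq (addIr k)).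
Qed.

Lemma based_sq11 : (mxop S1 \o mxop S1 = 0)%VF.
Proof. by rewrite mxop_comp S11 mxop0. Qed.

Lemma based_sq22 : (mxop S2 \o mxop S2 = mxop S1 \o mxop S2 \o mxop S1)%VF.
Proof. by rewrite !mxop_comp S22 mulmxA. Qed.

(* The module with basis e_0, ..., e_(n-1), e_i in degree [deg i], where S1 and
   S2 have the coordinates of Sq1 e_i and Sq2 e_i as their i-th rows. *)
Definition based : amod :=
  amod_of (undup_uniq _) based_pr_comp based_pr_sum
    (based_pr_sq deg1) (based_pr_sq deg2) based_sq11 based_sq22.

End Based.

Definition zero_mod : amod.
Proof.
refine (@based 0 (fun=> 0) 0 0 _ _ _ _); try by case.
  by rewrite mulmx0.
by rewrite !mulmx0.
Defined.

(* The trivial module F, in degree 0. *)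
Definition unit_mod : amod.
Proof.
refine (@based 1 (fun=> 0) 0 0 _ _ _ _).
- by move=> i j; rewrite mxE eqxx.
- by move=> i j; rewrite mxE eqxx.
- by rewrite mulmx0.
- by rewrite !mulmx0.
Defined.

Lemma A1deg_tab i (k l : 'I_8) : i \in [:: 1; 2]%N ->
  pmx 8 (A1tab i) k l != 0 -> A1deg l = A1deg k + i%:Z.
Proof.
move=> i12; rewrite mxE; case E: (A1tab i k == Some (l : nat)); last by rewrite eqxx.
move=> _; move/eqP: E i12; case: k => k k8; case: l => l l8 /=; rewrite !inE => e.
by case/orP => /eqP ei; move: e; rewrite ei;
  move: k k8 => [|[|[|[|[|[|[|[|k]]]]]]]] //= _ [<-].
Qed.

Lemma A1tab_lt i k l : (k < 8)%N -> A1tab i k = Some l -> (l < 8)%N.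
Proof.
by move: i k => [|[|[|i]]] [|[|[|[|[|[|[|[|k]]]]]]]] //= _ [<-].
Qed.

Lemma A1_11 : pmx 8 (A1tab 1) *m pmx 8 (A1tab 1) = 0.
Proof.
rewrite pmxM; last exact: A1tab_lt.
apply/matrixP => -[k k8] l; rewrite !mxE /=.
by move: k k8 => [|[|[|[|[|[|[|[|k]]]]]]]].
Qed.

Lemma A1_22 : pmx 8 (A1tab 2) *m pmx 8 (A1tab 2) =
  pmx 8 (A1tab 1) *m pmx 8 (A1tab 2) *m pmx 8 (A1tab 1).
Proof.
have lt2 i j k : (k < 8)%N -> forall l, obind (A1tab j) (A1tab i k) = Some l -> (l < 8)%N.
  move=> k8 l; case E: (A1tab i k) => [m|] //=.
  by apply: A1tab_lt; apply: A1tab_lt E.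
rewrite !pmxM; try by [exact: A1tab_lt | move=> k l h; apply: lt2].
apply/matrixP => -[k k8] l; rewrite !mxE /=.
by move: k k8 => [|[|[|[|[|[|[|[|k]]]]]]]].
Qed.

(* A(1) as a left module over itself, in its monomial basis. *)
Definition A1 : amod :=
  @based 8 (fun k => A1deg k) (pmx 8 (A1tab 1)) (pmx 8 (A1tab 2))
    (fun k l => @A1deg_tab 1 k l isT) (fun k l => @A1deg_tab 2 k l isT) A1_11 A1_22.

Definition A1one : A1 := (delta_mx 0 0 : 'rV['F_2]_8).

Lemma eq_ev (V : vectType 'F_2) (s t : nat -> 'End(V)) p : s =1 t -> ev s p = ev t p.
Proof.
move=> st; apply: eq_bigr => w _; congr (_ *: _).
by elim: (w : seq nat) => //= i v ->; rewrite st.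
Qed.

Lemma sqop_A1 i : sqop A1 i = mxop (pmx 8 (A1tab i)).
Proof.
case: i => [|[|[|i]]] //; rewrite /sqop /sqfam /= -(mxop0 8); congr mxop;
by apply/matrixP => k l; rewrite !mxE.
Qed.

(* [A1] is the subalgebra of the Steenrod algebra generated by Sq1 and Sq2: an
   element of F<Sq1, Sq2> vanishes in the Steenrod algebra if and only if it
   kills the element 1 of [A1], and 1 generates [A1]. *)
Lemma A1_faithful p : on12 p -> (steenrod0 p <-> ev (sqop A1) p A1one = 0).
Proof.
move=> hp; split=> [h0|h]; first by rewrite (sq_rel A1 hp h0) zero_lfunE.
apply: rel12_steenrod0; apply: nf_ideal => // k.
rewrite -(ev_run (T := A1tab)) // -(eq_ev p sqop_A1).
by apply: etrans (congr1 (fun x : 'rV['F_2]_8 => x 0 k) h) _; rewrite mxE.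
Qed.

Lemma A1_cyclic (x : A1) : exists2 p, on12 p & x = ev (sqop A1) p A1one.
Proof.
have h (k : 'I_8) : {p | on12 p & ev (sqop A1) p A1one = (delta_mx 0 k : 'rV['F_2]_8)}.
  have w12 : all (mem [:: 1; 2]%N) (A1word k).
    by case: k => -[|[|[|[|[|[|[|[|k]]]]]]]].
  exists << FMonom (A1word k) >>.
    by move=> w; rewrite msuppU1 inE => /eqP ->.
  rewrite (eq_ev _ sqop_A1) evU scale1r; apply: etrans (evw_run _ w12) _ => //.
  apply/rowP => l; rewrite !mxE eqxx /=; congr (nat_of_bool _)%:R.
  rewrite (_ : run12 _ = Some (k : nat)) 1?eq_sym //.
  by case: k {w12} => -[|[|[|[|[|[|[|[|k]]]]]]]].
exists (\sum_(k < 8) (x : 'rV['F_2]_8) 0 k *: s2val (h k)).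
  move=> w; rewrite -mcoeff_neq0 raddf_sum /=; apply: contraR => nw.
  rewrite big1 // => k _; rewrite mcoeffZ mcoeff_outdom ?mulr0 //.
  by apply: contra nw; apply: (s2valP (h k)).
rewrite ev_sum sum_lfunE {1}[x](row_sum_delta (x : 'rV['F_2]_8)).
by apply: eq_bigr => k _; rewrite evZ scale_lfunE (s2valP' (h k)).
Qed.

Section Susp.
Variables (k : int) (M : amod).

Lemma susp_pr_sum :
  \sum_(d <- [seq d + k | d <- degs M]) pr M (d - k) = \1%VF.
Proof.
rewrite big_map -(pr_sum M); apply: eq_bigr => d _.
by rewrite addrK.
Qed.

Lemma susp_pr_comp d e :
  (pr M (d - k) \o pr M (e - k))%VF = if d == e then pr M (d - k) else 0.
Proof. by rewrite pr_comp (inj_eq (addIr _)). Qed.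

Lemma susp_pr_sq1 d : (pr M (d + 1 - k) \o sq1 M = sq1 M \o pr M (d - k))%VF.
Proof. by rewrite addrAC pr_sq1. Qed.

Lemma susp_pr_sq2 d : (pr M (d + 2 - k) \o sq2 M = sq2 M \o pr M (d - k))%VF.
Proof. by rewrite addrAC pr_sq2. Qed.

Definition susp : amod :=
  @amod_of M [seq d + k | d <- degs M] (fun d => pr M (d - k)) (sq1 M) (sq2 M)
    (etrans (map_inj_uniq (addIr k) _) (degs_uniq M))
    susp_pr_comp susp_pr_sum susp_pr_sq1 susp_pr_sq2 (sq1sq1 M) (sq2sq2 M).

End Susp.

Lemma pr_out (M : amod) d : d \notin degs M -> pr M d = 0.
Proof.
move=> dM; rewrite -[LHS]comp_lfun1r -(pr_sum M).
have -> (s : seq int) : (pr M d \o \sum_(e <- s) pr M e = \sum_(e <- s) (pr M d \o pr M e))%VF.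
  by apply: (big_morph (fun f => (pr M d \o f)%VF)) => [f f'|];
    rewrite ?comp_lfunDr ?comp_lfun0r.
rewrite big_seq big1 // => e eM; rewrite pr_comp.
by case: eqP eM dM => // -> ->.
Qed.

Lemma pr_sumw (M : amod) (s : seq int) : uniq s -> {subset degs M <= s} ->
  \sum_(d <- s) pr M d = \1%VF.
Proof.
move=> us h; rewrite -(pr_sum M) [LHS](bigID (mem (degs M))) /=.
rewrite [X in _ + X]big1 ?addr0 => [|d /pr_out //].
rewrite -big_filter; apply: perm_big; apply: uniq_perm.
- exact: filter_uniq.
- exact: degs_uniq.
by move=> d; rewrite mem_filter; apply: andb_idr; apply: h.
Qed.

Section Dsum.
Variables M N : amod.

Definition dmap (f : 'End(M)) (g : 'End(N)) : 'End((M * N)%type) :=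
  linfun (fun x : M * N => (f x.1, g x.2)).

Lemma dmapE f g x : dmap f g x = (f x.1, g x.2).
Proof.
have lin : linear (fun x : M * N => (f x.1, g x.2)).
  by move=> c u v; rewrite /= !linearP.
pose L := GRing.isLinear.Build _ _ _ _ _ lin.
pose F : {linear (M * N)%type -> (M * N)%type} := HB.pack (fun x : M * N => (f x.1, g x.2)) L.
exact: (lfunE F).
Qed.

Lemma dmap_comp f g f' g' : (dmap f g \o dmap f' g' = dmap (f \o f') (g \o g'))%VF.
Proof. by apply/lfunP => x; rewrite comp_lfunE !dmapE /= !comp_lfunE. Qed.

Lemma dmap0 : dmap 0 0 = 0.
Proof. by apply/lfunP => x; rewrite dmapE !zero_lfunE. Qed.

Lemma dmapD f g f' g' : dmap (f + f') (g + g') = dmap f g + dmap f' g'.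
Proof. by apply/lfunP => x; rewrite add_lfunE !dmapE !add_lfunE. Qed.

Lemma dsum_pr_comp d e :
  (dmap (pr M d) (pr N d) \o dmap (pr M e) (pr N e))%VF =
    if d == e then dmap (pr M d) (pr N d) else 0.
Proof. by rewrite dmap_comp !pr_comp; case: eqP => // _; apply: dmap0. Qed.

Lemma dsum_pr_sum :
  \sum_(d <- undup (degs M ++ degs N)) dmap (pr M d) (pr N d) = \1%VF.
Proof.
have -> (s : seq int) : \sum_(d <- s) dmap (pr M d) (pr N d) =
    dmap (\sum_(d <- s) pr M d) (\sum_(d <- s) pr N d).
  elim: s => [|d s IH]; first by rewrite !big_nil dmap0.
  by rewrite !big_cons dmapD IH.
rewrite !pr_sumw ?undup_uniq //; last 2 first.
- by move=> d dN; rewrite mem_undup mem_cat dN orbT.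
- by move=> d dM; rewrite mem_undup mem_cat dM.
by apply/lfunP => -[x y]; rewrite dmapE !id_lfunE.
Qed.

Lemma dsum_pr_sq1 d : (dmap (pr M (d + 1)) (pr N (d + 1)) \o dmap (sq1 M) (sq1 N) =
  dmap (sq1 M) (sq1 N) \o dmap (pr M d) (pr N d))%VF.
Proof. by rewrite !dmap_comp !pr_sq1. Qed.

Lemma dsum_pr_sq2 d : (dmap (pr M (d + 2)) (pr N (d + 2)) \o dmap (sq2 M) (sq2 N) =
  dmap (sq2 M) (sq2 N) \o dmap (pr M d) (pr N d))%VF.
Proof. by rewrite !dmap_comp !pr_sq2. Qed.

Lemma dsum_sq11 : (dmap (sq1 M) (sq1 N) \o dmap (sq1 M) (sq1 N) = 0)%VF.
Proof. by rewrite dmap_comp !sq1sq1 dmap0. Qed.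

Lemma dsum_sq22 : (dmap (sq2 M) (sq2 N) \o dmap (sq2 M) (sq2 N) =
  dmap (sq1 M) (sq1 N) \o dmap (sq2 M) (sq2 N) \o dmap (sq1 M) (sq1 N))%VF.
Proof. by rewrite !dmap_comp !sq2sq2. Qed.

Definition dsum : amod :=
  amod_of (undup_uniq _) dsum_pr_comp dsum_pr_sum dsum_pr_sq1 dsum_pr_sq2
    dsum_sq11 dsum_sq22.

End Dsum.

Section Dual.
Variable M : amod.

Definition transp (f : 'End(M)) : 'End('Hom(M, ('F_2)^o)) :=
  linfun (fun phi : 'Hom(M, ('F_2)^o) => (phi \o f)%VF).

Lemma transpE f phi : transp f phi = (phi \o f)%VF.
Proof.
have lin : linear (fun phi : 'Hom(M, ('F_2)^o) => (phi \o f)%VF).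
  by move=> c u v; rewrite comp_lfunDl comp_lfunZl.
pose L := GRing.isLinear.Build _ _ _ _ _ lin.
pose F : {linear 'Hom(M, ('F_2)^o) -> 'Hom(M, ('F_2)^o)} :=
  HB.pack (fun phi : 'Hom(M, ('F_2)^o) => (phi \o f)%VF) L.
exact: (lfunE F).
Qed.

Lemma transp_comp f g : (transp f \o transp g = transp (g \o f))%VF.
Proof. by apply/lfunP => x; rewrite comp_lfunE !transpE comp_lfunA. Qed.

Lemma transp0 : transp 0 = 0.
Proof. by apply/lfunP => x; rewrite transpE comp_lfun0r zero_lfunE. Qed.

Lemma transpD f g : transp (f + g) = transp f + transp g.
Proof. by apply/lfunP => x; rewrite add_lfunE !transpE comp_lfunDr. Qed.

Lemma dual_pr_comp d e : (transp (pr M (- d)) \o transp (pr M (- e)))%VF =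
  if d == e then transp (pr M (- d)) else 0.
Proof.
rewrite transp_comp pr_comp (inj_eq oppr_inj) eq_sym.
by case: eqP => [->|_] //; apply: transp0.
Qed.

Lemma dual_pr_sum :
  \sum_(d <- [seq - d | d <- degs M]) transp (pr M (- d)) = \1%VF.
Proof.
rewrite big_map; under eq_bigr => d _ do rewrite opprK.
rewrite -(big_morph transp transpD transp0) pr_sum.
by apply/lfunP => x; rewrite transpE comp_lfun1r id_lfunE.
Qed.

Lemma dual_pr_sq1 d : (transp (pr M (- (d + 1))) \o transp (sq1 M) =
  transp (sq1 M) \o transp (pr M (- d)))%VF.
Proof. by rewrite !transp_comp -pr_sq1 opprD subrK. Qed.

Lemma dual_pr_sq2 d : (transp (pr M (- (d + 2))) \o transp (sq2 M) =
  transp (sq2 M) \o transp (pr M (- d)))%VF.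
Proof. by rewrite !transp_comp -pr_sq2 opprD subrK. Qed.

Lemma dual_sq11 : (transp (sq1 M) \o transp (sq1 M) = 0)%VF.
Proof. by rewrite transp_comp sq1sq1 transp0. Qed.

Lemma dual_sq22 : (transp (sq2 M) \o transp (sq2 M) =
  transp (sq1 M) \o transp (sq2 M) \o transp (sq1 M))%VF.
Proof. by rewrite !transp_comp sq2sq2 comp_lfunA. Qed.

(* (a phi)(x) = phi (chi(a) x), where the antipode chi fixes Sq1 and Sq2. *)
Definition dual : amod :=
  @amod_of 'Hom(M, ('F_2)^o) [seq - d | d <- degs M] (fun d => transp (pr M (- d)))
    (transp (sq1 M)) (transp (sq2 M))
    (etrans (map_inj_uniq oppr_inj _) (degs_uniq M))
    dual_pr_comp dual_pr_sum dual_pr_sq1 dual_pr_sq2 dual_sq11 dual_sq22.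

End Dual.

Lemma addrr2 (V : lmodType 'F_2) (x : V) : x + x = 0.
Proof.
rewrite -[x]scale1r -scalerDl (_ : 1 + 1 = 0 :> 'F_2) ?scale0r //.
exact/val_inj.
Qed.

Lemma cartan22 (M N : amod) (W : lmodType 'F_2) (P : M -> N -> W) (T1 T2 : W -> W) x y :
  (forall u v, T1 (u + v) = T1 u + T1 v) -> (forall u v, T2 (u + v) = T2 u + T2 v) ->
  (forall x y, T1 (P x y) = P (sq1 M x) y + P x (sq1 N y)) ->
  (forall x y, T2 (P x y) =
     P (sq2 M x) y + P (sq1 M x) (sq1 N y) + P x (sq2 N y)) ->
  (forall y, P 0 y = 0) -> (forall x, P x 0 = 0) ->
  T2 (T2 (P x y)) = T1 (T2 (T1 (P x y))).
Proof.
move=> D1 D2 E1 E2 P0l P0r.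
have s11 (L : amod) (z : L) : sq1 L (sq1 L z) = 0.
  by rewrite -comp_lfunE sq1sq1 zero_lfunE.
have s22 (L : amod) (z : L) : sq2 L (sq2 L z) = sq1 L (sq2 L (sq1 L z)).
  by rewrite -comp_lfunE sq2sq2 !comp_lfunE.
rewrite E2 !D2 !E2 !s11 !s22 P0l addr0.
rewrite E1 D2 !E2 !s11 P0l P0r !addr0 !D1 !E1 !s11 !(P0l, P0r) !(addr0, add0r).
by rewrite [LHS](AC (3*2*3) ((3*6)*(1*4*7*(2*(5*8))))) /= addrr2 add0r.
Qed.

Section Tensor.
Import VectorInternalTheory.
Variables M N : amod.

(* M (x) N is the space of matrices in the coordinates given by [v2r], the
   elementary tensor x (x) y being the outer product of x and y. *)
Definition tensT : vectType 'F_2 := 'M['F_2]_(dim M, dim N).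

Definition ptens (x : M) (y : N) : tensT := (v2r x)^T *m v2r y.

Definition tmap (f : 'End(M)) (g : 'End(N)) : 'End(tensT) :=
  linfun (fun X : 'M['F_2]_(dim M, dim N) =>
            (f2mx f)^T *m X *m f2mx g).

Lemma tmapE f g (X : 'M['F_2]_(dim M, dim N)) :
  tmap f g X = (f2mx f)^T *m X *m f2mx g.
Proof.
pose h (X : 'M['F_2]_(dim M, dim N)) := (f2mx f)^T *m X *m f2mx g.
have lin : linear h.
  by move=> c u v; rewrite /h mulmxDr mulmxDl -scalemxAr -scalemxAl.
pose L := GRing.isLinear.Build _ _ _ _ _ lin.
pose F : {linear 'M['F_2]_(dim M, dim N) ->
                 'M['F_2]_(dim M, dim N)} := HB.pack h L.
exact: (lfunE F).
Qed.

Lemma v2r_lfun (V W : vectType 'F_2) (f : 'Hom(V, W)) x :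
  v2r (f x) = v2r x *m f2mx f.
Proof. by rewrite unlock /= r2vK. Qed.

Lemma tmap_ptens f g x y : tmap f g (ptens x y) = ptens (f x) (g y).
Proof. by rewrite tmapE /ptens !v2r_lfun trmx_mul !mulmxA. Qed.

Lemma ptens_span (f g : 'End(tensT)) :
  (forall x y, f (ptens x y) = g (ptens x y)) -> f = g.
Proof.
move=> h; apply/lfunP => X.
rewrite [X](matrix_sum_delta (X : 'M['F_2]_(dim M, dim N))) !linear_sum /=.
apply: eq_bigr => i _; rewrite !linear_sum; apply: eq_bigr => j _; rewrite !linearZ.
congr (_ *: _); have := h (r2v (delta_mx 0 i)) (r2v (delta_mx 0 j)).
by rewrite /ptens !r2vK trmx_delta mul_delta_mx.
Qed.

Lemma ptensDl x x' y : ptens (x + x') y = ptens x y + ptens x' y.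
Proof. by rewrite /ptens !linearD mulmxDl. Qed.

Lemma ptensDr x y y' : ptens x (y + y') = ptens x y + ptens x y'.
Proof. by rewrite /ptens linearD mulmxDr. Qed.

Lemma ptens0l y : ptens 0 y = 0.
Proof. by rewrite /ptens !linear0 mul0mx. Qed.

Lemma ptens0r x : ptens x 0 = 0.
Proof. by rewrite /ptens linear0 mulmx0. Qed.

Lemma ptens_suml I (r : seq I) (F : I -> M) y :
  ptens (\sum_(i <- r) F i) y = \sum_(i <- r) ptens (F i) y.
Proof.
by apply: (big_morph (fun x => ptens x y)) => [x x'|];
  [apply: ptensDl | apply: ptens0l].
Qed.

Lemma ptens_sumr I (r : seq I) (F : I -> N) x :
  ptens x (\sum_(i <- r) F i) = \sum_(i <- r) ptens x (F i).
Proof.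
by apply: (big_morph (ptens x)) => [y y'|]; [apply: ptensDr | apply: ptens0r].
Qed.

Definition tens_degs : seq int := undup [seq d + e | d <- degs M, e <- degs N].

Definition tens_pr (d : int) : 'End(tensT) :=
  \sum_(e <- degs M) tmap (pr M e) (pr N (d - e)).

(* The diagonal action: Sq1 and Sq2 have coproducts Sq1 (x) 1 + 1 (x) Sq1 and
   Sq2 (x) 1 + Sq1 (x) Sq1 + 1 (x) Sq2. *)
Definition tens_sq1 : 'End(tensT) := tmap (sq1 M) \1%VF + tmap \1%VF (sq1 N).
Definition tens_sq2 : 'End(tensT) :=
  tmap (sq2 M) \1%VF + tmap (sq1 M) (sq1 N) + tmap \1%VF (sq2 N).

Lemma tens_prE d x y :
  tens_pr d (ptens x y) = \sum_(e <- degs M) ptens (pr M e x) (pr N (d - e) y).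
Proof. by rewrite sum_lfunE; apply: eq_bigr => e _; rewrite tmap_ptens. Qed.

Lemma tens_sq1E x y :
  tens_sq1 (ptens x y) = ptens (sq1 M x) y + ptens x (sq1 N y).
Proof. by rewrite add_lfunE !tmap_ptens !id_lfunE. Qed.

Lemma tens_sq2E x y : tens_sq2 (ptens x y) =
  ptens (sq2 M x) y + ptens (sq1 M x) (sq1 N y) + ptens x (sq2 N y).
Proof. by rewrite !add_lfunE !tmap_ptens !id_lfunE. Qed.

Lemma prprE (L : amod) d e (x : L) : pr L d (pr L e x) = if d == e then pr L d x else 0.
Proof. by rewrite -comp_lfunE pr_comp; case: eqP => // _; rewrite zero_lfunE. Qed.

Lemma hom_ptens (f g : 'End(tensT)) :
  (forall d e x y, pr M d x = x -> pr N e y = y -> f (ptens x y) = g (ptens x y)) ->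
  f = g.
Proof.
move=> h; apply: ptens_span => x y.
rewrite -[x](id_lfunE x) -[y](id_lfunE y) -(pr_sum M) -(pr_sum N) !sum_lfunE.
rewrite ptens_suml !linear_sum; apply: eq_bigr => d _.
rewrite ptens_sumr !linear_sum; apply: eq_bigr => e _.
by apply: (h d e); rewrite prprE eqxx.
Qed.

Lemma tens_pr_hom d u v x y : pr M u x = x -> pr N v y = y ->
  tens_pr d (ptens x y) = if d == u + v then ptens x y else 0.
Proof.
move=> hx hy; rewrite tens_prE.
have [uM|/pr_out u0] := boolP (u \in degs M); last first.
  rewrite -hx u0 zero_lfunE ptens0l if_same big1 // => e _.
  by rewrite linear0 ptens0l.
rewrite (bigD1_seq u) ?degs_uniq //= big1 ?addr0 => [|e eu]; last first.
  by rewrite -hx prprE (negPf eu) ptens0l.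
rewrite hx -{1}hy prprE subr_eq [v + u]addrC; case: eqP => [->|_].
  by rewrite addrAC subrr add0r hy.
by rewrite ptens0r.
Qed.

Lemma tens_pr_comp d e :
  (tens_pr d \o tens_pr e)%VF = if d == e then tens_pr d else 0.
Proof.
apply: hom_ptens => u v x y hx hy; rewrite comp_lfunE (tens_pr_hom e hx hy).
case: (eqVneq e (u + v)) => [->|ne].
  by case: eqP => [->|] //; rewrite (tens_pr_hom _ hx hy) zero_lfunE; case: eqP.
rewrite linear0; case: eqP => [->|_]; last by rewrite zero_lfunE.
by rewrite (tens_pr_hom _ hx hy) (negPf ne).
Qed.

Lemma tens_pr_sum : \sum_(d <- tens_degs) tens_pr d = \1%VF.
Proof.
apply: ptens_span => x y; rewrite sum_lfunE id_lfunE.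
under eq_bigr => d _ do rewrite tens_prE.
rewrite exchange_big /= -{2}[x](id_lfunE x) -(pr_sum M) sum_lfunE ptens_suml.
apply: eq_big_seq => u uM; rewrite -ptens_sumr; congr (ptens _ _).
rewrite -sum_lfunE -(big_map (fun d => d - u) xpredT (pr N)).
rewrite pr_sumw ?id_lfunE //.
  by rewrite (map_inj_uniq (addIr (- u))) undup_uniq.
move=> e eN; apply/mapP; exists (u + e); last by rewrite addrAC subrr add0r.
by rewrite mem_undup; apply/allpairsP; exists (u, e).
Qed.

Lemma pr_sq1_hom (L : amod) d (x : L) : pr L d x = x -> pr L (d + 1) (sq1 L x) = sq1 L x.
Proof. by move=> {2}<-; rewrite -!comp_lfunE pr_sq1. Qed.

Lemma pr_sq2_hom (L : amod) d (x : L) : pr L d x = x -> pr L (d + 2) (sq2 L x) = sq2 L x.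
Proof. by move=> {2}<-; rewrite -!comp_lfunE pr_sq2. Qed.

Lemma tens_pr_sq1 d : (tens_pr (d + 1) \o tens_sq1 = tens_sq1 \o tens_pr d)%VF.
Proof.
apply: hom_ptens => u v x y hx hy; rewrite !comp_lfunE tens_sq1E linearD /=.
rewrite (tens_pr_hom d hx hy) (tens_pr_hom _ (pr_sq1_hom hx) hy).
rewrite (tens_pr_hom _ hx (pr_sq1_hom hy)) addrAC addrA !(inj_eq (addIr 1)).
by case: eqP => _; rewrite ?tens_sq1E // linear0 addr0.
Qed.

Lemma tens_pr_sq2 d : (tens_pr (d + 2) \o tens_sq2 = tens_sq2 \o tens_pr d)%VF.
Proof.
apply: hom_ptens => u v x y hx hy; rewrite !comp_lfunE tens_sq2E !linearD /=.
rewrite (tens_pr_hom d hx hy) (tens_pr_hom _ (pr_sq2_hom hx) hy).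
rewrite (tens_pr_hom _ hx (pr_sq2_hom hy)).
rewrite (tens_pr_hom _ (pr_sq1_hom hx) (pr_sq1_hom hy)).
rewrite (_ : u + 1 + (v + 1) = u + v + 2); last by rewrite addrACA.
rewrite [u + 2 + v]addrAC [u + (v + 2)]addrA !(inj_eq (addIr 2)).
by case: eqP => _; rewrite ?tens_sq2E // linear0 !addr0.
Qed.

Lemma tens_sq11 : (tens_sq1 \o tens_sq1 = 0)%VF.
Proof.
apply: ptens_span => x y; rewrite comp_lfunE tens_sq1E linearD /= !tens_sq1E zero_lfunE.
rewrite -!comp_lfunE !sq1sq1 !zero_lfunE ptens0l ptens0r add0r addr0.
exact: addrr2.
Qed.

Lemma tens_sq22 : (tens_sq2 \o tens_sq2 = tens_sq1 \o tens_sq2 \o tens_sq1)%VF.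
Proof.
apply: ptens_span => x y; apply: etrans (comp_lfunE _ _ _) _.
apply: etrans _ (esym (etrans (comp_lfunE _ _ _) (comp_lfunE _ _ _))).
apply: (cartan22 (P := ptens)) => //.
- by move=> u v; apply: linearD.
- by move=> u v; apply: linearD.
- exact: tens_sq1E.
- exact: tens_sq2E.
- exact: ptens0l.
- exact: ptens0r.
Qed.

Definition tensor : amod :=
  amod_of (undup_uniq _) tens_pr_comp tens_pr_sum tens_pr_sq1 tens_pr_sq2
    tens_sq11 tens_sq22.

End Tensor.

Definition isop (M : amod) (f : 'End(M)) : Prop :=
  [\/ exists d, f = pr M d, f = sq1 M | f = sq2 M].

(* [stable U]: U is a graded submodule of M. *)
Definition stable (M : amod) (U : {vspace M}) : Prop :=
  forall f, isop f -> (f @: U <= U)%VS.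

Section Retract.
Variables (M : amod) (V : vectType 'F_2) (i : 'Hom(V, M)) (r : 'Hom(M, V)).
Let op (f : 'End(M)) : 'End(V) := (r \o f \o i)%VF.
Hypothesis ri : (r \o i = \1)%VF.
Hypothesis op2 : forall f g, isop f -> isop g -> (op f \o op g = op (f \o g))%VF.
Hypothesis op121 :
  (op (sq1 M) \o op (sq2 M) \o op (sq1 M) = op (sq1 M \o sq2 M \o sq1 M))%VF.

Let ispr d : isop (pr M d). Proof. by apply: Or31; exists d. Qed.
Let is1 : isop (sq1 M). Proof. exact: Or32. Qed.
Let is2 : isop (sq2 M). Proof. exact: Or33. Qed.

Let op0 : op 0 = 0.
Proof. by rewrite /op comp_lfun0r comp_lfun0l. Qed.

Let opD : {morph op : f g / f + g}.
Proof. by move=> f g; rewrite /op comp_lfunDr comp_lfunDl. Qed.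

Lemma retract_pr_comp d e :
  (op (pr M d) \o op (pr M e))%VF = if d == e then op (pr M d) else 0.
Proof. by rewrite op2 // pr_comp; case: eqP => // _; apply: op0. Qed.

Lemma retract_pr_sum : \sum_(d <- degs M) op (pr M d) = \1%VF.
Proof. by rewrite -(big_morph op opD op0) pr_sum /op comp_lfun1r. Qed.

Lemma retract_pr_sq1 d :
  (op (pr M (d + 1)) \o op (sq1 M) = op (sq1 M) \o op (pr M d))%VF.
Proof. by rewrite !op2 // pr_sq1. Qed.

Lemma retract_pr_sq2 d :
  (op (pr M (d + 2)) \o op (sq2 M) = op (sq2 M) \o op (pr M d))%VF.
Proof. by rewrite !op2 // pr_sq2. Qed.

Lemma retract_sq11 : (op (sq1 M) \o op (sq1 M) = 0)%VF.
Proof. by rewrite op2 // sq1sq1 op0. Qed.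

Lemma retract_sq22 : (op (sq2 M) \o op (sq2 M) =
  op (sq1 M) \o op (sq2 M) \o op (sq1 M))%VF.
Proof. by rewrite op121 op2 // sq2sq2. Qed.

Definition retract : amod :=
  amod_of (degs_uniq M) retract_pr_comp retract_pr_sum retract_pr_sq1
    retract_pr_sq2 retract_sq11 retract_sq22.

End Retract.

Section SubQuotient.
Variables (M : amod) (U : {vspace M}) (hU : stable U).

Definition sub_inj : 'Hom(subvs_of U, M) := linfun (@vsval _ _ U).
Definition sub_ret : 'Hom(M, subvs_of U) := linfun (vsproj U).

Lemma sub_ri : (sub_ret \o sub_inj = \1)%VF.
Proof. by apply/lfunP => x; rewrite comp_lfunE id_lfunE !lfunE /= vsvalK. Qed.

Lemma sub_iri f : isop f ->
  (sub_inj \o sub_ret \o f \o sub_inj = f \o sub_inj)%VF.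
Proof.
move=> hf; apply/lfunP => x; rewrite !comp_lfunE !lfunE /= vsprojK //.
by apply: (subvP (hU hf)); apply: memv_img; apply: subvsP.
Qed.

Lemma sub_op2 f g : isop g ->
  ((sub_ret \o f \o sub_inj) \o (sub_ret \o g \o sub_inj) =
   sub_ret \o (f \o g) \o sub_inj)%VF.
Proof.
move=> hg; rewrite -!comp_lfunA; congr (_ \o (_ \o _))%VF.
by rewrite -[in RHS](sub_iri hg) -!comp_lfunA.
Qed.

Definition sub : amod.
Proof.
refine (@retract M _ sub_inj sub_ret sub_ri (fun f g _ hg => sub_op2 f hg) _).
by rewrite !sub_op2 //; [apply: Or32 | apply: Or33].
Defined.

(* The quotient M / U, with underlying vector space the complement of U. *)
Definition quo_proj : 'Hom(M, subvs_of U^C) :=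
  (linfun (vsproj U^C) \o daddv_pi U^C U)%VF.
Definition quo_sec : 'Hom(subvs_of U^C, M) := linfun (@vsval _ _ U^C).

Lemma capCv : (U^C :&: U = 0)%VS. Proof. by rewrite capvC capv_compl. Qed.

Lemma quo_proj_sec : (quo_proj \o quo_sec = \1)%VF.
Proof.
apply/lfunP => x; rewrite /quo_proj !comp_lfunE id_lfunE !lfunE /=.
by rewrite daddv_pi_id ?capCv ?vsvalK // subvsP.
Qed.

Lemma quo_proj_ker x : (quo_proj x == 0) = (x \in U).
Proof.
have dx : daddv_pi U^C U x + daddv_pi U U^C x = x.
  by apply: daddv_pi_add; rewrite ?capCv // addvC addv_complf memvf.
apply/eqP/idP => [h|xU].
  move: h; rewrite comp_lfunE lfunE /= => /(congr1 (@vsval _ _ _)).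
  rewrite vsprojK ?memv_pi // => h; rewrite -dx h raddf0 add0r; exact: memv_pi.
move: dx; rewrite (daddv_pi_id _ xU) ?capv_compl // => /(canRL (addrK _)).
by rewrite subrr comp_lfunE => ->; rewrite linear0.
Qed.

Lemma quo_op2 f g : isop f ->
  ((quo_proj \o f \o quo_sec) \o (quo_proj \o g \o quo_sec) =
   quo_proj \o (f \o g) \o quo_sec)%VF.
Proof.
move=> hf; move: quo_proj quo_proj_sec quo_proj_ker => q q_sec q_ker.
apply/lfunP => x; rewrite !comp_lfunE; set y := g _.
have yU : quo_sec (q y) - y \in U.
  rewrite -q_ker linearB subr_eq0 /=; apply/eqP.
  by apply: etrans (esym (comp_lfunE _ _ _)) _; rewrite q_sec id_lfunE.
have : q (f (quo_sec (q y) - y)) == 0.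
  by rewrite q_ker; apply: (subvP (hU hf)); apply: memv_img.
by rewrite !linearB /= subr_eq0 => /eqP.
Qed.

Definition quo : amod.
Proof.
refine (@retract M _ quo_sec quo_proj quo_proj_sec (fun f g hf _ => quo_op2 g hf) _).
rewrite -[LHS]comp_lfunA !quo_op2 -?comp_lfunA //; [apply: Or32 | apply: Or33] => //.
Defined.

End SubQuotient.

Lemma ker_stable (M N : amod) (f : ahom M N) : stable (lker f).
Proof.
have K (u : 'End(M)) (v : 'End(N)) : (f \o u = v \o f)%VF -> (u @: lker f <= lker f)%VS.
  move=> e; apply/subvP => _ /memv_imgP[x + ->]; rewrite !memv_ker => /eqP fx.
  by rewrite -comp_lfunE e comp_lfunE fx linear0.
by move=> u [[d ->]|->|->]; apply: K; [apply: hom_pr | apply: hom_sq1 | apply: hom_sq2].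
Qed.

Definition ker (M N : amod) (f : ahom M N) : amod := sub (ker_stable f).

Definition cyc (M : amod) (x : M) : {vspace M} :=
  <<[seq evw (sqop M) (A1word k) x | k <- iota 0 8]>>%VS.

Lemma A1word12 k : all (mem [:: 1; 2]%N) (A1word k).
Proof.
by move: k => [|[|[|[|[|[|[|[|k]]]]]]]] //; rewrite /A1word /= nth_nil.
Qed.

Lemma on12_basis k : on12 (basis12 k).
Proof.
rewrite /basis12; have: all (mem [:: 1; 2]%N) (A1word k).
  exact: A1word12.
elim: (A1word k) => [_|i w IH] /=.
  by move=> w; rewrite msuppU1 inE => /eqP ->; rewrite fm1.
case/andP; rewrite !inE => /orP[] /eqP -> /IH h.
  exact: on12M on12_Sq1 h.
exact: on12M on12_Sq2 h.
Qed.

Lemma ev_basis (V : vectType 'F_2) (s : nat -> 'End(V)) k :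
  ev s (basis12 k) = evw s (A1word k).
Proof.
have := A1word12 k; rewrite /basis12; elim: (A1word k) => [_|i w IH /andP[i12 /IH e]]; first exact: ev1.
by case: i i12 => // i _; apply: etrans (evM _ _ _) _; rewrite ev_Sq12 e.
Qed.

Lemma sqop_basis (M : amod) i k : i \in [:: 1; 2]%N -> (k < 8)%N ->
  (sqop M i \o evw (sqop M) (A1word k))%VF =
    oapp (fun l => evw (sqop M) (A1word l)) 0 (A1tab i k).
Proof.
move=> i12 k8; have h := rel12_steenrod0 (tab12 i12 k8).
have oS : on12 (Sq i).
  by move: i12; rewrite !inE => /orP[] /eqP ->; [apply: on12_Sq1 | apply: on12_Sq2].
have oN o : on12 (nf o).
  by case: o => [l|]; [apply: on12_basis | move=> w; rewrite msupp0].
have e := sq_rel M (on12B (on12M oS (@on12_basis k)) (oN (A1tab i k))) h.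
move: e; rewrite -/(sqop M).
move=> /(etrans (esym (evD _ _ _))) /(etrans (congr1 (fun u => _ + u) (esym (evN _ _)))).
move/eqP; rewrite subr_eq0 => /eqP /(etrans (esym (evM _ _ _))).
rewrite ev_basis => e.
have -> : sqop M i = ev (sqop M) (Sq i) by case: i i12 {h oS e} => // i _; rewrite ev_Sq12.
by rewrite e; case: (A1tab i k) => [l|] /=; [apply: ev_basis | apply: ev0].
Qed.

Lemma evw_hom (M : amod) e (x : M) w : pr M e x = x ->
  pr M (e + (sumn w)%:Z) (evw (sqop M) w x) = evw (sqop M) w x.
Proof.
move=> hx; elim: w => [|i w IH] /=; first by rewrite addr0 id_lfunE hx.
rewrite comp_lfunE; move: (evw _ w x) IH => y hy.
move: i => [|[|[|i]]]; rewrite /sqop /sqfam /= ?zero_lfunE ?linear0 //.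
  rewrite PoszD addrA addrAC; exact: pr_sq1_hom.
rewrite PoszD addrA addrAC; exact: pr_sq2_hom.
Qed.

Lemma cyc_stable (M : amod) e (x : M) : pr M e x = x -> stable (cyc x).
Proof.
move=> hx f hf; rewrite /cyc limg_span; apply/span_subvP => y /mapP[z].
case/mapP => k; rewrite mem_iota add0n => /andP[_ k8] -> ->.
have inC l : (l < 8)%N -> evw (sqop M) (A1word l) x \in cyc x.
  by move=> l8; apply: memv_span; apply/mapP; exists l; rewrite ?mem_iota.
have sqC i : i \in [:: 1; 2]%N -> sqop M i (evw (sqop M) (A1word k) x) \in cyc x.
  move=> i12; rewrite -comp_lfunE sqop_basis //.
  case E: (A1tab i k) => [l|] /=; last by rewrite zero_lfunE mem0v.
  by apply: inC; apply: A1tab_lt E.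
case: hf => [[d ->]|->|->]; [|exact: (sqC 1%N)|exact: (sqC 2)].
rewrite -(evw_hom _ hx) prprE; case: eqP => [->|_]; last exact: mem0v.
by rewrite (evw_hom _ hx); apply: inC.
Qed.

Definition A1_12 : A1 := sq1 A1 (sq2 A1 A1one).

Lemma A1one_deg : pr A1 0 A1one = A1one.
Proof.
apply: etrans (mxopE _ _) _; rewrite -rowE; apply/rowP => j; rewrite !mxE eqxx /=.
by rewrite eq_sym; case: eqP => // <-.
Qed.

Lemma A1_12_deg : pr A1 3 A1_12 = A1_12.
Proof. exact: (pr_sq1_hom (pr_sq2_hom A1one_deg)). Qed.

Lemma A1_12_stable : stable (cyc A1_12).
Proof. exact: cyc_stable A1_12_deg. Qed.

(* A(1) Sq1 Sq2 is the left ideal [cyc A1_12]. *)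
Definition joker : amod := susp (- 2) (quo A1_12_stable).

Definition aug_fun : 'Hom(A1, unit_mod) :=
  linfun (mulmxr (delta_mx 0 0 : 'M['F_2]_(8, 1)) : 'rV['F_2]_8 -> 'rV['F_2]_1).

Lemma aug_funE (x : A1) :
  aug_fun x = ((x : 'rV['F_2]_8) *m delta_mx 0 0 : 'rV['F_2]_1).
Proof. exact: lfunE. Qed.

Lemma aug_pr d : (aug_fun \o pr A1 d = pr unit_mod d \o aug_fun)%VF.
Proof.
apply/lfunP => x; apply: etrans (comp_lfunE _ _ _) _.
apply: etrans _ (esym (comp_lfunE _ _ _)); apply: etrans (aug_funE _) _.
apply: etrans (congr1 (fun u : 'rV['F_2]_8 => u *m _) (mxopE _ _)) _.
apply: etrans _ (esym (mxopE _ _)).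
apply: etrans _ (congr1 (fun u : 'rV['F_2]_1 => u *m _) (esym (aug_funE x))).
rewrite -!mulmxA; congr (_ *m _); rewrite mul_diag_mx mul_mx_diag.
apply/matrixP => i j; rewrite !mxE mulrC.
by case: (eqVneq i 0) => [->|]; rewrite ?andbF ?mul0r.
Qed.

Lemma aug_sq (S : 'M['F_2]_8) (T : 'M['F_2]_1) :
  S *m (delta_mx 0 0 : 'M_(8, 1)) = 0 -> T = 0 ->
  (aug_fun \o (mxop S : 'End(A1)) = (mxop T : 'End(unit_mod)) \o aug_fun)%VF.
Proof.
move=> hS ->; rewrite mxop0 comp_lfun0l; apply/lfunP => x.
rewrite zero_lfunE; apply: etrans (comp_lfunE _ _ _) _; apply: etrans (aug_funE _) _.
apply: etrans (congr1 (fun u : 'rV['F_2]_8 => u *m _) (mxopE _ _)) _.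
by rewrite -mulmxA hS mulmx0.
Qed.

Lemma pmx_aug i : i \in [:: 1; 2]%N ->
  pmx 8 (A1tab i) *m (delta_mx 0 0 : 'M_(8, 1)) = 0.
Proof.
move=> i12; rewrite -colE; apply/matrixP => -[k k8] j; rewrite !mxE /=.
by move: i12; rewrite !inE => /orP[] /eqP ->;
  move: k k8 => [|[|[|[|[|[|[|[|k]]]]]]]].
Qed.

Definition aug : ahom A1 unit_mod :=
  AHom aug_pr (aug_sq (pmx_aug (i := 1) isT) erefl)
    (aug_sq (pmx_aug (i := 2) isT) erefl).

Definition OmegaF : amod := ker aug.

(* binom(n, i) = n (n - 1) ... (n - i + 1) / i!, for any integer n. *)
Definition binz (n : int) (i : nat) : int :=
  ((\prod_(j < i) (n - (j : nat)%:Z)) %/ (i`!)%:Z)%Z.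

Lemma binz1 n : binz n 1 = n.
Proof. by rewrite /binz big_ord1 subr0 divz1. Qed.

Lemma binz2 n : binz n 2 = ((n * (n - 1)) %/ 2)%Z.
Proof. by rewrite /binz !big_ord_recl big_ord0 subr0 mulr1. Qed.

Lemma intrF2 (n : int) : (n%:~R : 'F_2) = (odd `|n|)%:R.
Proof.
case: n => n; first by rewrite -natrF2.
rewrite NegzE mulrNz abszN.
have -> : (n.+1%:Z)%:~R = (odd n.+1)%:R :> 'F_2 by rewrite -natrF2.
by rewrite absz_nat; case: (odd n.+1); rewrite ?oppr0 //; apply/val_inj.
Qed.

Definition Psize (a b : int) : nat := if (a <= b)%R then (absz (b - a)).+1 else 0%N.

Definition Pmx (a : int) (n i : nat) : 'M['F_2]_n :=
  \matrix_(j, l) (if (l : nat) == (j + i)%N then (binz (a + (j : nat)%:Z) i)%:~R else 0).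

Lemma Pmx_deg a n i (j l : 'I_n) : Pmx a n i j l != 0 ->
  a + (l : nat)%:Z = a + (j : nat)%:Z + i%:Z.
Proof. by rewrite mxE; case: ifP => [/eqP ->|_]; rewrite ?eqxx // PoszD addrA. Qed.

Definition shmx n (i : nat) (c : nat -> 'F_2) : 'M['F_2]_n :=
  \matrix_(j, l) (if (l : nat) == (j + i)%N then c j else 0).

Lemma shmxM n i k c d :
  shmx n i c *m shmx n k d = shmx n (i + k) (fun j => c j * d (j + i)%N).
Proof.
apply/matrixP => j l; rewrite !mxE addnA; case: (ltnP (j + i) n) => [ltn|gen].
  rewrite (bigD1 (Ordinal ltn)) //= big1 ?addr0 => [|m mj]; rewrite !mxE /=.
    by rewrite eqxx; case: eqP => _; rewrite ?mulr0.
  rewrite (_ : ((m : nat) == _) = false) ?mul0r //.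
  by apply/eqP => e; move/negP: mj; apply; apply/eqP/val_inj.
rewrite big1 => [|m _]; last first.
  rewrite mxE (_ : ((m : nat) == _) = false) ?mul0r //.
  by apply/eqP => e; move: gen; rewrite -e leqNgt ltn_ord.
case: eqP => // e; move: (ltn_ord l); rewrite e; lia.
Qed.

Lemma eq_shmx n i c d : c =1 d -> shmx n i c = shmx n i d.
Proof. by move=> cd; apply/matrixP => j l; rewrite !mxE cd. Qed.

Lemma PmxE a n i : Pmx a n i = shmx n i (fun j => (binz (a + j%:Z) i)%:~R).
Proof. by []. Qed.

Lemma Pmx11 a n : Pmx a n 1 *m Pmx a n 1 = 0.
Proof.
rewrite !PmxE shmxM; apply/matrixP => j l; rewrite !mxE; case: eqP => // _.
rewrite !binz1 -intrM intrF2 abszM oddM PoszD addrA (_ : _ && _ = false) //.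
by move: (a + (j : nat)%:Z) => u; lia.
Qed.

Lemma binz2_mod4 n : exists q : int,
  [\/ n = 4 * q /\ binz n 2 = 2 * (q * (4 * q - 1)),
      n = 4 * q + 1 /\ binz n 2 = 2 * (q * (4 * q + 1)),
      n = 4 * q + 2 /\ binz n 2 = 2 * (4 * (q * q) + 3 * q) + 1 |
      n = 4 * q + 3 /\ binz n 2 = 2 * (4 * (q * q) + 5 * q + 1) + 1].
Proof.
have hb x : n * (n - 1) = x * 2 -> binz n 2 = x.
  by move=> e; rewrite binz2 e mulzK.
exists (n %/ 4)%Z; have := divz_eq n 4; set q := (n %/ 4)%Z.
have : (0 <= (n %% 4)%Z < 4)%R by rewrite modz_ge0 // ltz_pmod.
move: (n %% 4)%Z => r hr e.
have [r0|[r1|[r2|r3]]] : r = 0 \/ r = 1 \/ r = 2 \/ r = 3 by lia.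
- by constructor 1; split; [lia | apply: hb; nia].
- by constructor 2; split; [lia | apply: hb; nia].
- by constructor 3; split; [lia | apply: hb; nia].
- by constructor 4; split; [lia | apply: hb; nia].
Qed.

Lemma oddz_mod4 (u : int) :
  odd `|u| = ((u %% 4)%Z == 1) || ((u %% 4)%Z == 3).
Proof. lia. Qed.

Lemma odd_double_absz (x : int) : odd `|2 * x| = false.
Proof. by rewrite abszM oddM. Qed.

Lemma odd_double1_absz (x : int) : odd `|2 * x + 1| = true.
Proof. lia. Qed.

Lemma odd_binz2 u : odd `|binz u 2| = ((u %% 4)%Z == 2) || ((u %% 4)%Z == 3).
Proof.
have m4 (q r : int) : ((4 * q + r) %% 4)%Z = (r %% 4)%Z.
  by rewrite mulrC modzMDl.
have [q [] [-> ->]] := binz2_mod4 u.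
- by rewrite odd_double_absz -[4 * q]addr0 m4.
- by rewrite odd_double_absz m4.
- by rewrite odd_double1_absz m4.
- by rewrite odd_double1_absz m4.
Qed.

Lemma Pmx22 a n : Pmx a n 2 *m Pmx a n 2 = Pmx a n 1 *m Pmx a n 2 *m Pmx a n 1.
Proof.
rewrite !PmxE !shmxM; apply: eq_shmx => j; rewrite !binz1 -!intrM !intrF2.
congr (nat_of_bool _)%:R.
rewrite (_ : a + (j + 2)%N%:Z = a + j%:Z + 2); last by rewrite PoszD addrA.
rewrite (_ : a + (j + 1)%N%:Z = a + j%:Z + 1); last by rewrite PoszD addrA.
rewrite (_ : a + (j + (1 + 2))%N%:Z = a + j%:Z + 3); last by rewrite PoszD addrA.
move: (a + j%:Z) => u {a n j}.
rewrite !abszM !oddM !odd_binz2 !oddz_mod4.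
have : (0 <= (u %% 4)%Z < 4)%R by rewrite modz_ge0 // ltz_pmod.
rewrite -(modzDml u 1) -(modzDml u 2) -(modzDml u 3).
move: (u %% 4)%Z => r hr.
by have [->|[->|[->|->]]] : r = 0 \/ r = 1 \/ r = 2 \/ r = 3 by lia.
Qed.

(* P^b_a, with basis u^a, ..., u^b (zero when b < a): Sq^i u^n is
   binom(n, i) u^(n + i) if n + i <= b, and 0 otherwise. *)
Definition Pmod (a b : int) : amod :=
  @based (Psize a b) (fun j => a + (j : nat)%:Z)
    (Pmx a (Psize a b) 1) (Pmx a (Psize a b) 2)
    (fun j l => @Pmx_deg a (Psize a b) 1 j l)
    (fun j l => @Pmx_deg a (Psize a b) 2 j l)
    (Pmx11 a (Psize a b)) (Pmx22 a (Psize a b)).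

Definition reduced (M : amod) : Prop := (sq2 M \o sq2 M \o sq2 M)%VF = 0.

Definition free_mod (ds : seq int) : amod :=
  foldr (fun d F => dsum (susp d A1) F) zero_mod ds.

Definition is_free (M : amod) : Prop := exists ds, iso M (free_mod ds).

Definition is_red_part (M R : amod) : Prop :=
  reduced R /\ exists F, is_free F /\ iso M (dsum F R).

(* M^red is only well defined up to isomorphism: [red M] is an arbitrary choice. *)
Definition red (M : amod) : amod := epsilon (inhabits zero_mod) (is_red_part M).

Fixpoint tpow (M : amod) (n : nat) : amod :=
  if n is n'.+1 then tensor M (tpow M n') else unit_mod.

Definition Omega (n : int) (M : amod) : amod :=
  match n with
  | Posz n => red (tensor (tpow OmegaF n) M)
  | Negz n => red (tensor (tpow (dual OmegaF) n.+1) M)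
  end.

Definition nontrivial (M N : amod) (f : ahom M N) : Prop := (f : 'Hom(M, N)) <> 0.

(* The non-trivial morphism M -> F, when there is a unique one. *)
Definition to_unit (M : amod) : ahom M unit_mod :=
  epsilon (inhabits (hom0 M unit_mod))
    (fun f => nontrivial f /\ forall g : ahom M unit_mod, nontrivial g ->
       (g : 'Hom(M, unit_mod)) = f).

Definition Amod (k : nat) (eps : bool) : amod :=
  ker (to_unit (susp (- (k.+1)%:Z) (Omega k.+1 (tpow joker eps)))).

(* Main.v *)
(** Work in the stable category of A(1)-modules, where morphisms factoring
    through a free module are killed.  A(1) is a Frobenius algebra, so free
    modules are also injective, every module splits as free plus reduced, and
    stably isomorphic reduced modules are isomorphic: on a reduced module an
    endomorphism factoring through a free module has its image in the radical.
    Hence Omega^s J^eps can be computed from any short exact sequences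
    0 -> N -> P -> M -> 0 with P free.

    Given a module L with a functional lam on its bottom degree, let E L be the
    extension of Sigma^4 L by B = A(1)/A(1)Sq1 in which Sq1 of the bottom class
    of Sigma^4 L is the top class of B.  An exact sequence 0 -> Sigma N -> P ->
    M -> 0 with P free and compatible functionals yields an exact sequence
    0 -> Sigma E N -> A(1) + Sigma^4 P -> E M -> 0.  Starting from the four
    modules F, Sigma^-1 Omega F, J and Sigma^-1 Omega J, this gives
    Sigma^-s Omega^s J^eps = E^[s/2] of one of the four, according to s + 2 eps
    mod 4.  Applied to F or Sigma^-1 Omega J, E^e produces Sigma P_1^n with one
    more class below it, which is case (1).  Replacing B by D = A(1)/A(1)Sq2Sq1
    in the extension gives an exact sequence 0 -> Sigma ker(E N -> F) ->
    A(1) + Sigma^4 P -> E_D M -> 0, and E_D M is a suspension of P_3^n when M is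
    of the previous form, which is case (2). *)
From HB Require Import structures.
From Stdlib Require Import Classical ClassicalEpsilon.
Require Import Defs.
From mathcomp Require Import all_boot all_order all_algebra.
From mathcomp Require Import zify.

Set Implicit Arguments.
Unset Strict Implicit.
Unset Printing Implicit Defensive.

Import GRing.Theory.

Local Open Scope ring_scope.

(** * Additive maps and morphisms of modules *)

(** The extension by B imitates the 4-periodicity of the powers of u. The modules built from F and
    Sigma^-1 Omega J are suspensions of the span of u^-1, u^1, u^2, ..., u^n, with u^0 divided out.
    In E L the classes of B play u^-1, u^1, u^2, u^4, those of L move up by four exponents, and the
    glueing term is Sq1 u^3 = u^4. That a syzygy of E M is again some E N comes from one element of
    A(1), Sq2Sq1Sq2: it projects to the top class of B in A(1)/A(1)Sq1, and its Sq1 is the image of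
    the top class of B under right multiplication by Sq1. It thus carries the extension term at both
    ends. [red] and [to_unit] are arbitrary choices, so [Omega] and [Amod] cannot be computed with.
    They are recognised up to isomorphism: [Omega] by stable equivalence with an explicit reduced
    module, [Amod] by uniqueness of the morphism to F. Freeness of the tensor products that occur is
    detected by counting top classes rather than by an untwisting isomorphism. *)

Lemma oppF2 (V : lmodType 'F_2) (x : V) : - x = x.
Proof. by apply/eqP; rewrite eq_sym -subr_eq0 opprK addrr2. Qed.

Lemma F2P (c : 'F_2) : c = 0 \/ c = 1.
Proof. by case: c => -[|[|[]]] // i; [left|right]; apply: val_inj. Qed.

Section Additive.
Variables (V W : vectType 'F_2).
Implicit Types f : V -> W.

Definition addmap f := {morph f : x y / x + y}.

Lemma addmap0 f : addmap f -> f 0 = 0.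
Proof. by move=> fD; apply: (addrI (f 0)); rewrite -fD !addr0. Qed.

Lemma addmapZ f c x : addmap f -> f (c *: x) = c *: f x.
Proof. by move=> fD; case: (F2P c) => ->; rewrite ?scale1r ?scale0r ?addmap0. Qed.

Lemma addmap_sum f I (r : seq I) (P : pred I) (F : I -> V) : addmap f ->
  f (\sum_(i <- r | P i) F i) = \sum_(i <- r | P i) f (F i).
Proof. by move=> fD; apply: (big_morph f fD (addmap0 fD)). Qed.

Definition lin_of f of addmap f : 'Hom(V, W) := linfun f.

Lemma lin_ofE f (fD : addmap f) x : lin_of fD x = f x.
Proof.
have lin : linear f by move=> c u v; rewrite fD addmapZ.
pose L := GRing.isLinear.Build _ _ _ _ _ lin.
pose F : {linear V -> W} := HB.pack f L.
exact: (lfunE F).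
Qed.

Lemma lfun_addmap (f : 'Hom(V, W)) : addmap f.
Proof. by move=> x y; rewrite linearD. Qed.

Lemma addmap_inj f : addmap f -> (forall x, f x = 0 -> x = 0) -> injective f.
Proof.
move=> fD h x y e; apply/eqP; rewrite -subr_eq0 oppF2; apply/eqP/h.
by rewrite fD e addrr2.
Qed.

Lemma addmap_retract f : addmap f -> injective f ->
  exists2 g : W -> V, {morph g : x y / x + y} & cancel f g.
Proof.
move=> fD fI; exists (lin_of fD)^-1%VF => [x y|x]; first by rewrite linearD.
have h : lker (lin_of fD) == 0%VS by apply/lker0P => u v; rewrite !lin_ofE => /fI.
by rewrite -(lin_ofE fD) -comp_lfunE lker0_compVf // id_lfunE.
Qed.

Lemma addmap_section f : addmap f -> (forall y, exists x, f x = y) ->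
  exists2 g : W -> V, {morph g : x y / x + y} & cancel g f.
Proof.
move=> fD fS; exists (lin_of fD)^-1%VF => [x y|y]; first by rewrite linearD.
have [x <-] := fS y; rewrite -!(lin_ofE fD).
by rewrite -!comp_lfunE inv_lfun_def.
Qed.

Lemma addmap_inj_dim f : addmap f -> injective f ->
  (\dim {:V} <= \dim {:W})%N.
Proof.
move=> fD fI; rewrite -(@limg_ker_dim _ _ _ (lin_of fD) fullv).
have -> : lker (lin_of fD) = 0%VS by apply/eqP/lker0P => u v; rewrite !lin_ofE => /fI.
by rewrite capv0 dimv0 add0n dimvS // subvf.
Qed.

Lemma addmap_surj_dim f : addmap f -> (forall y, exists x, f x = y) ->
  (\dim {:W} <= \dim {:V})%N.
Proof.
move=> fD fS; rewrite -[X in (_ <= X)%N](@limg_ker_dim _ _ _ (lin_of fD) fullv).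
apply: leq_trans (leq_addl _ _); apply/dimvS/subvP => y _.
by have [x <-] := fS y; rewrite -(lin_ofE fD) memv_img // memvf.
Qed.

Lemma inj_dim_surj f : addmap f -> injective f ->
  (\dim {:W} <= \dim {:V})%N -> forall y, exists x, f x = y.
Proof.
move=> fD fI le y.
have k0 : lker (lin_of fD) = 0%VS by apply/eqP/lker0P => u v; rewrite !lin_ofE => /fI.
have e : (lin_of fD @: fullv)%VS = fullv.
  apply/eqP; rewrite eqEdim subvf /=.
  by have := limg_ker_dim (lin_of fD) fullv; rewrite k0 capv0 dimv0 add0n => ->.
have : y \in (lin_of fD @: fullv)%VS by rewrite e memvf.
by case/memv_imgP => x _ ->; exists x; rewrite lin_ofE.
Qed.

Lemma surj_dim_inj f : addmap f -> (forall y, exists x, f x = y) ->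
  (\dim {:V} <= \dim {:W})%N -> injective f.
Proof.
move=> fD fS le.
have e : (lin_of fD @: fullv)%VS = fullv.
  apply/eqP; rewrite eqEsubv subvf; apply/subvP => y _.
  by have [x <-] := fS y; rewrite -(lin_ofE fD) memv_img // memvf.
have := limg_ker_dim (lin_of fD) fullv; rewrite e capfv => d.
have : lker (lin_of fD) == 0%VS by rewrite -dimv_eq0; apply/eqP; lia.
by move/lker0P => h u v uv; apply: h; rewrite !lin_ofE.
Qed.

End Additive.

Lemma addmap_bij (V W : vectType 'F_2) (f : V -> W) : addmap f ->
  (forall x, f x = 0 -> x = 0) -> (forall y, exists x, f x = y) -> 
  exists g : W -> V, [/\ addmap g, cancel f g & cancel g f].
Proof.
move=> fD f0 fS; have [g gD fg] := addmap_section fD fS.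
by exists g; split=> // x; apply: (addmap_inj fD f0).
Qed.

Section Basics.
Variable M : amod.
Implicit Types x : M.

Lemma sq1_sq1 x : sq1 M (sq1 M x) = 0.
Proof. by rewrite -comp_lfunE sq1sq1 zero_lfunE. Qed.

Lemma sq2_sq2 x : sq2 M (sq2 M x) = sq1 M (sq2 M (sq1 M x)).
Proof. by rewrite -comp_lfunE sq2sq2 !comp_lfunE. Qed.

Lemma prsq1 d x : pr M (d + 1) (sq1 M x) = sq1 M (pr M d x).
Proof. by rewrite -!comp_lfunE pr_sq1. Qed.

Lemma prsq2 d x : pr M (d + 2) (sq2 M x) = sq2 M (pr M d x).
Proof. by rewrite -!comp_lfunE pr_sq2. Qed.

Lemma prsq1' d x : pr M d (sq1 M x) = sq1 M (pr M (d - 1) x).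
Proof. by rewrite -prsq1 subrK. Qed.

Lemma prsq2' d x : pr M d (sq2 M x) = sq2 M (pr M (d - 2) x).
Proof. by rewrite -prsq2 subrK. Qed.

Lemma sum_pr x : \sum_(d <- degs M) pr M d x = x.
Proof. by rewrite -sum_lfunE pr_sum id_lfunE. Qed.

Definition top x : M := sq2 M (sq2 M (sq2 M x)).

Lemma sq1D : addmap (sq1 M). Proof. exact: lfun_addmap. Qed.
Lemma sq2D : addmap (sq2 M). Proof. exact: lfun_addmap. Qed.
Lemma prD d : addmap (pr M d). Proof. exact: lfun_addmap. Qed.
Lemma topD : addmap top. Proof. by move=> x y; rewrite /top !linearD. Qed.

End Basics.

Lemma reducedP (M : amod) : reduced M <-> forall x : M, top x = 0.
Proof.
split=> [h x|h]; first by rewrite /top -!comp_lfunE h zero_lfunE.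
by apply/lfunP => x; rewrite zero_lfunE !comp_lfunE; apply: h.
Qed.

(* Additivity is enough: over F_2, additive maps are linear. *)
Definition mor (k : int) (M N : amod) (f : M -> N) :=
  [/\ addmap f, forall d x, f (pr M d x) = pr N (d + k) (f x),
      forall x, f (sq1 M x) = sq1 N (f x) & forall x, f (sq2 M x) = sq2 N (f x)].

Section Mor.
Variables (k : int) (M N : amod) (f : M -> N).
Hypothesis h : mor k f.

Lemma morD : addmap f. Proof. by case: h. Qed.
Lemma mor0 : f 0 = 0. Proof. exact: addmap0 morD. Qed.
Lemma mor_pr d x : f (pr M d x) = pr N (d + k) (f x). Proof. by case: h. Qed.
Lemma mor1 x : f (sq1 M x) = sq1 N (f x). Proof. by case: h. Qed.
Lemma mor2 x : f (sq2 M x) = sq2 N (f x). Proof. by case: h. Qed.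
Lemma mor_top x : f (top x) = top (f x). Proof. by rewrite /top !mor2. Qed.

Lemma mor_inv g : cancel f g -> cancel g f -> mor (- k) g.
Proof.
move=> fK gK; split=> [x y|d x|x|x]; apply: (can_inj fK);
  by rewrite ?morD ?mor_pr ?subrK ?mor1 ?mor2 !gK.
Qed.

Lemma mor_susp a b : mor (k + b - a) (f : susp a M -> susp b N).
Proof.
split=> [|d x||]; [exact: morD | | exact: mor1 | exact: mor2].
rewrite /= mor_pr; congr (pr N _ _); lia.
Qed.

End Mor.

Lemma mor_eq k (M N : amod) (f g : M -> N) : f =1 g -> mor k f -> mor k g.
Proof.
move=> e [fD fp f1 f2]; split=> [x y|d x|x|x]; rewrite -!e; [exact: fD|exact: fp|exact: f1|exact: f2].
Qed.

Lemma mor_comp k l (M N L : amod) (f : M -> N) (g : N -> L) :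
  mor k f -> mor l g -> mor (k + l) (fun x => g (f x)).
Proof.
move=> [fD fp f1 f2] [gD gp g1 g2]; split=> [x y|d x|x|x];
by rewrite ?fD ?gD ?fp ?gp ?f1 ?g1 ?f2 ?g2 ?addrA.
Qed.

Lemma mor_id (M : amod) : mor 0 (fun x : M => x).
Proof. by split=> // d x; rewrite addr0. Qed.

Lemma mor_zero k (M N : amod) : mor k (fun x : M => 0 : N).
Proof. by split=> [x y|d x|x|x]; rewrite ?linear0 ?addr0. Qed.

Lemma mor_add k (M N : amod) (f g : M -> N) : mor k f -> mor k g ->
  mor k (fun x => f x + g x).
Proof.
move=> [fD fp f1 f2] [gD gp g1 g2]; split=> [x y|d x|x|x]; rewrite ?fD ?gD ?fp ?gp ?f1 ?g1 ?f2 ?g2 ?linearD //.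
by rewrite addrACA.
Qed.

Lemma mor_comp0 (M N L : amod) (f : M -> N) (g : N -> L) :
  mor 0 f -> mor 0 g -> mor 0 (fun x => g (f x)).
Proof. exact: mor_comp. Qed.

Definition isom (M N : amod) := exists f : M -> N, exists g : N -> M,
  [/\ mor 0 f, mor 0 g, cancel f g & cancel g f].

Lemma ahom_mor (M N : amod) (f : ahom M N) : mor 0 f.
Proof.
split=> [|d x|x|x]; first exact: lfun_addmap.
- by rewrite -!comp_lfunE addr0 hom_pr.
- by rewrite -!comp_lfunE hom_sq1.
- by rewrite -!comp_lfunE hom_sq2.
Qed.

Lemma mor_ahom (M N : amod) (f : M -> N) : mor 0 f -> {g : ahom M N | g =1 f}.
Proof.
move=> h; have p d : (lin_of (morD h) \o pr M d = pr N d \o lin_of (morD h))%VF.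
  by apply/lfunP => x; rewrite !comp_lfunE !lin_ofE (mor_pr h) addr0.
have p1 : (lin_of (morD h) \o sq1 M = sq1 N \o lin_of (morD h))%VF.
  by apply/lfunP => x; rewrite !comp_lfunE !lin_ofE (mor1 h).
have p2 : (lin_of (morD h) \o sq2 M = sq2 N \o lin_of (morD h))%VF.
  by apply/lfunP => x; rewrite !comp_lfunE !lin_ofE (mor2 h).
by exists (AHom p p1 p2) => x /=; rewrite lin_ofE.
Qed.

Lemma isomP (M N : amod) : iso M N <-> isom M N.
Proof.
split=> [[f [g fK gK]]|[f [g [hf hg fK gK]]]].
  exists f, g; split=> //; first exact: ahom_mor.
  by rewrite -oppr0; apply: mor_inv gK => //; apply: ahom_mor.
have [F e] := mor_ahom hf; exists F; exists g => x; rewrite e //.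
Qed.

Lemma isom_refl (M : amod) : isom M M.
Proof. by exists id, id; split=> //; apply: mor_id. Qed.

Lemma isom_sym (M N : amod) : isom M N -> isom N M.
Proof. by move=> [f [g [? ? ? ?]]]; exists g, f. Qed.

Lemma isom_trans N M L : isom M N -> isom N L -> isom M L.
Proof.
move=> [f [g [hf hg fK gK]]] [f' [g' [hf' hg' fK' gK']]].
exists (fun x => f' (f x)), (fun x => g (g' x)); split.
- exact: mor_comp0.
- exact: mor_comp0.
- by move=> x; rewrite fK' fK.
- by move=> x; rewrite gK gK'.
Qed.

Lemma bij_isom (M N : amod) (f : M -> N) : mor 0 f -> (forall x, f x = 0 -> x = 0) ->
  (forall y, exists x, f x = y) -> isom M N.
Proof.
move=> hf f0 fS; have [g [gD fK gK]] := addmap_bij (morD hf) f0 fS.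
by exists f, g; split=> //; rewrite -oppr0; apply: mor_inv gK.
Qed.

Lemma isom_susp a b (M N : amod) : a = b -> isom M N -> isom (susp a M) (susp b N).
Proof.
move=> <- [f [g [hf hg fK gK]]]; exists f, g; split=> //.
  by have := mor_susp hf a a; rewrite add0r subrr.
by have := mor_susp hg a a; rewrite add0r subrr.
Qed.

Lemma isom_susp2 a b M : isom (susp a (susp b M)) (susp (a + b) M).
Proof.
have e d x : pr (susp (a + b) M) d x = pr (susp a (susp b M)) d x.
  by rewrite /=; congr (pr M _ _); lia.
by exists id, id; split=> //; split=> // d x; rewrite addr0 -?e ?e.
Qed.

Lemma isom_susp0 (M : amod) : isom (susp 0 M) M.
Proof. by exists id, id; split=> //; split=> // d x; rewrite addr0 /= subr0. Qed.

Section DsumMor.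
Variables M N : amod.

Lemma pr_dsum d (x : dsum M N) : pr (dsum M N) d x = (pr M d x.1, pr N d x.2).
Proof. exact: dmapE. Qed.
Lemma sq1_dsum (x : dsum M N) : sq1 (dsum M N) x = (sq1 M x.1, sq1 N x.2).
Proof. exact: dmapE. Qed.
Lemma sq2_dsum (x : dsum M N) : sq2 (dsum M N) x = (sq2 M x.1, sq2 N x.2).
Proof. exact: dmapE. Qed.

Lemma top_dsum (x : dsum M N) : top x = (top x.1, top x.2).
Proof. by rewrite /top !sq2_dsum. Qed.

Lemma mor_fst : mor 0 (fun x : dsum M N => x.1).
Proof. by split=> [x y|d x|x|x]; rewrite ?pr_dsum ?sq1_dsum ?sq2_dsum ?addr0. Qed.

Lemma mor_snd : mor 0 (fun x : dsum M N => x.2).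
Proof. by split=> [x y|d x|x|x]; rewrite ?pr_dsum ?sq1_dsum ?sq2_dsum ?addr0. Qed.

Lemma mor_pair k (L : amod) (f : L -> M) (g : L -> N) : mor k f -> mor k g ->
  mor k (fun x => (f x, g x) : dsum M N).
Proof.
move=> [fD fp f1 f2] [gD gp g1 g2]; split=> [x y|d x|x|x];
  rewrite ?pr_dsum ?sq1_dsum ?sq2_dsum /= ?fD ?gD ?fp ?gp ?f1 ?g1 ?f2 ?g2 //.
Qed.

Lemma mor_inl : mor 0 (fun x : M => (x, 0) : dsum M N).
Proof. by apply: mor_pair; [apply: mor_id | apply: mor_zero]. Qed.

Lemma mor_inr : mor 0 (fun x : N => (0, x) : dsum M N).
Proof. by apply: mor_pair; [apply: mor_zero | apply: mor_id]. Qed.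

Lemma mor_case k (L : amod) (f : M -> L) (g : N -> L) : mor k f -> mor k g ->
  mor k (fun x : dsum M N => f x.1 + g x.2).
Proof.
move=> [fD fp f1 f2] [gD gp g1 g2]; split=> [x y|d x|x|x];
  rewrite ?pr_dsum ?sq1_dsum ?sq2_dsum /= ?fD ?gD ?fp ?gp ?f1 ?g1 ?f2 ?g2 ?linearD //.
by rewrite addrACA.
Qed.

End DsumMor.

Lemma isom_dsum M N M' N' : isom M M' -> isom N N' -> isom (dsum M N) (dsum M' N').
Proof.
move=> [f [g [hf hg fK gK]]] [f' [g' [hf' hg' fK' gK']]].
exists (fun x => (f x.1, f' x.2)), (fun x => (g x.1, g' x.2)); split.
- apply: mor_pair; apply: (mor_comp0 (g := _)) => //; [exact: mor_fst|exact: mor_snd].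
- apply: mor_pair; apply: (mor_comp0 (g := _)) => //; [exact: mor_fst|exact: mor_snd].
- by case=> x y /=; rewrite fK fK'.
- by case=> x y /=; rewrite gK gK'.
Qed.

Lemma isom_dsumA (M N L : amod) : isom (dsum M (dsum N L)) (dsum (dsum M N) L).
Proof.
exists (fun x => ((x.1, x.2.1), x.2.2)), (fun x => (x.1.1, (x.1.2, x.2))); split.
- by split=> [x y|d x|x|x]; rewrite ?pr_dsum ?sq1_dsum ?sq2_dsum ?addr0.
- by split=> [x y|d x|x|x]; rewrite ?pr_dsum ?sq1_dsum ?sq2_dsum ?addr0.
- by case=> x [].
- by case=> -[].
Qed.

(** * Free modules *)

Section Words.
Variable M : amod.

Definition word (k : nat) (x : M) : M :=
  match k with
  | 0%N => x | 1%N => sq1 M x | 2%N => sq2 M x | 3%N => sq1 M (sq2 M x)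
  | 4%N => sq2 M (sq1 M x) | 5%N => sq1 M (sq2 M (sq1 M x))
  | 6%N => sq2 M (sq1 M (sq2 M x)) | 7%N => sq1 M (sq2 M (sq1 M (sq2 M x)))
  | _ => 0
  end.

Lemma top7 x : top x = word 7 x.
Proof. by rewrite /top sq2_sq2. Qed.

Lemma top7' x : top x = sq2 M (sq1 M (sq2 M (sq1 M x))).
Proof. by rewrite /top (sq2_sq2 x). Qed.

Lemma wordD k : addmap (@word k).
Proof.
move: k => [|[|[|[|[|[|[|[|k]]]]]]]] x y; by rewrite /= ?linearD ?addr0.
Qed.

Definition oword (o : option nat) (x : M) : M := oapp (fun l => word l x) 0 o.

Lemma sq2_top x : sq2 M (top x) = 0.
Proof. by rewrite /top (sq2_sq2 x) sq2_sq2 sq1_sq1 !linear0. Qed.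

Lemma sq1_word k x : sq1 M (word k x) = oword (A1tab 1 k) x.
Proof.
by move: k => [|[|[|[|[|[|[|[|k]]]]]]]]; rewrite /= ?sq1_sq1 ?linear0.
Qed.

Lemma sq2_word k x : sq2 M (word k x) = oword (A1tab 2 k) x.
Proof.
move: k => [|[|[|[|[|[|[|[|k]]]]]]]]; rewrite /= ?linear0 //; try exact: sq2_sq2.
- by rewrite sq2_sq2 sq1_sq1 !linear0.
- by rewrite -top7' top7.
- by rewrite sq2_sq2 sq1_sq1 !linear0.
- by rewrite -[sq1 M _]/(word 7 x) -top7 sq2_top.
Qed.

(** Right multiplication by Sq1 and Sq2 on the word basis, where [A1tab] is left multiplication. It
    is needed for maps into A(1) built from functionals, where words are precomposed with Sq1 and
    Sq2. *)
Definition rtab (i k : nat) : option nat :=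
  match i, k with
  | 1, 0 => Some 1 | 1, 2 => Some 4 | 1, 3 => Some 5 | 1, 6 => Some 7
  | 2, 0 => Some 2 | 2, 1 => Some 3 | 2, 2 => Some 5 | 2, 4 => Some 6
  | 2, 5 => Some 7
  | _, _ => None
  end%N.

Lemma word_sq1 k x : word k (sq1 M x) = oword (rtab 1 k) x.
Proof.
move: k => [|[|[|[|[|[|[|[|k]]]]]]]] //=; rewrite ?sq1_sq1 ?linear0 //.
  by rewrite -top7' top7.
by rewrite -sq2_sq2 -[LHS]/(top (sq1 M x)) top7' sq1_sq1 !linear0.
Qed.

Lemma word_sq2 k x : word k (sq2 M x) = oword (rtab 2 k) x.
Proof.
by move: k => [|[|[|[|[|[|[|[|k]]]]]]]] //=; rewrite ?sq2_sq2 ?sq1_sq1 ?linear0.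
Qed.

Definition word_deg (k : nat) : int := (nth 0 [:: 0; 1; 2; 3; 3; 4; 5; 6] k)%N%:Z.

Lemma pr_word d k x : pr M d (word k x) = word k (pr M (d - word_deg k) x).
Proof.
move: k => [|[|[|[|[|[|[|[|k]]]]]]]]; rewrite /= ?subr0 ?linear0 //;
 rewrite ?(prsq1', prsq2') -?addrA -?opprD //.
Qed.

End Words.

Lemma mor_word k (M N : amod) (f : M -> N) l x : mor k f -> f (word l x) = word l (f x).
Proof.
move=> h; move: l => [|[|[|[|[|[|[|[|l]]]]]]]]; rewrite /= ?(mor1 h, mor2 h) //.
exact: mor0 h.
Qed.

Lemma evw_word (M : amod) (x : M) k : (k < 8)%N -> evw (sqop M) (A1word k) x = word k x.
Proof.
by move: k => [|[|[|[|[|[|[|[|k]]]]]]]] //= _; rewrite ?comp_lfunE id_lfunE.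
Qed.

Definition coefA (k : nat) (a : A1) : 'F_2 := (a : 'rV['F_2]_8) 0 (inord k).

Lemma coefA_D k (a b : A1) : coefA k (a + b) = coefA k a + coefA k b.
Proof. exact: mxE. Qed.

Lemma coefA_inj (a b : A1) : (forall k, (k < 8)%N -> coefA k a = coefA k b) -> a = b.
Proof.
move=> h; apply/rowP => k; have := h k (ltn_ord k).
by rewrite /coefA inord_val.
Qed.

Definition A1row (F : nat -> 'F_2) : A1 := (\row_(k < 8) F k : 'rV['F_2]_8).

Lemma coefA_row F k : (k < 8)%N -> coefA k (A1row F) = F k.
Proof. by move=> k8; rewrite /coefA mxE inordK. Qed.

Lemma sum_ord8 (V : nmodType) (F : nat -> V) :
  \sum_(k < 8) F k = \sum_(k <- iota 0 8) F k.
Proof. by rewrite -(big_mkord xpredT). Qed.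

Lemma coefA_pmx (f : nat -> option nat) (x : 'rV['F_2]_8) l : (l < 8)%N ->
  coefA l (x *m pmx 8 f : 'rV['F_2]_8) = \sum_(k <- iota 0 8) coefA k x * (f k == Some l)%:R.
Proof.
move=> l8; rewrite -sum_ord8 /coefA mxE; apply: eq_bigr => k _.
by rewrite mxE inord_val inordK.
Qed.

Lemma coefA_sq1_sum l a : (l < 8)%N ->
  coefA l (sq1 A1 a) = \sum_(k <- iota 0 8) coefA k a * (A1tab 1 k == Some l)%:R.
Proof. by move=> l8; rewrite -coefA_pmx //; congr coefA; apply: mxopE. Qed.

Lemma coefA_sq2_sum l a : (l < 8)%N ->
  coefA l (sq2 A1 a) = \sum_(k <- iota 0 8) coefA k a * (A1tab 2 k == Some l)%:R.
Proof. by move=> l8; rewrite -coefA_pmx //; congr coefA; apply: mxopE. Qed.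

Lemma coefA_pr l d a : (l < 8)%N -> coefA l (pr A1 d a) = (word_deg l == d)%:R * coefA l a.
Proof.
move=> l8; rewrite /coefA (_ : pr A1 d a = (a : 'rV_8) *m diag_mx (\row_i (A1deg i == d)%:R)).
  rewrite mul_mx_diag !mxE mulrC inordK //; congr ((_ == d)%:R * _).
  by move: l l8 => [|[|[|[|[|[|[|[|l]]]]]]]].
exact: mxopE.
Qed.

Section FreeHom.
Variables (M : amod) (x : M) (d : int).
Hypothesis xd : pr M d x = x.

Definition free_hom (a : A1) : M := \sum_(k <- iota 0 8) coefA k a *: word k x.

Lemma free_homD : addmap free_hom.
Proof.
move=> a b; rewrite /free_hom -big_split; apply: eq_bigr => k _ /=.
by rewrite coefA_D scalerDl.
Qed.

Lemma free_hom_sq (i : nat) (s : A1 -> A1) : (forall k, A1tab i k = None \/ (oapp id 0 (A1tab i k) < 8)%N) ->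
  (forall l a, (l < 8)%N -> coefA l (s a) = \sum_(k <- iota 0 8) coefA k a * (A1tab i k == Some l)%:R) ->
  forall a, free_hom (s a) = \sum_(k <- iota 0 8) coefA k a *: oword (A1tab i k) x.
Proof.
move=> tlt hs a; rewrite /free_hom.
transitivity (\sum_(l <- iota 0 8) \sum_(k <- iota 0 8)
    (coefA k a * (A1tab i k == Some l)%:R) *: word l x).
  rewrite !big_seq; apply: eq_bigr => l; rewrite mem_iota => /andP[_ l8].
  by rewrite hs // scaler_suml.
rewrite exchange_big /=; apply: eq_bigr => k _.
under eq_bigr => l _ do rewrite -scalerA.
rewrite -scaler_sumr; congr (_ *: _).
case E: (A1tab i k) (tlt k) => [l|] /= [//|l8].
  rewrite (bigD1_seq l) ?iota_uniq //=; last by rewrite -[_ :: _]/(iota 0 8) mem_iota.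
  rewrite eqxx scale1r big1 ?addr0 // => j jl.
  rewrite (_ : (Some l == Some j) = false) ?scale0r //.
  by apply/eqP => -[e]; rewrite e eqxx in jl.
all: by move=> *; rewrite big1 // => j _; rewrite scale0r.
Qed.

Lemma free_hom_mor : mor d free_hom.
Proof.
split; first exact: free_homD.
- move=> e a; rewrite /free_hom linear_sum !big_seq; apply: eq_bigr => k.
  rewrite mem_iota => /andP[_ k8]; rewrite linearZ /= coefA_pr // pr_word -{2}xd prprE.
  case: (eqVneq (word_deg k) e) => [->|ke].
    by rewrite (addrC e) addrK eqxx xd mul1r.
  rewrite mul0r scale0r ifF ?(addmap0 (@wordD M k)) ?scaler0 //.
  by apply/eqP => ?; case/eqP: ke; lia.
- move=> a; rewrite (free_hom_sq (i := 1)); last exact: coefA_sq1_sum.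
    rewrite linear_sum; apply: eq_bigr => k _; rewrite linearZ /=.
    by rewrite sq1_word.
  by move=> [|[|[|[|[|[|[|[|k]]]]]]]]; (by left) || (by right).
- move=> a; rewrite (free_hom_sq (i := 2)); last exact: coefA_sq2_sum.
    rewrite linear_sum; apply: eq_bigr => k _; rewrite linearZ /=.
    by rewrite sq2_word.
  by move=> [|[|[|[|[|[|[|[|k]]]]]]]]; (by left) || (by right).
Qed.

End FreeHom.

Lemma coefA_A1one k : (k < 8)%N -> coefA k A1one = (k == 0%N)%:R.
Proof.
move=> k8; rewrite /coefA mxE eqxx /=; congr (_%:R).
by rewrite -val_eqE /= inordK.
Qed.

Lemma free_hom_one (M : amod) (x : M) : free_hom x A1one = x.
Proof.
rewrite /free_hom /= !big_cons big_nil !coefA_A1one //= scale1r.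
by rewrite !scale0r !addr0.
Qed.

Section CofreeHom.
Variables (M : amod) (lam : M -> 'F_2) (d : int).
Hypothesis lamD : {morph lam : x y / x + y}.
Hypothesis lamd : forall e x, lam (pr M e x) = (e == d + 6)%:R * lam x.

(* The dual of the word basis under the Frobenius form, the coefficient of the
   top class. *)
Definition dual_index (k : nat) : nat := nth 0 [:: 7; 6; 5; 3; 4; 2; 1; 0]%N k.

(** A(1) is self-dual, so a functional in degree d + 6 determines a map into A(1): the coefficient k
    of an element is the top coefficient of its product with the dual word, see [coefA7_word]. *)
Definition cofree_hom (m : M) : A1 := A1row (fun k => lam (word (dual_index k) m)).

Lemma functional0 : lam 0 = 0.
Proof. by apply: (addrI (lam 0)); rewrite -lamD !addr0. Qed.

Lemma word_deg_dual k : (k < 8)%N -> word_deg (dual_index k) = 6 - word_deg k.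
Proof. by move: k => [|[|[|[|[|[|[|[|k]]]]]]]]. Qed.

Lemma cofree_hom_mor : mor (- d) cofree_hom.
Proof.
split.
- by move=> x y; apply/rowP => k; rewrite !mxE wordD lamD.
- move=> e x; apply: coefA_inj => k k8; rewrite coefA_pr // !coefA_row //.
  have := pr_word (e + word_deg (dual_index k)) (dual_index k) x; rewrite addrK => <-.
  rewrite lamd word_deg_dual //; congr ((nat_of_bool _)%:R * _).
  by apply/eqP/eqP; lia.
- move=> x; apply: coefA_inj => k k8; rewrite coefA_sq1_sum // big_seq.
  under eq_bigr => j; first (rewrite mem_iota => /andP[_ j8]; rewrite coefA_row //; over).
  rewrite -big_seq /= coefA_row // !big_cons big_nil word_sq1.
  by move: k k8 => [|[|[|[|[|[|[|[|k]]]]]]]] //= _; rewrite !(mulr0, mulr1, add0r, addr0, functional0).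
- move=> x; apply: coefA_inj => k k8; rewrite coefA_sq2_sum // big_seq.
  under eq_bigr => j; first (rewrite mem_iota => /andP[_ j8]; rewrite coefA_row //; over).
  rewrite -big_seq /= coefA_row // !big_cons big_nil word_sq2.
  by move: k k8 => [|[|[|[|[|[|[|[|k]]]]]]]] //= _; rewrite !(mulr0, mulr1, add0r, addr0, functional0).
Qed.

End CofreeHom.

Lemma coefA_sq1 l a : (l < 8)%N -> coefA l (sq1 A1 a) =
  match l with 1%N => coefA 0 a | 3%N => coefA 2 a | 5%N => coefA 4 a | 7%N => coefA 6 a | _ => 0 end.
Proof.
move=> l8; rewrite coefA_sq1_sum //= !big_cons big_nil.
by move: l l8 => [|[|[|[|[|[|[|[|l]]]]]]]] //= _; rewrite !(mulr0, mulr1, add0r, addr0).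
Qed.

Lemma coefA_sq2 l a : (l < 8)%N -> coefA l (sq2 A1 a) =
  match l with 2%N => coefA 0 a | 4%N => coefA 1 a | 5%N => coefA 2 a | 6%N => coefA 3 a
             | 7%N => coefA 5 a | _ => 0 end.
Proof.
move=> l8; rewrite coefA_sq2_sum //= !big_cons big_nil.
by move: l l8 => [|[|[|[|[|[|[|[|l]]]]]]]] //= _; rewrite !(mulr0, mulr1, add0r, addr0).
Qed.

Lemma coefA_word_one l k : (l < 8)%N -> (k < 8)%N -> coefA l (word k A1one) = (k == l)%:R.
Proof.
move: k l => [|[|[|[|[|[|[|[|k]]]]]]]] [|[|[|[|[|[|[|[|l]]]]]]]] //= _ _;
  by rewrite ?(coefA_sq1, coefA_sq2) // coefA_A1one.
Qed.

Lemma coefA7_word k a : (k < 8)%N -> coefA 7 (word (dual_index k) a) = coefA k a.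
Proof.
by move: k => [|[|[|[|[|[|[|[|k]]]]]]]] //= _; rewrite ?(coefA_sq1, coefA_sq2).
Qed.

Lemma coefA_Z k c (a : A1) : coefA k (c *: a) = c * coefA k a.
Proof. exact: mxE. Qed.

Lemma coefA_0 k : coefA k 0 = 0.
Proof. exact: mxE. Qed.

Lemma A1_gen (a : A1) : a = free_hom A1one a.
Proof.
apply: coefA_inj => l l8; rewrite /free_hom.
rewrite (big_morph (coefA l) (@coefA_D l) (@coefA_0 l)) (bigD1_seq l) ?iota_uniq ?mem_iota //=.
rewrite coefA_Z coefA_word_one // eqxx mulr1 big_seq_cond big1 ?addr0 // => k.
rewrite -[_ :: _]/(iota 0 8) mem_iota => /andP[/andP[_ k8] /negPf kl].
by rewrite coefA_Z coefA_word_one // kl mulr0.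
Qed.

Lemma mor_A1 k (M : amod) (f : A1 -> M) a : mor k f -> f a = free_hom (f A1one) a.
Proof.
move=> h; rewrite {1}[a]A1_gen /free_hom (addmap_sum _ _ _ (morD h)).
by apply: eq_bigr => l _; rewrite (addmapZ _ _ (morD h)) (mor_word _ _ h).
Qed.

Lemma top_s1 (M : amod) (x : M) : top (sq1 M x) = 0.
Proof. by rewrite top7' sq1_sq1 !linear0. Qed.

Lemma top_s2 (M : amod) (x : M) : top (sq2 M x) = 0.
Proof. exact: sq2_top. Qed.

Lemma topZ (M : amod) c (x : M) : top (c *: x) = c *: top x.
Proof. by apply: addmapZ; apply: topD. Qed.

Lemma free_hom_split (M : amod) (x : M) a :
  exists u v, free_hom x a = coefA 0 a *: x + sq1 M u + sq2 M v.
Proof.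
exists (coefA 1 a *: x + coefA 3 a *: word 2 x + coefA 5 a *: word 4 x + coefA 7 a *: word 6 x).
exists (coefA 2 a *: x + coefA 4 a *: word 1 x + coefA 6 a *: word 3 x).
rewrite /free_hom !big_cons big_nil !linearD !linearZ /= addr0.
by rewrite !addrA [LHS](AC 8%N ((1*2*4*6*8)*3*5*7))%AC.
Qed.

Lemma A1_split (a : A1) : exists u v, a = coefA 0 a *: A1one + sq1 A1 u + sq2 A1 v.
Proof. by rewrite {1}[a]A1_gen; apply: free_hom_split. Qed.

Lemma A1_top (a : A1) : top a = coefA 0 a *: word 7 A1one.
Proof.
have [u [v e]] := A1_split a.
by rewrite {1}e !topD topZ top_s1 top_s2 !addr0 top7.
Qed.

Lemma dim_A1 : \dim {:A1} = 8%N.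
Proof. by rewrite dimvf. Qed.

Lemma dim_prod (V W : vectType 'F_2) :
  \dim {:(V * W)%type} = (\dim {:V} + \dim {:W})%N.
Proof. by rewrite !dimvf. Qed.

Definition projective (P : amod) := forall (X Y : amod) (p : X -> Y) (f : P -> Y),
  mor 0 p -> (forall y, exists x, p x = y) -> mor 0 f ->
  exists2 g : P -> X, mor 0 g & forall x, p (g x) = f x.

Definition injec (P : amod) := forall (X Y : amod) (i : X -> Y) (f : X -> P),
  mor 0 i -> injective i -> mor 0 f ->
  exists2 g : Y -> P, mor 0 g & forall x, g (i x) = f x.

(** The property of free modules that forces maps out of reduced modules into the radical. *)
Definition top_rad (P : amod) :=
  forall x : P, top x = 0 -> exists u v, x = sq1 P u + sq2 P v.

(** Bounds the rank of Sq2Sq2Sq2 by an eighth of the dimension, which counts free generators without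
    naming a basis. *)
Definition top_gen (P : amod) := exists (W : vectType 'F_2) (G : P -> W),
  [/\ addmap G, \dim {:P} = (8 * \dim {:W})%N & forall x, G x = 0 -> top x = 0].

Lemma mor_of_susp k d (M N : amod) (f : M -> N) :
  mor k (f : susp d M -> N) <-> mor (k + d) f.
Proof.
split=> -[fD fp f1 f2]; split=> // e x.
  by have := fp (e + d) x; rewrite /= addrK => ->; congr (pr N _ _); lia.
by rewrite /= fp; congr (pr N _ _); lia.
Qed.

Lemma mor_to_susp k d (M N : amod) (f : M -> N) :
  mor k (f : M -> susp d N) <-> mor (k - d) f.
Proof.
split=> -[fD fp f1 f2]; split=> // e x; rewrite fp /=; congr (pr N _ _); lia.
Qed.

Lemma A1_projective d : projective (susp d A1).
Proof.
move=> X Y p f hp pS /(mor_of_susp 0 d) hf; rewrite add0r in hf.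
have [x px] := pS (f A1one).
have hx : pr X d (pr X d x) = pr X d x by rewrite prprE eqxx.
exists (free_hom (pr X d x)); first by apply/(mor_of_susp 0 d); rewrite add0r; apply: free_hom_mor.
move=> a; rewrite (mor_A1 a hf).
have h := mor_comp (free_hom_mor hx) hp.
rewrite (mor_A1 a h); congr (free_hom _ a).
by rewrite free_hom_one (mor_pr hp) px -{2}A1one_deg (mor_pr hf) addr0 add0r.
Qed.

(** A linear retraction [r] of [i] need not be a morphism, but only the functional taking the top
    coefficient of [f] has to be extended along it; [cofree_hom] rebuilds a morphism from this
    functional. *)
Lemma A1_injec d : injec (susp d A1).
Proof.
move=> X Y i f hi iI /(mor_to_susp 0 d) hf; rewrite add0r in hf.
have [r rD rK] := addmap_retract (morD hi) iI.
pose lam y := coefA 7 (f (r (pr Y (d + 6) y))).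
have lamD : {morph lam : x y / x + y}.
  by move=> x y; rewrite /lam prD rD (morD hf) coefA_D.
have lam0' : lam 0 = 0 by apply: (addrI (lam 0)); rewrite -lamD !addr0.
have lamd e y : lam (pr Y e y) = (e == d + 6)%:R * lam y.
  rewrite /lam prprE; case: (eqVneq e (d + 6)) => _; first by rewrite mul1r.
  by rewrite mul0r (addmap0 rD) (mor0 hf) coefA_0.
exists (cofree_hom lam); first by apply/(mor_to_susp 0 d); rewrite add0r; apply: cofree_hom_mor.
move=> x; apply: coefA_inj => k k8; rewrite coefA_row // -(coefA7_word _ k8) -(mor_word _ _ hf).
rewrite -(mor_word _ _ hi) /lam -[d + 6]addr0 -(mor_pr hi) rK (mor_pr hf).
by rewrite coefA_pr // addrAC subrr add0r eqxx mul1r.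
Qed.

Lemma A1_top_rad d : top_rad (susp d A1).
Proof.
move=> a a0; have [u [v e]] := A1_split a; exists u, v.
have : coefA 7 (top (a : A1)) = 0 by rewrite [top _]a0 coefA_0.
rewrite A1_top coefA_Z coefA_word_one // mulr1 => c0.
by rewrite {1}e c0 scale0r add0r.
Qed.

Lemma A1_top_gen d : top_gen (susp d A1).
Proof.
exists ('F_2)^o, (coefA 0); split; first exact: coefA_D.
  by rewrite !dimvf.
by move=> a a0; apply: etrans (A1_top a) _; rewrite a0 scale0r.
Qed.

Definition good P := [/\ projective P, injec P, top_rad P & top_gen P].

Lemma good_dsum P Q : good P -> good Q -> good (dsum P Q).
Proof.
move=> [Pp Pi Pr [W [G [GD Gd Gt]]]] [Qp Qi Qr [W' [G' [GD' Gd' Gt']]]]; split.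
- move=> X Y p f hp pS hf.
  have [g hg gE] := Pp _ _ _ _ hp pS (mor_comp0 (mor_inl P Q) hf).
  have [g' hg' gE'] := Qp _ _ _ _ hp pS (mor_comp0 (mor_inr P Q) hf).
  exists (fun x => g x.1 + g' x.2); first exact: mor_case.
  move=> [x y] /=; rewrite (morD hp) gE gE' -(morD hf).
  by congr f; rewrite -[LHS]/((x + 0, 0 + y)) addr0 add0r.
- move=> X Y i f hi iI hf.
  have [g hg gE] := Pi _ _ _ _ hi iI (mor_comp0 hf (mor_fst P Q)).
  have [g' hg' gE'] := Qi _ _ _ _ hi iI (mor_comp0 hf (mor_snd P Q)).
  exists (fun x => (g x, g' x)); first exact: mor_pair.
  by move=> x; rewrite gE gE' -surjective_pairing.
- move=> [x y]; rewrite top_dsum /= => -[/Pr[u [v ->]] /Qr[u' [v' ->]]].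
  by exists (u, u'), (v, v'); rewrite sq1_dsum sq2_dsum.
- exists (W * W')%type, (fun x => (G x.1, G' x.2)); split.
  + by move=> x y; rewrite /= GD GD'.
  + by rewrite [LHS]dim_prod Gd Gd' -mulnDr -dim_prod.
  + by move=> x [/Gt e1 /Gt' e2]; rewrite top_dsum e1 e2.
Qed.

Lemma good_iso P Q : isom P Q -> good P -> good Q.
Proof.
move=> [f [g [hf hg fK gK]]] [Pp Pi Pr [W [G [GD Gd Gt]]]]; split.
- move=> X Y p h hp pS hh.
  have [l hl lE] := Pp _ _ _ _ hp pS (mor_comp0 hf hh).
  exists (fun x => l (g x)); first exact: mor_comp0.
  by move=> x; rewrite lE gK.
- move=> X Y i h hi iI hh.
  have [l hl lE] := Pi _ _ _ _ hi iI (mor_comp0 hh hg).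
  exists (fun x => f (l x)); first exact: mor_comp0.
  by move=> x; rewrite lE gK.
- move=> x x0; have /Pr[u [v e]] : top (g x) = 0 by rewrite -(mor_top hg) x0 (mor0 hg).
  by exists (f u), (f v); rewrite -(mor1 hf) -(mor2 hf) -(morD hf) -e gK.
- exists W, (fun x => G (g x)); split.
  + by move=> x y; rewrite (morD hg) GD.
  + rewrite -Gd; apply/eqP; rewrite eqn_leq.
    by rewrite (addmap_inj_dim (morD hg) (can_inj gK)) (addmap_inj_dim (morD hf) (can_inj fK)).
  + by move=> x /Gt h; rewrite -(gK x) -(mor_top hf) h (mor0 hf).
Qed.

Lemma zero_mod0 (x : zero_mod) : x = 0.
Proof. by apply/rowP => -[]. Qed.

Lemma good_zero : good zero_mod.
Proof.
split.
- move=> X Y p f hp _ hf; exists (fun=> 0); first exact: mor_zero.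
  by move=> x; rewrite (zero_mod0 x) (mor0 hf) (mor0 hp).
- move=> X Y i f _ _ _; exists (fun=> 0); first exact: mor_zero.
  by move=> x; rewrite (zero_mod0 (f x)).
- by move=> x _; exists 0, 0; rewrite !linear0 addr0 (zero_mod0 x).
- exists zero_mod, id; split=> //; first by rewrite !dimvf.
  by move=> x _; apply: zero_mod0.
Qed.

Lemma good_free_mod ds : good (free_mod ds).
Proof.
elim: ds => [|d ds IH]; first exact: good_zero.
apply: good_dsum IH; split; [exact: A1_projective | exact: A1_injec | exact: A1_top_rad |].
exact: A1_top_gen.
Qed.

Lemma free_good P : is_free P -> good P.
Proof. by case=> ds /isomP/isom_sym h; apply: good_iso h (good_free_mod ds). Qed.

Lemma is_free_iso P Q : isom P Q -> is_free P -> is_free Q.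
Proof.
move=> /isom_sym h [ds /isomP k]; exists ds; apply/isomP; exact: isom_trans h k.
Qed.

Lemma is_free_A1 d : is_free (susp d A1).
Proof.
exists [:: d]; apply/isomP; exists (fun x => (x, 0)), fst; split.
- exact: mor_inl.
- exact: mor_fst.
- by [].
- by case=> x y; rewrite (zero_mod0 y).
Qed.

Lemma free_mod_cat ds es : isom (dsum (free_mod ds) (free_mod es)) (free_mod (ds ++ es)).
Proof.
elim: ds => [|d ds IH] /=.
  exists snd, (fun x => (0, x)); split=> //; [exact: mor_snd | exact: mor_inr |].
  by case=> x y; rewrite (zero_mod0 x).
apply: isom_trans (isom_sym (isom_dsumA _ _ _)) _.
exact: isom_dsum (isom_refl _) IH.
Qed.

Lemma is_free_dsum P Q : is_free P -> is_free Q -> is_free (dsum P Q).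
Proof.
move=> [ds /isomP h] [es /isomP k]; exists (ds ++ es); apply/isomP.
exact: isom_trans (isom_dsum h k) (free_mod_cat ds es).
Qed.

Lemma isom_susp_dsum d M N : isom (susp d (dsum M N)) (dsum (susp d M) (susp d N)).
Proof.
by exists id, id; split=> //; split=> // e x; rewrite addr0.
Qed.

Lemma is_free_susp d P : is_free P -> is_free (susp d P).
Proof.
move=> [ds /isomP h]; apply: is_free_iso (isom_sym (isom_susp (erefl d) h)) _.
elim: ds {h} => [|e ds IH] /=.
  exists [::]; apply/isomP; exists id, id; split=> //; split=> // *.
  all: try by rewrite [LHS]zero_mod0 [RHS]zero_mod0.
apply: is_free_iso (isom_sym (isom_susp_dsum _ _ _)) _; apply: is_free_dsum IH.
apply: is_free_iso (isom_sym (isom_susp2 _ _ _)) _; exact: is_free_A1.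
Qed.

(** * Kernels, quotients and splitting off free summands *)

Lemma sub_op (M : amod) (U : {vspace M}) (hU : stable U) (f : 'End(M)) (x : subvs_of U) :
  isop f -> vsval ((sub_ret U \o f \o sub_inj U)%VF x) = f (vsval x).
Proof.
move=> hf; have := congr1 (fun g : 'Hom(subvs_of U, M) => g x) (sub_iri hU hf).
by rewrite !comp_lfunE !(lfunE vsval).
Qed.

Lemma sub_mor (M : amod) (U : {vspace M}) (hU : stable U) :
  mor 0 (vsval : sub hU -> M).
Proof.
split.
- by move=> x y; rewrite linearD.
- by move=> d x; rewrite addr0; apply: sub_op => //; apply: Or31; exists d.
- by move=> x; apply: sub_op => //; apply: Or32.
- by move=> x; apply: sub_op => //; apply: Or33.
Qed.

Lemma quo_proj_op (M : amod) (U : {vspace M}) (hU : stable U) (f : 'End(M)) x :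
  isop f -> quo_proj U (f x) = (quo_proj U \o f \o quo_sec U)%VF (quo_proj U x).
Proof.
move: (quo_proj U) (quo_proj_sec U) (@quo_proj_ker _ U) => q q_sec q_ker hf.
rewrite !comp_lfunE; set z := quo_sec U _.
have zU : x - z \in U.
  rewrite -q_ker linearB subr_eq0 /=; apply/eqP.
  by rewrite /z -[RHS]comp_lfunE q_sec id_lfunE.
have : q (f (x - z)) == 0.
  by rewrite q_ker; apply: (subvP (hU _ hf)); apply: memv_img.
by rewrite !linearB /= subr_eq0 => /eqP.
Qed.

Lemma quo_mor (M : amod) (U : {vspace M}) (hU : stable U) :
  mor 0 (quo_proj U : M -> quo hU).
Proof.
split.
- exact: lfun_addmap.
- by move=> d x; rewrite addr0; apply: quo_proj_op => //; apply: Or31; exists d.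
- by move=> x; apply: quo_proj_op => //; apply: Or32.
- by move=> x; apply: quo_proj_op => //; apply: Or33.
Qed.

Lemma quo_proj_surj (M : amod) (U : {vspace M}) y : exists x : M, quo_proj U x = y.
Proof. by exists (quo_sec U y); apply: etrans (esym (comp_lfunE _ _ _)) _; rewrite quo_proj_sec id_lfunE. Qed.

Definition subker (M N : amod) (f : M -> N) (h : mor 0 f) : amod := ker (sval (mor_ahom h)).
Definition subinj (M N : amod) (f : M -> N) (h : mor 0 f) : subker h -> M := vsval.

Section Kernel.
Variables (M N : amod) (f : M -> N).
Hypothesis h : mor 0 f.

Lemma subinj_mor : mor 0 (@subinj M N f h). Proof. exact: sub_mor. Qed.

Lemma subinj_inj : injective (@subinj M N f h).
Proof. exact: val_inj. Qed.

Lemma subinj_ker x : f (@subinj M N f h x) = 0.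
Proof.
by have := subvsP x; rewrite memv_ker => /eqP; rewrite (svalP (mor_ahom h)).
Qed.

Lemma subinj_im x : f x = 0 -> exists y, @subinj M N f h y = x.
Proof.
move=> x0; have xk : x \in lker (sval (mor_ahom h)).
  by rewrite memv_ker (svalP (mor_ahom h)) x0.
by exists (Subvs xk).
Qed.

End Kernel.

Lemma dim_isom (M N : amod) : isom M N -> \dim {:M} = \dim {:N}.
Proof.
move=> [f [g [hf hg fK gK]]]; apply/eqP; rewrite eqn_leq.
by rewrite (addmap_inj_dim (morD hf) (can_inj fK)) (addmap_inj_dim (morD hg) (can_inj gK)).
Qed.

(** A linear retraction of [j] serves as the lift: as [j] is injective, compatibility with the
    operations can be tested after applying [j]. *)
Lemma ker_lift (M N K : amod) (j : K -> M) (f : N -> M) : mor 0 j -> injective j ->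
  mor 0 f -> (forall x, exists k, j k = f x) ->
  exists2 g : N -> K, mor 0 g & forall x, j (g x) = f x.
Proof.
move=> hj jI hf fj; have [r rD rK] := addmap_retract (morD hj) jI.
have jr x : j (r (f x)) = f x by have [k <-] := fj x; rewrite rK.
exists (fun x => r (f x)) => //; split.
- by move=> x y; rewrite (morD hf) rD.
- move=> d x; apply: jI; rewrite jr (mor_pr hf) addr0.
  by rewrite (mor_pr hj) addr0 jr.
- by move=> x; apply: jI; rewrite jr (mor1 hf) (mor1 hj) jr.
- by move=> x; apply: jI; rewrite jr (mor2 hf) (mor2 hj) jr.
Qed.

Lemma coker_desc (M N Q : amod) (p : M -> Q) (f : M -> N) : mor 0 p ->
  (forall y, exists x, p x = y) -> mor 0 f -> (forall x, p x = 0 -> f x = 0) ->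
  exists2 g : Q -> N, mor 0 g & forall x, g (p x) = f x.
Proof.
move=> hp pS hf fp; have [s sD sK] := addmap_section (morD hp) pS.
have fs x : f (s (p x)) = f x.
  apply/eqP; rewrite -subr_eq0 oppF2 -(morD hf); apply/eqP/fp.
  by rewrite (morD hp) sK addrr2.
exists (fun x => f (s x)) => //; split.
- by move=> x y; rewrite sD (morD hf).
- move=> d y; have [x <-] := pS y; have := mor_pr hp d x; rewrite !addr0 => <-.
  by rewrite !fs (mor_pr hf) addr0.
- by move=> y; have [x <-] := pS y; rewrite -(mor1 hp) !fs (mor1 hf).
- by move=> y; have [x <-] := pS y; rewrite -(mor2 hp) !fs (mor2 hf).
Qed.

Lemma split_isom (A M : amod) (i : A -> M) (r : M -> A) : mor 0 i -> mor 0 r ->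
  cancel i r -> exists K, isom M (dsum A K).
Proof.
move=> hi hr iK; exists (subker hr).
have hj := subinj_mor hr.
apply: isom_sym; apply: (bij_isom (mor_case hi hj)).
- move=> [a k] /= e.
  have a0 : a = 0.
    by rewrite -(mor0 hr) -e (morD hr) iK subinj_ker addr0.
  rewrite a0 (mor0 hi) add0r in e.
  by congr (_, _) => //; apply: (subinj_inj (h := hr)); rewrite e (mor0 hj).
- move=> y; have [k kE] : exists k, @subinj _ _ _ hr k = y - i (r y).
    by apply: subinj_im; rewrite oppF2 (morD hr) iK addrr2.
  by exists (r y, k); rewrite /= kE addrC subrK.
Qed.

Section Functional.
Import VectorInternalTheory.

Lemma functional (V : vectType 'F_2) (y : V) : y <> 0 ->
  exists2 l : V -> 'F_2, {morph l : u v / u + v} & l y = 1.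
Proof.
move=> y0.
have [j jy] : exists j, v2r y 0 j <> 0.
  apply: NNPP => h; apply: y0.
  apply: (@v2r_inj _ V); apply/rowP => j.
  by rewrite linear0 [RHS]mxE; apply: NNPP => e; apply: h; exists j.
exists (fun u => v2r u 0 j) => [u v|]; first by rewrite linearD mxE.
by have [] := F2P (v2r y 0 j).
Qed.

End Functional.

(** A homogeneous x with nonzero top class generates a free summand: a functional equal to 1 on this
    top class gives a map back to A(1) carrying x to 1. Splitting it off lowers the dimension by
    8. *)
Lemma red_exists (M : amod) : exists2 R, reduced R & exists ds, isom M (dsum (free_mod ds) R).
Proof.
have [n] := ubnP (\dim {:M}); elim: n M => // n IH M; rewrite ltnS => dM.
case: (classic (reduced M)) => [rM|nrM].
  exists M => //; exists [::]; apply: isom_sym.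
  exists snd, (fun x => (0, x)); split=> //; [exact: mor_snd | exact: mor_inr |].
  by case=> x y; rewrite (zero_mod0 x).
have [x0 hx0] : exists x : M, top x <> 0.
  apply: NNPP => h; apply: nrM; apply/reducedP => x.
  by apply: NNPP => tx; apply: h; exists x.
have [d hd] : exists d, top (pr M d x0) <> 0.
  apply: NNPP => h; apply: hx0.
  rewrite -{1}(sum_pr x0) (addmap_sum _ _ _ (@topD M)) big1 // => d _.
  by apply: NNPP => tx; apply: h; exists d.
set x := pr M d x0 in hd; have xd : pr M d x = x by rewrite prprE eqxx.
have [l lD l1] := functional hd.
pose lam m := l (pr M (d + 6) m).
have l0 : l 0 = 0 by apply: (addrI (l 0)); rewrite -lD !addr0.
have lamD : {morph lam : x y / x + y} by move=> u v; rewrite /lam prD lD.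
have lamd e y : lam (pr M e y) = (e == d + 6)%:R * lam y.
  rewrite /lam prprE; case: (eqVneq e (d + 6)) => _; first by rewrite mul1r.
  by rewrite mul0r l0.
have hi : mor 0 (free_hom x : susp d A1 -> M).
  by apply/mor_of_susp; rewrite add0r; apply: free_hom_mor.
have hr : mor 0 (cofree_hom lam : M -> susp d A1).
  by apply/mor_to_susp; rewrite add0r; apply: cofree_hom_mor.
have iK : cancel (free_hom x : susp d A1 -> M) (cofree_hom lam).
  have h : mor 0 (fun a : A1 => cofree_hom lam (free_hom x a) : A1).
    by have := mor_comp (free_hom_mor xd) (cofree_hom_mor lamD lamd); rewrite subrr.
  have e1 : cofree_hom lam x = A1one.
    apply: coefA_inj => k k8.
    rewrite coefA_A1one // -[x]xd (mor_pr (cofree_hom_mor lamD lamd)) subrr coefA_pr //.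
    (* In degree 0 only the coefficient of 1 survives. Its dual word is the top word, so it equals
       [l (top x)], which is 1. *)
    move: k k8 => [|[|[|[|[|[|[|[|k]]]]]]]] //= _; rewrite ?mul0r // mul1r coefA_row //=.
    rewrite /lam -[sq1 M _]/(word 7 x) -top7 /top !prsq2'.
    by rewrite (_ : d + 6 - 2 - 2 - 2 = d) ?xd //; lia.
  by move=> a; have e := mor_A1 a h; rewrite free_hom_one e1 -A1_gen in e.
have [K hK] := split_isom hi hr iK.
have dK : (\dim {:K} < n)%N.
  apply: leq_trans dM; rewrite (dim_isom hK) [X in (_ < X)%N]dim_prod.
  by rewrite -[\dim {:susp d A1}]/(\dim {:A1}) dim_A1; lia.
have [R rR [ds hR]] := IH K dK; exists R => //; exists (d :: ds) => /=.
apply: isom_trans hK _; apply: isom_trans _ (isom_dsumA _ _ _).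
exact: isom_dsum (isom_refl _) hR.
Qed.

(** * The stable category *)

Definition fac_free (M N : amod) (h : M -> N) := exists P, is_free P /\
  exists (a : M -> P) (b : P -> N), [/\ mor 0 a, mor 0 b & forall x, h x = b (a x)].

Lemma fac_eq (M N : amod) (h k : M -> N) : h =1 k -> fac_free h -> fac_free k.
Proof.
move=> e [P [Pf [a [b [ha hb ab]]]]]; exists P; split=> //; exists a, b; split=> // x.
by rewrite -e.
Qed.

Lemma is_free_zero : is_free zero_mod.
Proof. by exists [::]; apply/isomP; apply: isom_refl. Qed.

Lemma fac_zero (M N : amod) (h : M -> N) : (forall x, h x = 0) -> fac_free h.
Proof.
move=> h0; exists zero_mod; split; first exact: is_free_zero.
by exists (fun=> 0), (fun=> 0); split=> //; apply: mor_zero.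
Qed.

Lemma fac_add (M N : amod) (h k : M -> N) : fac_free h -> fac_free k -> fac_free (fun x => h x + k x).
Proof.
move=> [P [Pf [a [b [ha hb ab]]]]] [Q [Qf [c [d [hc hd cd]]]]].
exists (dsum P Q); split; first exact: is_free_dsum.
exists (fun x => (a x, c x)), (fun x => b x.1 + d x.2); split.
- exact: mor_pair.
- exact: mor_case.
- by move=> x; rewrite ab cd.
Qed.

Lemma fac_pre (L M N : amod) (f : L -> M) (h : M -> N) : mor 0 f -> fac_free h ->
  fac_free (fun x => h (f x)).
Proof.
move=> hf [P [Pf [a [b [ha hb ab]]]]]; exists P; split=> //.
by exists (fun x => a (f x)), b; split=> //; apply: mor_comp0.
Qed.

Lemma fac_post (L M N : amod) (f : N -> L) (h : M -> N) : mor 0 f -> fac_free h ->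
  fac_free (fun x => f (h x)).
Proof.
move=> hf [P [Pf [a [b [ha hb ab]]]]]; exists P; split=> //.
exists a, (fun x => f (b x)); split=> // [|x]; first exact: mor_comp0.
by rewrite ab.
Qed.

(* Isomorphism in the stable category; the sums are differences in
   characteristic 2. *)
Definition stable_iso (M N : amod) := exists (f : M -> N) (g : N -> M),
  [/\ mor 0 f, mor 0 g, fac_free (fun x => g (f x) + x) & fac_free (fun y => f (g y) + y)].

Lemma steq_sym M N : stable_iso M N -> stable_iso N M.
Proof. by move=> [f [g [? ? ? ?]]]; exists g, f. Qed.

Lemma isom_steq M N : isom M N -> stable_iso M N.
Proof.
move=> [f [g [hf hg fK gK]]]; exists f, g; split=> //; apply: fac_zero => x.
  by rewrite fK addrr2.
by rewrite gK addrr2.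
Qed.

Lemma steq_trans N M L : stable_iso M N -> stable_iso N L -> stable_iso M L.
Proof.
move=> [f [g [hf hg gf fg]]] [f' [g' [hf' hg' gf' fg']]].
exists (fun x => f' (f x)), (fun x => g (g' x)); split; try exact: mor_comp0.
  apply: (fac_eq (h := fun x => g (g' (f' (f x)) + f x) + (g (f x) + x))).
    by move=> x; rewrite (morD hg) addrA -(addrA (g (g' _))) addrr2 addr0.
  apply: fac_add gf; apply: (fac_post hg).
  exact: (fac_pre (h := fun y => g' (f' y) + y) hf).
apply: (fac_eq (h := fun x => f' (f (g (g' x)) + g' x) + (f' (g' x) + x))).
  by move=> x; rewrite (morD hf') addrA -(addrA (f' (f _))) addrr2 addr0.
apply: fac_add fg'; apply: (fac_post hf').
exact: (fac_pre (h := fun y => f (g y) + y) hg').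
Qed.

Lemma steq_dsum_free F R : is_free F -> stable_iso (dsum F R) R.
Proof.
move=> hF; exists snd, (fun x => (0, x)); split.
- exact: mor_snd.
- exact: mor_inr.
- exists F; split=> //; exists fst, (fun x => (x, 0)); split.
  + exact: mor_fst.
  + exact: mor_inl.
  + move=> [x y] /=; rewrite -[LHS]/((0 + x, y + y)); congr (_, _).
      exact: add0r.
    exact: addrr2.
- by apply: fac_zero => x /=; rewrite addrr2.
Qed.

(** Membership in I^j M, where I = Sq1 A(1) + Sq2 A(1) is the augmentation ideal. *)
Fixpoint rad (M : amod) (j : nat) (x : M) : Prop :=
  if j is j'.+1 then exists u v, [/\ rad j' u, rad j' v & x = sq1 M u + sq2 M v]
  else True.

Lemma rad_pr (M : amod) j (x : M) K : (forall d, d < - K -> pr M d = 0) ->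
  rad j x -> forall d, d < - K + j%:Z -> pr M d x = 0.
Proof.
move=> hK; elim: j x => [|j IH] x /= => [_ d dK|[u [v [ju jv ->]]] d dK].
  by rewrite hK ?zero_lfunE //; lia.
rewrite linearD /= prsq1' prsq2' (IH u) // ?(IH v) // ?linear0 ?addr0 //; lia.
Qed.

(** Each factor of the augmentation ideal raises the degree by at least 1, while all degrees of M
    lie between -K and K. *)
Lemma rad_nil (M : amod) (x : M) : (forall j, rad j x) -> x = 0.
Proof.
move=> hx; pose K : int := (\sum_(d <- degs M) `|d|%N)%:Z.
have hK d : d \in degs M -> - K <= d <= K.
  move=> dM; rewrite /K (bigD1_seq d) ?degs_uniq //=.
  set s := (\sum_(i <- _ | _) _)%N; lia.
have h0 d : d < - K -> pr M d = 0.
  by move=> dK; apply: pr_out; apply/negP => /hK; lia.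
rewrite -(sum_pr x) big_seq big1 // => d /hK dK.
by apply: (rad_pr h0 (hx (absz (K + K + 1)))); lia.
Qed.

(** As M is reduced, [a y] has zero top class and lies in the radical of P. Hence [h] maps M into I
    M, and so I^j M into I^(j+1) M; a fixed point lies in every I^j M. *)
Lemma fac_reduced_fix (M : amod) (h : M -> M) x : reduced M -> mor 0 h -> fac_free h ->
  h x = x -> x = 0.
Proof.
move=> /reducedP rM hh [P [/free_good[_ _ Pr _] [a [b [ha hb ab]]]]] hx.
have h1 y : exists u v, h y = sq1 M u + sq2 M v.
  have /Pr[u [v e]] : top (a y) = 0 by rewrite -(mor_top ha) rM (mor0 ha).
  by exists (b u), (b v); rewrite ab e (morD hb) (mor1 hb) (mor2 hb).
have step j y : rad j y -> rad j.+1 (h y).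
  elim: j y => [|j IH] y; first by move=> _; have [u [v e]] := h1 y; exists u, v.
  case=> u [v [ju jv ->]]; exists (h u), (h v); split; [exact: IH|exact: IH|].
  by rewrite (morD hh) (mor1 hh) (mor2 hh).
by apply: rad_nil; elim=> [//|j]; rewrite -{2}hx; apply: step.
Qed.

(** If f x = 0, then x is fixed by g f + 1, which factors through a free module, so x = 0. By
    symmetry g is injective too, and the dimensions agree. *)
Lemma steq_isom M N : reduced M -> reduced N -> stable_iso M N -> isom M N.
Proof.
move=> rM rN [f [g [hf hg gf fg]]].
have inj0 (A B : amod) (u : A -> B) (v : B -> A) : reduced A -> mor 0 u -> mor 0 v ->
    fac_free (fun x => v (u x) + x) -> forall x, u x = 0 -> x = 0.
  move=> rA hu hv vu x ux; apply: (fac_reduced_fix rA _ vu).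
    by apply: mor_add (mor_id _); apply: mor_comp0 hv.
  by rewrite ux (mor0 hv) add0r.
have fI := inj0 _ _ _ _ rM hf hg gf; have gI := inj0 _ _ _ _ rN hg hf fg.
apply: (bij_isom hf) => //; apply: (inj_dim_surj (morD hf)).
  exact: addmap_inj (morD hf) fI.
by apply: (addmap_inj_dim (morD hg)); apply: addmap_inj (morD hg) gI.
Qed.

(** * Short exact sequences and invariance of syzygies and cosyzygies *)

Record ses (N P M : amod) (i : N -> P) (p : P -> M) : Prop := Ses {
  ses_i : mor 0 i; ses_p : mor 0 p; ses_inj : injective i;
  ses_surj : forall y, exists x, p x = y;
  ses_pi : forall x, p (i x) = 0;
  ses_ex : forall z, p z = 0 -> exists x, i x = z }.

(** On P the maps c b and 1 cover g f and 1. Adding a lift of the factorisation of g f + 1 through Q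
    makes the sum vanish under [p], so it defines D : P -> N. The correction vanishes on N, where D
    restricts to w + 1, which therefore factors through P. *)
Lemma fac_syzygy (N P M P' M' : amod) (i : N -> P) (p : P -> M) (f : M -> M') (g : M' -> M)
    (b : P -> P') (c : P' -> P) (p' : P' -> M') (w : N -> N) :
  ses i p -> is_free P -> mor 0 b -> mor 0 c ->
  (forall x, p' (b x) = f (p x)) -> (forall x, p (c x) = g (p' x)) ->
  (forall x, i (w x) = c (b (i x))) ->
  fac_free (fun x => g (f x) + x) -> fac_free (fun x => w x + x).
Proof.
move=> S fP hb hc bvecE cE wE [Q [fQ [al [bvec [hal hbe ab]]]]].
have [pQ _ _ _] := free_good fQ.
have [be' hbe' be'E] := pQ _ _ _ _ (ses_p S) (ses_surj S) hbe.
have [D hD DE] : exists2 D : P -> N, mor 0 D &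
    forall x, i (D x) = c (b x) + x + be' (al (p x)).
  apply: (ker_lift (ses_i S) (ses_inj S)).
    apply: mor_add; first by apply: mor_add (mor_id _); apply: mor_comp0.
    by apply: mor_comp0 hbe'; apply: mor_comp0 hal; apply: ses_p S.
  move=> x; apply: (ses_ex S).
  by rewrite !(morD (ses_p S)) cE bvecE be'E -ab addrr2.
exists P; split=> //; exists i, D; split=> // [|x]; first exact: ses_i S.
apply: (ses_inj S); rewrite DE (morD (ses_i S)) wE (ses_pi S).
by rewrite (mor0 hal) (mor0 hbe') addr0.
Qed.

Lemma steq_syzygy (N P M N' P' M' : amod) i p i' p' :
  @ses N P M i p -> @ses N' P' M' i' p' -> is_free P -> is_free P' ->
  stable_iso M M' -> stable_iso N N'.
Proof.
move=> S S' fP fP' [f [g [hf hg gf fg]]].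
have [pP _ _ _] := free_good fP; have [pP' _ _ _] := free_good fP'.
have [b hb bvecE] := pP _ _ _ _ (ses_p S') (ses_surj S') (mor_comp0 (ses_p S) hf).
have [c hc cE] := pP' _ _ _ _ (ses_p S) (ses_surj S) (mor_comp0 (ses_p S') hg).
have [u hu uE] : exists2 u : N -> N', mor 0 u & forall x, i' (u x) = b (i x).
  apply: (ker_lift (ses_i S') (ses_inj S')); first exact: mor_comp0 (ses_i S) hb.
  by move=> x; apply: (ses_ex S'); rewrite bvecE (ses_pi S) (mor0 hf).
have [v hv vE] : exists2 v : N' -> N, mor 0 v & forall x, i (v x) = c (i' x).
  apply: (ker_lift (ses_i S) (ses_inj S)); first exact: mor_comp0 (ses_i S') hc.
  by move=> x; apply: (ses_ex S); rewrite cE (ses_pi S') (mor0 hg).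
exists u, v; split=> //.
  by apply: (fac_syzygy S fP hb hc bvecE cE) gf => x; rewrite vE uE.
by apply: (fac_syzygy S' fP' hc hb cE bvecE) fg => x; rewrite uE vE.
Qed.

(** Dual argument: injectivity of Q extends [al] to P, the corrected sum vanishes on N and descends
    to D : M -> P, and p D = w + 1. *)
Lemma fac_cosyzygy (N P M P' N' : amod) (i : N -> P) (p : P -> M) (f : N -> N') (g : N' -> N)
    (b : P -> P') (c : P' -> P) (i' : N' -> P') (w : M -> M) :
  ses i p -> is_free P -> mor 0 b -> mor 0 c -> mor 0 w ->
  (forall x, b (i x) = i' (f x)) -> (forall x, c (i' x) = i (g x)) ->
  (forall x, w (p x) = p (c (b x))) ->
  fac_free (fun x => g (f x) + x) -> fac_free (fun x => w x + x).
Proof.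
move=> S fP hb hc hw bvecE cE wE [Q [fQ [al [bvec [hal hbe ab]]]]].
have [_ pQ _ _] := free_good fQ.
have [al' hal' al'E] := pQ _ _ _ _ (ses_i S) (ses_inj S) hal.
have [D hD DE] : exists2 D : M -> P, mor 0 D &
    forall x, D (p x) = c (b x) + x + i (bvec (al' x)).
  apply: (coker_desc (ses_p S) (ses_surj S)).
    apply: mor_add; first by apply: mor_add (mor_id _); apply: mor_comp0.
    by apply: mor_comp0 (ses_i S); apply: mor_comp0 hbe.
  move=> x /(ses_ex S)[n <-]; rewrite bvecE cE al'E -ab.
  by rewrite -!(morD (ses_i S)) addrr2 (mor0 (ses_i S)).
exists P; split=> //; exists D, p; split=> // [|y]; first exact: ses_p S.
have [x <-] := ses_surj S y.
by rewrite DE !(morD (ses_p S)) wE (ses_pi S) addr0.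
Qed.

Lemma steq_cosyzygy (N P M N' P' M' : amod) i p i' p' :
  @ses N P M i p -> @ses N' P' M' i' p' -> is_free P -> is_free P' ->
  stable_iso N N' -> stable_iso M M'.
Proof.
move=> S S' fP fP' [f [g [hf hg gf fg]]].
have [_ pP _ _] := free_good fP; have [_ pP' _ _] := free_good fP'.
have [b hb bvecE] := pP' _ _ _ _ (ses_i S) (ses_inj S) (mor_comp0 hf (ses_i S')).
have [c hc cE] := pP _ _ _ _ (ses_i S') (ses_inj S') (mor_comp0 hg (ses_i S)).
have [u hu uE] : exists2 u : M -> M', mor 0 u & forall x, u (p x) = p' (b x).
  apply: (coker_desc (ses_p S) (ses_surj S)); first exact: mor_comp0 hb (ses_p S').
  by move=> x /(ses_ex S)[n <-]; rewrite bvecE (ses_pi S').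
have [v hv vE] : exists2 v : M' -> M, mor 0 v & forall x, v (p' x) = p (c x).
  apply: (coker_desc (ses_p S') (ses_surj S')); first exact: mor_comp0 hc (ses_p S).
  by move=> x /(ses_ex S')[n <-]; rewrite cE (ses_pi S).
exists u, v; split=> //.
  apply: (fac_cosyzygy S fP hb hc) bvecE cE _ gf; first exact: mor_comp0.
  by move=> x; rewrite uE vE.
apply: (fac_cosyzygy S' fP' hc hb) cE bvecE _ fg; first exact: mor_comp0.
by move=> x; rewrite vE uE.
Qed.

(** Split X into a free F and a reduced R. The top classes of X all come from F, so V embeds in the
    space of generators of F. Then dim F is at least 8 dim V, hence at least dim X, and R
    vanishes. *)
Lemma free_criterion (X : amod) (V : vectType 'F_2) (s : V -> X) (c : X -> V) :
  addmap s -> addmap c -> (forall v, c (top (s v)) = v) ->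
  (\dim {:X} <= 8 * \dim {:V})%N -> is_free X.
Proof.
move=> sD cD cs dX; have [R rR [ds hX]] := red_exists X.
have fF : is_free (free_mod ds) by exists ds; apply/isomP; apply: isom_refl.
have [_ _ _ [W [G [GD Gd Gt]]]] := free_good fF.
have [f [g [hf hg fK gK]]] := hX; move/reducedP: rR => rR.
have le : (\dim {:V} <= \dim {:W})%N.
  apply: (@addmap_inj_dim _ _ (fun v => G (f (s v)).1)).
    by move=> u v; rewrite sD (morD hf) -GD.
  apply: addmap_inj => [u v|v /Gt t0]; first by rewrite sD (morD hf) -GD.
  rewrite -[v]cs -[top _]fK (mor_top hf) top_dsum t0 rR.
  by rewrite -[(0, 0)]/(0 : dsum (free_mod ds) R) (mor0 hg) (addmap0 cD).
have dR : \dim {:R} = 0%N.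
  have := dim_isom hX; rewrite [X in _ = X]dim_prod Gd; lia.
have R0 (x : R) : x = 0.
  apply/eqP; rewrite -memv0; have := memvf x.
  by have /eqP -> : (fullv : {vspace R}) == 0%VS by rewrite -dimv_eq0 dR.
exists ds; apply/isomP; apply: isom_trans hX _.
exists fst, (fun x => (x, 0)); split=> //; [exact: mor_fst | exact: mor_inl |].
by case=> x y; rewrite (R0 y).
Qed.

Lemma red_spec M : reduced (red M) /\ stable_iso (red M) M.
Proof.
have : is_red_part M (red M).
  apply: (epsilon_spec (inhabits zero_mod) (is_red_part M)).
  have [R rR [ds hR]] := red_exists M; exists R; split=> //.
  exists (free_mod ds); split; last exact/isomP.
  by exists ds; apply/isomP; apply: isom_refl.
move=> [rR [F [fF /isomP hM]]]; split=> //; apply: steq_sym.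
apply: steq_trans (isom_steq hM) _; exact: steq_dsum_free.
Qed.

(** Makes the choice in [red] harmless: to identify a reduced part, any stably equivalent reduced
    module will do. *)
Lemma red_isom M R : reduced R -> stable_iso M R -> isom (red M) R.
Proof.
have [rM sM] := red_spec M.
by move=> rR h; apply: steq_isom rM rR _; apply: steq_trans sM h.
Qed.

#[local] Arguments sq1 : simpl never.
#[local] Arguments sq2 : simpl never.

(** * Tensor products *)

Section TensorMaps.
Import VectorInternalTheory.

Lemma tens_ind (M N : amod) (Q : tensT M N -> Prop) : Q 0 ->
  (forall z w, Q z -> Q w -> Q (z + w)) -> (forall x y, Q (ptens x y)) ->
  forall z, Q z.
Proof.
move=> Q0 QD Qt z; rewrite [z](matrix_sum_delta (z : 'M['F_2]_(dim M, dim N))).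
elim/big_ind: _ => // i _; elim/big_ind: _ => // j _.
have [->|->] := F2P (z i j); first by rewrite scale0r.
rewrite scale1r; have := Qt (r2v (delta_mx 0 i)) (r2v (delta_mx 0 j)).
by rewrite /ptens !r2vK trmx_delta mul_delta_mx.
Qed.

Lemma tens_ext (M N : amod) (W : vectType 'F_2) (f g : tensT M N -> W) :
  addmap f -> addmap g -> (forall x y, f (ptens x y) = g (ptens x y)) -> f =1 g.
Proof.
move=> fD gD fg; apply: tens_ind => [|z w zE wE|] //; first by rewrite (addmap0 fD) (addmap0 gD).
by rewrite fD gD zE wE.
Qed.

Lemma tens_hom_ext (M N : amod) (W : vectType 'F_2) (f g : tensT M N -> W) :
  addmap f -> addmap g ->
  (forall d e x y, pr M d x = x -> pr N e y = y -> f (ptens x y) = g (ptens x y)) ->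
  f =1 g.
Proof.
move=> fD gD fg; apply: tens_ext => // x y.
rewrite -[x](sum_pr x) -[y](sum_pr y) ptens_suml !(addmap_sum _ _ _ fD, addmap_sum _ _ _ gD).
apply: eq_bigr => d _; rewrite ptens_sumr !(addmap_sum _ _ _ fD, addmap_sum _ _ _ gD).
by apply: eq_bigr => e _; apply: (fg d e); rewrite prprE eqxx.
Qed.

Definition tens_map (M N M' N' : amod) (f : 'Hom(M, M')) (g : 'Hom(N, N'))
    (X : tensT M N) : tensT M' N' :=
  (f2mx f)^T *m (X : 'M['F_2]_(dim M, dim N)) *m f2mx g.

Lemma tens_mapD M N M' N' f g : addmap (@tens_map M N M' N' f g).
Proof. by move=> x y; rewrite /tens_map mulmxDr mulmxDl. Qed.

Lemma tens_map_ptens M N M' N' f g x y :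
  @tens_map M N M' N' f g (ptens x y) = ptens (f x) (g y).
Proof. by rewrite /tens_map /ptens !v2r_lfun trmx_mul !mulmxA. Qed.

Definition contrl (M N : amod) (c : M -> 'F_2) (X : tensT M N) : N :=
  r2v ((\row_j c (r2v (delta_mx 0 j))) *m (X : 'M['F_2]_(dim M, dim N))).

Lemma contrlD M N c : addmap (@contrl M N c).
Proof. by move=> x y; rewrite /contrl mulmxDr linearD. Qed.

Lemma row_functional (M : amod) (c : M -> 'F_2) x : {morph c : x y / x + y} ->
  (\row_j c (r2v (delta_mx 0 j))) *m (v2r x)^T = (c x)%:M.
Proof.
move=> cD; have c0 : c 0 = 0 by apply: (addrI (c 0)); rewrite -cD !addr0.
apply/matrixP => i j; rewrite !ord1 !mxE eqxx mulr1n.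
rewrite -[x in RHS](v2rK x) [v2r x in RHS](row_sum_delta (v2r x)) linear_sum.
rewrite (big_morph c cD c0); apply: eq_bigr => k _; rewrite !mxE linearZ /=.
by have [->|->] := F2P (v2r x 0 k); rewrite ?scale0r ?scale1r ?c0 ?mulr0 ?mulr1.
Qed.

Lemma contrl_ptens M N c x y : {morph c : x y / x + y} ->
  @contrl M N c (ptens x y) = c x *: y.
Proof.
by move=> cD; rewrite /contrl /ptens mulmxA row_functional // mul_scalar_mx linearZ /= v2rK.
Qed.

Definition contrr (M N : amod) (c : N -> 'F_2) (X : tensT M N) : M :=
  r2v ((\row_j c (r2v (delta_mx 0 j))) *m (X : 'M['F_2]_(dim M, dim N))^T).

Lemma contrrD M N c : addmap (@contrr M N c).
Proof. by move=> x y; rewrite /contrr linearD mulmxDr linearD. Qed.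

Lemma contrr_ptens M N c x y : {morph c : x y / x + y} ->
  @contrr M N c (ptens x y) = c y *: x.
Proof.
move=> cD; rewrite /contrr /ptens trmx_mul trmxK mulmxA row_functional //.
by rewrite mul_scalar_mx linearZ /= v2rK.
Qed.

Lemma dim_tens M N : \dim {:tensT M N} = (\dim {:M} * \dim {:N})%N.
Proof. by rewrite !dimvf. Qed.

End TensorMaps.

Section TensorMor.
Variables (M N : amod).

Lemma sq1_tens (x : M) (y : N) :
  sq1 (tensor M N) (ptens x y) = ptens (sq1 M x) y + ptens x (sq1 N y).
Proof. exact: tens_sq1E. Qed.

Lemma sq2_tens (x : M) (y : N) : sq2 (tensor M N) (ptens x y) =
  ptens (sq2 M x) y + ptens (sq1 M x) (sq1 N y) + ptens x (sq2 N y).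
Proof. exact: tens_sq2E. Qed.

Lemma pr_tens d u v (x : M) (y : N) : pr M u x = x -> pr N v y = y ->
  pr (tensor M N) d (ptens x y) = if d == u + v then ptens x y else 0.
Proof. exact: tens_pr_hom. Qed.

Lemma mor_tens_map (M' N' : amod) (f : 'Hom(M, M')) (g : 'Hom(N, N')) : mor 0 f -> mor 0 g ->
  mor 0 (tens_map f g : tensor M N -> tensor M' N').
Proof.
move=> hf hg; have tD := @tens_mapD _ _ _ _ f g.
split; first exact: tD.
- move=> d; apply: tens_hom_ext.
  + by move=> x y; rewrite prD tD.
  + by move=> x y; rewrite tD prD.
  + move=> u v x y hx hy; rewrite (pr_tens _ hx hy) tens_map_ptens.
    have hx' : pr M' u (f x) = f x by have := mor_pr hf u x; rewrite hx addr0.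
    have hy' : pr N' v (g y) = g y by have := mor_pr hg v y; rewrite hy addr0.
    rewrite addr0 (tens_pr_hom _ hx' hy'); case: eqP => _; last exact: addmap0 tD.
    exact: tens_map_ptens.
- apply: tens_ext.
  + by move=> x y; rewrite sq1D tD.
  + by move=> x y; rewrite tD sq1D.
  + move=> x y; rewrite sq1_tens tD !tens_map_ptens (mor1 hf) (mor1 hg).
    by rewrite [RHS]tens_sq1E.
- apply: tens_ext.
  + by move=> x y; rewrite sq2D tD.
  + by move=> x y; rewrite tD sq2D.
  + move=> x y; rewrite sq2_tens !tD !tens_map_ptens.
    by rewrite (mor1 hf) (mor1 hg) (mor2 hf) (mor2 hg) [RHS]tens_sq2E.
Qed.

Lemma mor_contrl (c : M -> 'F_2) : {morph c : x y / x + y} ->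
  (forall d x, c (pr M d x) = (d == 0)%:R * c x) ->
  (forall x, c (sq1 M x) = 0) -> (forall x, c (sq2 M x) = 0) ->
  mor 0 (contrl c : tensor M N -> N).
Proof.
move=> cD cp c1 c2; have tD := @contrlD M N c.
split; first exact: tD.
- move=> d; apply: tens_hom_ext.
  + by move=> x y; rewrite prD tD.
  + by move=> x y; rewrite tD prD.
  + move=> u v x y hx hy; rewrite (pr_tens _ hx hy) addr0 contrl_ptens //.
    rewrite linearZ /= -{2}hx cp -{2}hy prprE.
    have [->|u0] := eqVneq u 0.
      rewrite add0r mul1r; case: eqP => [->|_]; last by rewrite (addmap0 tD) scaler0.
      by rewrite contrl_ptens // hy.
    rewrite mul0r scale0r; case: eqP => _; last exact: addmap0 tD.
    by rewrite contrl_ptens // -hx cp (negPf u0) mul0r scale0r.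
- apply: tens_ext.
  + by move=> x y; rewrite sq1D tD.
  + by move=> x y; rewrite tD sq1D.
  + by move=> x y; rewrite sq1_tens tD !contrl_ptens // c1 scale0r add0r linearZ.
- apply: tens_ext.
  + by move=> x y; rewrite sq2D tD.
  + by move=> x y; rewrite tD sq2D.
  + move=> x y; rewrite sq2_tens !tD !contrl_ptens // c1 c2 !scale0r !add0r.
    by rewrite linearZ.
Qed.

Lemma mor_contrr (c : N -> 'F_2) : {morph c : x y / x + y} ->
  (forall d x, c (pr N d x) = (d == 0)%:R * c x) ->
  (forall x, c (sq1 N x) = 0) -> (forall x, c (sq2 N x) = 0) ->
  mor 0 (contrr c : tensor M N -> M).
Proof.
move=> cD cp c1 c2; have tD := @contrrD M N c.
split; first exact: tD.
- move=> d; apply: tens_hom_ext.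
  + by move=> x y; rewrite prD tD.
  + by move=> x y; rewrite tD prD.
  + move=> u v x y hx hy; rewrite (pr_tens _ hx hy) addr0 contrr_ptens //.
    rewrite linearZ /= -{2}hy cp -{2}hx prprE.
    have [->|v0] := eqVneq v 0.
      rewrite addr0 mul1r; case: eqP => [->|_]; last by rewrite (addmap0 tD) scaler0.
      by rewrite contrr_ptens // hx.
    rewrite mul0r scale0r; case: eqP => _; last exact: addmap0 tD.
    by rewrite contrr_ptens // -hy cp (negPf v0) mul0r scale0r.
- apply: tens_ext.
  + by move=> x y; rewrite sq1D tD.
  + by move=> x y; rewrite tD sq1D.
  + by move=> x y; rewrite sq1_tens tD !contrr_ptens // c1 scale0r addr0 linearZ.
- apply: tens_ext.
  + by move=> x y; rewrite sq2D tD.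
  + by move=> x y; rewrite tD sq2D.
  + move=> x y; rewrite sq2_tens !tD !contrr_ptens // c1 c2 !scale0r !addr0.
    by rewrite linearZ.
Qed.

End TensorMor.

Lemma tens_map_inj (M N M' : amod) (f : 'Hom(M, M')) : injective f ->
  injective (tens_map f \1%VF : tensor M N -> tensor M' N).
Proof.
move=> fI; have [r rD rK] := addmap_retract (lfun_addmap f) fI.
apply: (@can_inj _ _ _ (tens_map (lin_of rD) \1%VF)).
apply: tens_ext => // [x y|x y]; first by rewrite !tens_mapD.
by rewrite !tens_map_ptens lin_ofE rK !id_lfunE.
Qed.

Lemma tens_map_surj (M N M' : amod) (f : 'Hom(M, M')) : (forall y, exists x, f x = y) ->
  forall z, exists w, (tens_map f \1%VF : tensor M N -> tensor M' N) w = z.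
Proof.
move=> fS z; have [s sD sK] := addmap_section (lfun_addmap f) fS.
exists (tens_map (lin_of sD) \1%VF z); move: z.
apply: tens_ext => // [x y|x y]; first by rewrite !tens_mapD.
by rewrite !tens_map_ptens lin_ofE sK !id_lfunE.
Qed.

Lemma mor_id_lfun (M : amod) : mor 0 (\1%VF : 'End(M)).
Proof. by apply: mor_eq (mor_id M) => x; rewrite id_lfunE. Qed.

Lemma mor_lf k (M N : amod) (f : M -> N) (h : mor k f) : mor k (lin_of (morD h)).
Proof. by apply: (mor_eq _ h) => x; rewrite lin_ofE. Qed.

Lemma ses_dim N P M i p : @ses N P M i p -> \dim {:P} = (\dim {:N} + \dim {:M})%N.
Proof.
move=> S; have pD := morD (ses_p S); have iD := morD (ses_i S).
have [s sD sK] := addmap_section pD (ses_surj S).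
apply/eqP; rewrite eqn_leq -dim_prod; apply/andP; split.
  apply: (@addmap_surj_dim (N * M)%type P (fun x => i x.1 + s x.2)).
    by move=> x y; rewrite /= iD sD addrACA.
  move=> z; have [n nz] : exists n, i n = z - s (p z).
    by apply: (ses_ex S); rewrite oppF2 pD sK addrr2.
  by exists (n, p z); rewrite /= nz subrK.
apply: (@addmap_inj_dim (N * M)%type P (fun x => i x.1 + s x.2)).
  by move=> x y; rewrite /= iD sD addrACA.
apply: addmap_inj => [x y|[n m] /= e]; first by rewrite /= iD sD addrACA.
have m0 : m = 0 by rewrite -(addmap0 pD) -e pD sK (ses_pi S) add0r.
rewrite m0 (addmap0 sD) addr0 in e.
by rewrite m0; congr (_, _); apply: (ses_inj S); rewrite e (addmap0 iD).
Qed.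

(** [i] factors through the kernel of [p] as an injection, which the dimension bound makes
    surjective. *)
Lemma ses_of_dim (N P M : amod) (i : N -> P) (p : P -> M) : mor 0 i -> mor 0 p ->
  injective i -> (forall y, exists x, p x = y) -> (forall x, p (i x) = 0) ->
  (\dim {:P} <= \dim {:N} + \dim {:M})%N -> ses i p.
Proof.
move=> hi hp iI pS pi dP; split=> // z pz.
have S : ses (subinj (h := hp)) p.
  split=> //; [exact: subinj_mor|exact: subinj_inj|exact: subinj_ker|exact: subinj_im].
have [u hu uE] : exists2 u : N -> subker hp, mor 0 u & forall x, subinj (u x) = i x.
  apply: (ker_lift (ses_i S) (ses_inj S) hi) => x; apply: (ses_ex S); exact: pi.
have uI : injective u by move=> x y e; apply: iI; rewrite -!uE e.
have [k kz] := ses_ex S pz.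
have [|x xk] := inj_dim_surj (morD hu) uI _ k.
  by have := ses_dim S; lia.
by exists x; rewrite -uE xk.
Qed.

(** * Freeness of tensor products, detected on top classes *)

(* [killed c n x]: c vanishes on a x for every product a of Sq1's and Sq2's of
   degree less than n. *)
Fixpoint killed (X : amod) (V : vectType 'F_2) (c : X -> V) (n : nat) (x : X) : Prop :=
  if n is n'.+1 then
    [/\ c x = 0, killed c n' (sq1 X x) & if n' is n''.+1 then killed c n'' (sq2 X x) else True]
  else True.

Lemma killedD (X : amod) (V : vectType 'F_2) (c : X -> V) n x y : addmap c -> killed c n x -> killed c n y ->
  killed c n (x + y).
Proof.
move=> cD; have [m] := ubnP n; elim: m n x y => // m IH [|[|n]] x y //= nm.
  by move=> [x0 _ _] [y0 _ _]; rewrite cD x0 y0 addr0.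
move=> [x0 [x1 x11 x12] x2] [y0 [y1 y11 y12] y2].
rewrite cD x0 y0 addr0; split=> //.
  rewrite sq1D; apply: (IH n.+1); [lia | by split | by split].
by rewrite sq2D; apply: (IH n) => //; lia.
Qed.

Lemma killed_weak (X : amod) (V : vectType 'F_2) (c : X -> V) n x : killed c n.+1 x -> killed c n x.
Proof.
have [m] := ubnP n; elim: m n x => // m IH [|n] x //= nm [x0 x1 x2]; split=> //.
  by apply: IH; [lia | exact: x1].
by case: n nm x1 x2 => // n nm _ x2; apply: IH; [lia | exact: x2].
Qed.

Section Frame.
Variables (X V M : amod) (s : 'Hom(V, X)) (c : 'Hom(X, V)).

Let C : tensor X M -> tensT V M := tens_map c \1%VF.

(** By the Cartan formula, the part of an operation that falls on the first factor never exceeds the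
    operation in degree. *)
Lemma killed_tens n x m : killed c n x -> killed C n (ptens x m).
Proof.
have CD : addmap C by apply: tens_mapD.
have [k] := ubnP n; elim: k n x m => // k IH [|n] x m //= nk kx.
have [x0 x1 x2] := kx; split.
- by rewrite /C tens_map_ptens x0 ptens0l.
- rewrite sq1_tens; apply: (killedD CD); apply: IH => //.
  exact: (killed_weak kx).
- case: n nk kx x1 x2 => // n nk kx x1 x2.
  rewrite sq2_tens; apply: (killedD CD); first apply: (killedD CD); apply: IH => //; try lia.
  + exact: (killed_weak x1).
  + by apply: killed_weak; apply: (@killed_weak _ _ _ n.+1).
Qed.

(** The elements s v play free generators: [c] reads their top classes and annihilates all their
    products of degree below 6. *)
Definition frame (Y : amod) (W : vectType 'F_2) (s : W -> Y) (c : Y -> W) :=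
  [/\ addmap s, addmap c, forall v, killed c 6 (s v) & forall v, c (top (s v)) = v].

(** In the Cartan expansion of Sq2Sq2Sq2 on x (x) m, every term except top x (x) m applies to x an
    operation of degree below 6, which [c] kills. *)
Lemma frame_tens : frame s c ->
  @frame (tensor X M) (tensT V M) (tens_map s \1%VF) (tens_map c \1%VF).
Proof.
have CD : addmap C by apply: tens_mapD.
move=> [sD cD ck ct]; split; try exact: tens_mapD.
  apply: tens_ind => [|z w kz kw|v m].
  - rewrite (addmap0 (@tens_mapD _ _ _ _ s \1%VF)).
    by rewrite -(ptens0r M (s 0)); apply: killed_tens.
  - by rewrite tens_mapD; apply: killedD.
  - by rewrite tens_map_ptens; apply: killed_tens.
apply: tens_ext => // [x y|v m]; first by rewrite tens_mapD topD tens_mapD.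
rewrite tens_map_ptens id_lfunE.
(* Applied after one, respectively two, of the three Sq2 have been expanded: these facts discard the
   terms in which x has so far received degree less than 2, respectively less than 4. *)
have k5 z : killed C 5 z -> C (sq2 _ (sq2 _ z)) = 0.
  by case=> _ _ [_ _ []].
have k3 z : killed C 3 z -> C (sq2 _ z) = 0.
  by case=> _ _ [].
move: (s v) (ck v) (ct v) => x kx tx.
have [_ kx1 kx2] := kx; have [_ kx21 kx22] := kx2; have [x0 kx221 _] := kx22.
rewrite -/C /top sq2_tens !(sq2D, CD) (k5 (ptens (sq1 X x) _)); last exact: killed_tens.
rewrite (k5 (ptens x _)); last exact/killed_tens/killed_weak.
rewrite !addr0 sq2_tens !(sq2D, CD) (k3 (ptens (sq1 X _) _)); last exact: killed_tens.
rewrite (k3 (ptens (sq2 X x) _)); last exact/killed_tens/killed_weak.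
rewrite !addr0 sq2_tens !CD /C !tens_map_ptens.
have [e1 _ _] := kx221; rewrite e1 x0 !ptens0l !addr0 id_lfunE.
by rewrite -[sq2 X _]/(top x) tx.
Qed.
End Frame.

Lemma killed_eq (X : amod) (V : vectType 'F_2) (c c' : X -> V) n x : c =1 c' ->
  killed c n x -> killed c' n x.
Proof.
move=> e; have [m] := ubnP n; elim: m n x => // m IH [|[|n]] x //= nm.
  by rewrite -e.
move=> [x0 x1 x2]; rewrite -e; split=> //; first by apply: (IH n.+1).
by apply: (IH n) => //; lia.
Qed.

Lemma frame_lf (Y : amod) (W : vectType 'F_2) (s : W -> Y) (c : Y -> W)
  (sD : addmap s) (cD : addmap c) : frame s c -> frame (lin_of sD) (lin_of cD).
Proof.
move=> [_ _ ck ct]; split; try exact: lfun_addmap.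
  by move=> v; rewrite lin_ofE; apply: killed_eq (ck v) => x; rewrite lin_ofE.
by move=> v; rewrite !lin_ofE.
Qed.

Lemma frame_free (Y : amod) (W : vectType 'F_2) s c : @frame Y W s c ->
  (\dim {:Y} <= 8 * \dim {:W})%N -> is_free Y.
Proof. by move=> [sD cD _ ct]; apply: (free_criterion sD cD ct). Qed.

Definition rv1 (c : 'F_2) : unit_mod := (const_mx c : 'rV['F_2]_1).
Definition uc (v : unit_mod) : 'F_2 := (v : 'rV['F_2]_1) 0 0.

Lemma rv1K c : uc (rv1 c) = c. Proof. exact: mxE. Qed.
Lemma ucK v : rv1 (uc v) = v.
Proof. by apply/rowP => i; rewrite ord1 mxE. Qed.
Lemma ucD : {morph uc : x y / x + y}. Proof. by move=> x y; apply: mxE. Qed.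
Lemma rv1D : {morph rv1 : x y / x + y}.
Proof. by move=> x y; apply/rowP => i; rewrite !mxE. Qed.

Lemma uc_pr d x : uc (pr unit_mod d x) = (d == 0)%:R * uc x.
Proof.
rewrite /uc (_ : pr unit_mod d x = (x : 'rV_1) *m diag_mx (\row_i (0 == d)%:R)).
  by rewrite mul_mx_diag !mxE mulrC eq_sym.
exact: mxopE.
Qed.

Lemma sq1_unit (x : unit_mod) : sq1 unit_mod x = 0.
Proof. by apply: etrans (mxopE _ _) _; rewrite mulmx0. Qed.
Lemma sq2_unit (x : unit_mod) : sq2 unit_mod x = 0.
Proof. by apply: etrans (mxopE _ _) _; rewrite mulmx0. Qed.

Section CyclicFrame.
Variables (X : amod) (x : X) (c : X -> 'F_2).
Hypothesis cD : {morph c : x y / x + y}.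
Hypothesis cx : forall k, (k < 8)%N -> c (word k x) = (k == 7)%:R.

Lemma cyclic_frame : @frame X unit_mod (fun v => uc v *: x) (fun a => rv1 (c a)).
Proof.
have c0 : c 0 = 0 by apply: (addrI (c 0)); rewrite -cD !addr0.
have r0 : rv1 0 = 0 by apply/rowP => i; rewrite !mxE.
split.
- by move=> u v; rewrite ucD scalerDl.
- by move=> u v; rewrite cD rv1D.
- move=> v; have [->|->] := F2P (uc v).
    by rewrite scale0r /= !linear0 c0 r0.
  rewrite scale1r /= !sq1_sq1 !linear0 !sq2_sq2 !sq1_sq1 !linear0 ?c0 ?r0.
  have e k : (k < 7)%N -> rv1 (c (word k x)) = 0.
    by move=> k7; rewrite cx ?ltn_eqF ?r0 // ltnW.
  have := (e 0%N isT, e 1%N isT, e 2%N isT, e 3%N isT, (e 4%N isT, e 5%N isT, e 6%N isT)).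
  rewrite /= => h; rewrite !h.
  by [].
- move=> v; rewrite topZ top7; have := @cx 7 isT; move: (word 7 x) => y cy.
  by rewrite -[RHS]ucK; have [->|->] := F2P (uc v); rewrite ?scale0r ?scale1r ?c0 ?cy.
Qed.

(** The bracketing is that of [tensor (tpow _ s.+1) M], so that no associativity isomorphism is
    called for. *)
Lemma cyclic_tens_free (T M : amod) : \dim {:X} = 8%N ->
  is_free (tensor (tensor X T) M).
Proof.
move=> dX; have F := cyclic_frame; have [sD cD' _ _] := F.
have F1 := frame_tens T (frame_lf sD cD' F); have [sD2 cD2 _ _] := F1.
have F2 : frame (lin_of sD2 : 'Hom(tensor unit_mod T, tensor X T))
                (lin_of cD2 : 'Hom(tensor X T, tensor unit_mod T)) := frame_lf sD2 cD2 F1.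
apply: (frame_free (frame_tens M F2)).
rewrite [X in (X <= _)%N]dim_tens [X in (X * _ <= _)%N]dim_tens dX.
rewrite [X in (_ <= 8 * X)%N]dim_tens [X in (_ <= 8 * (X * _))%N]dim_tens.
by rewrite [\dim {:unit_mod}]dimvf mul1n mulnA.
Qed.
End CyclicFrame.

Lemma A1_tens_free T M : is_free (tensor (tensor A1 T) M).
Proof.
apply: (@cyclic_tens_free A1 A1one (coefA 7)); [exact: coefA_D | | exact: dim_A1].
by move=> k k8; rewrite coefA_word_one // eq_sym.
Qed.

Lemma pr_tens_l (M N : amod) d (x : M) (y : N) : pr M 0 x = x ->
  pr (tensor M N) d (ptens x y) = ptens x (pr N d y).
Proof.
move=> x0; rewrite -{1}(sum_pr y) ptens_sumr (addmap_sum _ _ _ (@prD (tensor M N) d)).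
rewrite -[in RHS](sum_pr y) (addmap_sum _ _ _ (@prD N d)) ptens_sumr.
apply: eq_bigr => e _; rewrite (pr_tens d x0 (v := e)) ?prprE ?eqxx // add0r.
by case: eqP => [->|]; rewrite // ptens0r.
Qed.

Lemma coefA_addmap k : @addmap A1 ('F_2)^o (coefA k).
Proof. exact: coefA_D. Qed.

Definition dev (M : amod) (phi : dual M) (x : M) : 'F_2 := (phi : 'Hom(M, ('F_2)^o)) x.

Lemma dev_sq1 (M : amod) (phi : dual M) (x : M) : dev (sq1 (dual M) phi) x = dev phi (sq1 M x).
Proof. by rewrite /dev [sq1 _ _]transpE comp_lfunE. Qed.

Lemma dev_sq2 (M : amod) (phi : dual M) (x : M) : dev (sq2 (dual M) phi) x = dev phi (sq2 M x).
Proof. by rewrite /dev [sq2 _ _]transpE comp_lfunE. Qed.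

Lemma dev_pr (M : amod) d (phi : dual M) (x : M) : dev (pr (dual M) d phi) x = dev phi (pr M (- d) x).
Proof. by rewrite /dev [pr _ _ _]transpE comp_lfunE. Qed.

Lemma devDl (M : amod) (phi psi : dual M) x : dev (phi + psi) x = dev phi x + dev psi x.
Proof. by rewrite /dev add_lfunE. Qed.

Lemma dev0 (M : amod) x : dev (0 : dual M) x = 0.
Proof. by rewrite /dev zero_lfunE. Qed.

Lemma dev_ext (M : amod) (phi psi : dual M) : dev phi =1 dev psi -> phi = psi.
Proof. by move=> e; apply/lfunP => x; apply: e. Qed.

Definition mkdual (M : amod) (f : M -> 'F_2) (fD : @addmap M ('F_2)^o f) : dual M := lin_of fD.

Lemma dev_mk (M : amod) f fD x : dev (@mkdual M f fD) x = f x.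
Proof. exact: (lin_ofE fD). Qed.

(** The dual of A(1) is generated by the functional reading the top coefficient, and evaluation at 1
    detects the top class of this generator. *)
Lemma dual_A1_tens_free T M : is_free (tensor (tensor (dual A1) T) M).
Proof.
apply: (@cyclic_tens_free (dual A1) (mkdual (coefA_addmap 7)) (fun phi => dev phi A1one)).
- by move=> x y; rewrite devDl.
- move=> k; move: k => [|[|[|[|[|[|[|[|k]]]]]]]] //= _;
    by rewrite ?(dev_sq1, dev_sq2) dev_mk ?(coefA_sq1, coefA_sq2) ?coefA_A1one.
- by rewrite [LHS]dimvf.
Qed.

(** * Tensoring with Omega F and with its dual *)

Lemma dim_unit : \dim {:unit_mod} = 1%N.
Proof. by rewrite dimvf. Qed.

Lemma aug_co a : uc (aug a) = coefA 0 a.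
Proof.
rewrite [aug a]aug_funE /uc /coefA mxE (bigD1 0) //= mxE /= mulr1 big1 ?addr0.
  by congr (fun_of_matrix a _ _); apply: val_inj; rewrite /= inordK.
by move=> i i0; rewrite mxE (negPf i0) mulr0.
Qed.

Lemma ses_aug : @ses OmegaF A1 unit_mod vsval aug.
Proof.
split.
- exact: sub_mor.
- exact: ahom_mor.
- exact: val_inj.
- move=> y; exists (uc y *: A1one).
  by rewrite -[LHS]ucK -[RHS]ucK aug_co coefA_Z coefA_A1one // mulr1.
- by move=> x; have := subvsP x; rewrite memv_ker => /eqP.
- move=> z z0; have zk : z \in lker aug by rewrite memv_ker z0.
  by exists (Subvs zk).
Qed.

Lemma dim_OmegaF : \dim {:OmegaF} = 7%N.
Proof. by have := ses_dim ses_aug; rewrite dim_A1 dim_unit; lia. Qed.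

(** Tensoring the augmentation sequence with T and M keeps the middle term free, so the left side is
    a syzygy of T (x) M and can be compared with any other syzygy sequence of R. *)
Lemma steq_Omega (T M N P R : amod) (i : N -> P) (p : P -> R) : ses i p -> is_free P ->
  stable_iso (tensor T M) R -> stable_iso (tensor (tensor OmegaF T) M) N.
Proof.
move=> S fP.
suff [i' [p' S']] : exists i' p', @ses (tensor (tensor OmegaF T) M)
    (tensor (tensor A1 T) M) (tensor T M) i' p'.
  by apply: (steq_syzygy S' S) => //; apply: A1_tens_free.
have hc : mor 0 (contrl (fun a => uc (aug a)) : tensor A1 T -> T).
  apply: mor_contrl => [x y|d x|x|x].
  - by rewrite linearD ucD.
  - by rewrite (mor_pr (ahom_mor aug)) addr0 uc_pr.
  - by rewrite (mor1 (ahom_mor aug)) sq1_unit /uc mxE.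
  - by rewrite (mor2 (ahom_mor aug)) sq2_unit /uc mxE.
have hi := mor_lf (ses_i ses_aug).
have hcl := mor_lf hc.
have hi2 := mor_lf (mor_tens_map hi (mor_id_lfun T)).
exists (tens_map (lin_of (morD (mor_tens_map hi (mor_id_lfun T)))) \1%VF).
exists (tens_map (lin_of (morD hc)) \1%VF).
apply: (ses_of_dim (mor_tens_map hi2 (mor_id_lfun M)) (mor_tens_map hcl (mor_id_lfun M))).
- apply: tens_map_inj => x y; rewrite !lin_ofE; apply: tens_map_inj => {}x {}y.
  by rewrite !lin_ofE => /(ses_inj ses_aug).
- apply: tens_map_surj => t; exists (ptens A1one t).
  rewrite lin_ofE contrl_ptens => [|x y]; last by rewrite linearD ucD.
  by rewrite aug_co coefA_A1one // scale1r.
- apply: tens_ext => [x y|x y|z m]; first by rewrite !tens_mapD.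
    by rewrite addr0.
  rewrite !tens_map_ptens [X in ptens X _](_ : _ = 0) ?ptens0l //.
  rewrite !lin_ofE; move: z; apply: tens_ext => [x y|x y|z t].
  - by rewrite tens_mapD contrlD.
  - by rewrite addr0.
  rewrite tens_map_ptens lin_ofE contrl_ptens => [|x y]; last by rewrite linearD ucD.
  by rewrite (ses_pi ses_aug) /uc mxE scale0r.
- rewrite [X in (X <= _)%N]dim_tens [X in (X * _ <= _)%N]dim_tens.
  rewrite [X in (_ <= X + _)%N]dim_tens [X in (_ <= X * _ + _)%N]dim_tens.
  by rewrite [X in (_ <= _ + X)%N]dim_tens dim_A1 dim_OmegaF; lia.
Qed.

(** The counit of A(1): the invariant element spanning the kernel of the restriction to [OmegaF]. *)
Definition coefA0_dual : dual A1 := mkdual (coefA_addmap 0).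

Definition restr (phi : dual A1) : dual OmegaF :=
  ((phi : 'Hom(A1, ('F_2)^o)) \o sub_inj (lker aug))%VF.

Lemma restrE phi x : dev (restr phi) x = dev phi (vsval x).
Proof. by rewrite /dev comp_lfunE (lfunE vsval). Qed.

Lemma mor_restr : mor 0 restr.
Proof.
have h := ses_i ses_aug.
split=> [x y|d phi|phi|phi]; apply: dev_ext => z.
- by rewrite !(restrE, devDl).
- by rewrite addr0 !(restrE, dev_pr) (mor_pr h) addr0.
- by rewrite !(restrE, dev_sq1) (mor1 h).
- by rewrite !(restrE, dev_sq2) (mor2 h).
Qed.

(** Uses the dual augmentation sequence, tensored with N, in the role of a cosyzygy sequence. The
    factor [unit_mod] is the one in [tpow _ 1]. *)
Lemma steq_dual_Omega (M N P R : amod) (i : M -> P) (p : P -> R) : ses i p -> is_free P ->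
  stable_iso M N -> stable_iso (tensor (tensor (dual OmegaF) unit_mod) N) R.
Proof.
move=> S fP hMN; apply: steq_sym; pose j (m : N) : tensor (tensor (dual A1) unit_mod) N :=
  ptens (ptens coefA0_dual (rv1 1) : tensor (dual A1) unit_mod) m.
have hr := mor_lf mor_restr.
have hr2 := mor_lf (mor_tens_map hr (mor_id_lfun unit_mod)).
have hr3 := mor_tens_map hr2 (mor_id_lfun N).
have s1c : sq1 (dual A1) coefA0_dual = 0.
  by apply: dev_ext => x; rewrite dev_sq1 dev_mk coefA_sq1 // dev0.
have s2c : sq2 (dual A1) coefA0_dual = 0.
  by apply: dev_ext => x; rewrite dev_sq2 dev_mk coefA_sq2 // dev0.
have pc : pr (dual A1) 0 coefA0_dual = coefA0_dual.
  by apply: dev_ext => x; rewrite dev_pr oppr0 !dev_mk coefA_pr // mul1r.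
have pu : pr unit_mod 0 (rv1 1) = rv1 1.
  by rewrite -[LHS]ucK uc_pr mul1r ucK.
have e1 : sq1 (tensor (dual A1) unit_mod) (ptens coefA0_dual (rv1 1)) = 0.
  by rewrite sq1_tens s1c sq1_unit ptens0l ptens0r addr0.
have e2 : sq2 (tensor (dual A1) unit_mod) (ptens coefA0_dual (rv1 1)) = 0.
  by rewrite sq2_tens s1c s2c sq1_unit !ptens0l !ptens0r !addr0.
have e0 : pr (tensor (dual A1) unit_mod) 0 (ptens coefA0_dual (rv1 1)) = ptens coefA0_dual (rv1 1).
  by rewrite pr_tens_l // pu.
have hj : mor 0 j.
  split=> [x y|d x|x|x].
  - exact: ptensDr.
  - by rewrite addr0 /j pr_tens_l.
  - by rewrite /j sq1_tens e1 ptens0l add0r.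
  - by rewrite /j sq2_tens e1 e2 !ptens0l !add0r.
suff S' : @ses N (tensor (tensor (dual A1) unit_mod) N)
    (tensor (tensor (dual OmegaF) unit_mod) N) j
    (tens_map (lin_of (morD (mor_tens_map hr (mor_id_lfun unit_mod)))) \1%VF).
  by apply: (steq_cosyzygy S S') => //; apply: dual_A1_tens_free.
apply: (ses_of_dim hj hr3).
(* Evaluation at 1 takes the counit to 1, so contracting the first factor with it inverts [j] on the
   left. *)
- pose ev (w : tensor (dual A1) unit_mod) : 'F_2 := dev (contrr uc w : dual A1) A1one.
  have evD : {morph ev : x y / x + y}.
    by move=> x y; rewrite /ev contrrD devDl.
  have jK x : contrl ev (j x) = x.
    rewrite contrl_ptens // /ev contrr_ptens; last exact: ucD.
    by rewrite rv1K scale1r dev_mk coefA_A1one // scale1r.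
  by move=> x y e; rewrite -(jK x) e jK.
- apply: tens_map_surj => t; have [r rD rK] := addmap_retract (morD (ses_i ses_aug)) (ses_inj ses_aug).
  have [w wE] : exists w, tens_map (lin_of (morD mor_restr)) \1%VF w = t.
    apply: tens_map_surj => phi.
    have h : @addmap A1 ('F_2)^o (fun x => dev (phi : dual OmegaF) (r x)).
      by move=> x y; rewrite rD /dev linearD.
    by exists (mkdual h); rewrite lin_ofE; apply: dev_ext => x; rewrite restrE dev_mk rK.
  by exists w; rewrite lin_ofE.
- move=> x; rewrite /j /=; rewrite tens_map_ptens lin_ofE tens_map_ptens lin_ofE.
  rewrite (_ : restr coefA0_dual = 0) ?ptens0l //.
  apply: dev_ext => z; rewrite restrE dev_mk dev0.
  by rewrite -aug_co (ses_pi ses_aug) /uc mxE.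
- rewrite [X in (X <= _)%N]dim_tens [X in (X * _ <= _)%N]dim_tens.
  rewrite [X in (_ <= _ + X)%N]dim_tens [X in (_ <= _ + X * _)%N]dim_tens.
  have -> : \dim {:dual A1} = 8%N by rewrite dimvf.
  have -> : \dim {:dual OmegaF} = 7%N.
    by have := dim_OmegaF; rewrite !dimvf => e; rewrite -[RHS]/(7 * 1)%N -e.
  by rewrite dim_unit; lia.
Qed.

#[local] Arguments pr : simpl never.

(** * Modules given by tables *)

(* The row [i] of a table lists the columns of the nonzero entries. *)
Definition tabmx m n (t : seq (seq nat)) : 'M['F_2]_(m, n) :=
  \matrix_(i, j) ((j : nat) \in nth [::] t i)%:R.

Definition tmul m n p (t u : seq (seq nat)) : seq (seq nat) :=
  [seq [seq j <- iota 0 p | odd (count (fun k => (k \in nth [::] t i) &&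
      (j \in nth [::] u k)) (iota 0 n))] | i <- iota 0 m].

Definition tadd m n (t u : seq (seq nat)) : seq (seq nat) :=
  [seq [seq j <- iota 0 n | (j \in nth [::] t i) (+) (j \in nth [::] u i)] | i <- iota 0 m].

Definition tid n : seq (seq nat) := [seq [:: i] | i <- iota 0 n].

Lemma tmxM m n p t u : tabmx m n t *m tabmx n p u = tabmx m p (tmul m n p t u).
Proof.
apply/matrixP => i j; rewrite !mxE (nth_map 0%N) ?size_iota // nth_iota // add0n.
rewrite mem_filter mem_iota leq0n add0n ltn_ord !andbT; apply: etrans _ (natrF2 _).
transitivity ((\sum_(k < n) (((k : nat) \in nth [::] t i) && ((j : nat) \in nth [::] u k) : nat))%:R : 'F_2).
  by rewrite natr_sum; apply: eq_bigr => k _; rewrite !mxE -natrM mulnb.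
rewrite -(big_mkord xpredT (fun k : nat => ((k \in nth [::] t i) && ((j : nat) \in nth [::] u k) : nat))).
congr (_%:R); rewrite -sum1_count [RHS]big_mkcond /index_iota subn0 /=.
by apply: eq_bigr => k _; case: ifP.
Qed.

Lemma tmxD m n t u : tabmx m n t + tabmx m n u = tabmx m n (tadd m n t u).
Proof.
apply/matrixP => i j; rewrite !mxE (nth_map 0%N) ?size_iota // nth_iota // add0n.
rewrite mem_filter mem_iota leq0n add0n ltn_ord !andbT.
case: (_ \in _); case: (_ \in _); rewrite ?addr0 ?add0r //; exact: val_inj.
Qed.

Lemma tmx0 m n p : tabmx m n (nseq p [::]) = 0.
Proof. by apply/matrixP => i j; rewrite !mxE nth_nseq if_same. Qed.

Lemma tmx1 n : tabmx n n (tid n) = 1%:M.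
Proof.
apply/matrixP => i j; rewrite !mxE (nth_map 0%N) ?size_iota // nth_iota // add0n inE.
by rewrite eq_sym.
Qed.

Definition tab_ok n (ds : seq int) (t1 t2 : seq (seq nat)) : bool :=
  [&& all (fun i => all (fun j => ds`_j == ds`_i + 1) (nth [::] t1 i)) (iota 0 n),
      all (fun i => all (fun j => ds`_j == ds`_i + 2) (nth [::] t2 i)) (iota 0 n),
      tmul n n n t1 t1 == nseq n [::] &
      tmul n n n t2 t2 == tmul n n n (tmul n n n t1 t2) t1].

Lemma tab_deg n m (ds ds' : seq int) (k : int) t :
  all (fun i => all (fun j => ds'`_j == ds`_i + k) (nth [::] t i)) (iota 0 n) ->
  forall (i : 'I_n) (j : 'I_m), tabmx n m t i j != 0 -> ds'`_j = ds`_i + k.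
Proof.
move=> /allP h i j; rewrite mxE; case E: (_ \in _) => // _.
have /h/allP : (i : nat) \in iota 0 n by rewrite mem_iota /=.
by move/(_ _ E)/eqP.
Qed.

Section Tab.
Variables (n : nat) (ds : seq int) (t1 t2 : seq (seq nat)).
Hypothesis ok : tab_ok n ds t1 t2.

Lemma tab11 : tabmx n n t1 *m tabmx n n t1 = 0.
Proof. by case/and4P: ok => _ _ /eqP e _; rewrite tmxM e tmx0. Qed.

Lemma tab22 : tabmx n n t2 *m tabmx n n t2 = tabmx n n t1 *m tabmx n n t2 *m tabmx n n t1.
Proof. by case/and4P: ok => _ _ _ /eqP e; rewrite !tmxM e. Qed.

Lemma tab_deg1 (i j : 'I_n) : tabmx n n t1 i j != 0 -> ds`_j = ds`_i + 1.
Proof. by case/and4P: ok => h _ _ _; apply: (tab_deg h). Qed.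

Lemma tab_deg2 (i j : 'I_n) : tabmx n n t2 i j != 0 -> ds`_j = ds`_i + 2.
Proof. by case/and4P: ok => _ h _ _; apply: (tab_deg h). Qed.

Definition tab : amod :=
  @based n (fun i => ds`_i) (tabmx n n t1) (tabmx n n t2) tab_deg1 tab_deg2 tab11 tab22.

End Tab.

Section BasedMor.
Variables (n : nat) (dn : 'I_n -> int) (S1 S2 : 'M['F_2]_n).
Variables (h1 : forall i j, S1 i j != 0 -> dn j = dn i + 1).
Variables (h2 : forall i j, S2 i j != 0 -> dn j = dn i + 2).
Variables (h11 : S1 *m S1 = 0) (h22 : S2 *m S2 = S1 *m S2 *m S1).
Let M := based h1 h2 h11 h22.

Lemma sq1_based (x : M) : sq1 M x = (x : 'rV_n) *m S1. Proof. exact: mxopE. Qed.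
Lemma sq2_based (x : M) : sq2 M x = (x : 'rV_n) *m S2. Proof. exact: mxopE. Qed.

Lemma pr_based d (x : M) i : (pr M d x : 'rV_n) 0 i = (dn i == d)%:R * (x : 'rV_n) 0 i.
Proof.
rewrite (_ : pr M d x = (x : 'rV_n) *m diag_mx (\row_i (dn i == d)%:R)); last exact: mxopE.
by rewrite mul_mx_diag !mxE mulrC.
Qed.

Lemma based_pr_out d : (forall i, dn i != d) -> forall x, pr M d x = 0.
Proof.
move=> h x; apply/rowP => i; rewrite pr_based (negPf (h i)) mul0r.
by rewrite [RHS]mxE.
Qed.

Variables (m : nat) (dm : 'I_m -> int) (T1 T2 : 'M['F_2]_m).
Variables (k1 : forall i j, T1 i j != 0 -> dm j = dm i + 1).
Variables (k2 : forall i j, T2 i j != 0 -> dm j = dm i + 2).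
Variables (k11 : T1 *m T1 = 0) (k22 : T2 *m T2 = T1 *m T2 *m T1).

Lemma based_mul_pr k (X : 'M['F_2]_(n, m)) :
  (forall i j, X i j != 0 -> dm j = dn i + k) -> forall d (x : M),
  (pr M d x : 'rV_n) *m X = pr (based k1 k2 k11 k22) (d + k) ((x : 'rV_n) *m X).
Proof.
move=> hX d x; pose D := \row_(i < n) (dn i == d)%:R : 'rV['F_2]_n.
pose D' := \row_(i < m) (dm i == d + k)%:R : 'rV['F_2]_m.
rewrite (_ : pr M d x = (x : 'rV_n) *m diag_mx D); last exact: mxopE.
rewrite [RHS](_ : _ = ((x : 'rV_n) *m X) *m diag_mx D'); last exact: mxopE.
rewrite -!mulmxA; congr (_ *m _); apply/matrixP => i j.
rewrite mul_diag_mx mul_mx_diag !mxE.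
have [->|/hX ->] := eqVneq (X i j) 0; first by rewrite mulr0 mul0r.
by rewrite mulrC (inj_eq (addIr k)).
Qed.

Lemma based_mor k (X : 'M['F_2]_(n, m)) :
  (forall i j, X i j != 0 -> dm j = dn i + k) ->
  S1 *m X = X *m T1 -> S2 *m X = X *m T2 ->
  mor k (fun x : M => (x : 'rV_n) *m X : based k1 k2 k11 k22).
Proof.
move=> hX X1 X2; split; first by move=> x y; rewrite mulmxDl.
- exact: based_mul_pr.
- by move=> x; rewrite sq1_based [RHS]mxopE -!mulmxA X1.
- by move=> x; rewrite sq2_based [RHS]mxopE -!mulmxA X2.
Qed.

End BasedMor.

Lemma pr_susp k (M : amod) d (x : susp k M) : pr (susp k M) d x = pr M (d - k) x.
Proof. by []. Qed.

(** * Extensions and syzygies *)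

(** The two vanishing conditions are what Sq1Sq1 = 0 and Sq2Sq2 = Sq1Sq2Sq1 demand of the extension
    in which Sq1 x gains the term [lam x *: e]. *)
Record lmod := LMod {
  lmc :> amod;
  lam : lmc -> 'F_2;
  lamD : {morph lam : x y / x + y};
  lam_pr : forall d x, lam (pr lmc d x) = (d == 0)%:R * lam x;
  lam_sq1 : forall x, lam (sq1 lmc x) = 0;
  lam_sq21 : forall x, lam (sq2 lmc (sq1 lmc x)) = 0
}.

(** Makes [lam] a morphism to F. It is a separate predicate because it fails for the Joker, whose
    class of degree 0 is Sq2 of its bottom class. *)
Definition lin2 (L : lmod) := forall x : L, lam (sq2 L x) = 0.

Lemma lam0 (L : lmod) : lam (0 : L) = 0.
Proof. by apply: (addrI (lam (0 : L))); rewrite -lamD !addr0. Qed.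

(* The extension of Sigma^4 L by B in which Sq1 of a class x of Sigma^4 L gains
   the term lam x *: e. *)
Section Ext.
Variables (B : amod) (e : B).
Hypothesis (e5 : pr B 5 e = e) (es1 : sq1 B e = 0) (es2 : sq2 B e = 0).
Variable L : lmod.

Let M4 := susp 4 L.

Definition ext1f (x : B * L) : B * L := (sq1 B x.1 + lam x.2 *: e, sq1 L x.2).

Lemma ext1D : addmap ext1f.
Proof.
move=> [b m] [b' m']; rewrite /ext1f /= lamD scalerDl !linearD /= addrACA.
by [].
Qed.

Definition ext1 : 'End((B * L)%type) := lin_of ext1D.

Lemma ext1E x : ext1 x = (sq1 B x.1 + lam x.2 *: e, sq1 L x.2).
Proof. exact: lin_ofE. Qed.

Lemma ext_pr1 d : (dmap (pr B (d + 1)) (pr M4 (d + 1)) \o ext1 =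
  ext1 \o dmap (pr B d) (pr M4 d))%VF.
Proof.
apply/lfunP => x; rewrite !comp_lfunE !ext1E !dmapE /= linearD linearZ /= prsq1.
rewrite !pr_susp addrAC prsq1 lam_pr; congr (_ + _, _).
rewrite -{1}e5 prprE; have [->|d4] := eqVneq d 4.
  by rewrite eqxx subrr eqxx mul1r e5.
rewrite ifF ?subr_eq0 ?(negPf d4) ?mul0r ?scale0r ?scaler0 //.
by apply/eqP => ?; case/eqP: d4; lia.
Qed.

Lemma ext_sq11 : (ext1 \o ext1 = 0)%VF.
Proof.
apply/lfunP => x; rewrite comp_lfunE !ext1E /= linearD linearZ /= !sq1_sq1 es1 scaler0 addr0.
by rewrite lam_sq1 scale0r addr0 zero_lfunE.
Qed.

Lemma ext_sq22 : (dmap (sq2 B) (sq2 M4) \o dmap (sq2 B) (sq2 M4) =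
  ext1 \o dmap (sq2 B) (sq2 M4) \o ext1)%VF.
Proof.
apply/lfunP => x; rewrite !comp_lfunE !ext1E !dmapE /= !linearD !linearZ /=.
rewrite es2 linear0 !scaler0 addr0 -!sq2_sq2 -[sq2 M4]/(sq2 L) lam_sq21 scale0r addr0.
by [].
Qed.

Definition ext_mod : amod :=
  amod_of (undup_uniq _) (@dsum_pr_comp B M4) (@dsum_pr_sum B M4)
    ext_pr1 (@dsum_pr_sq2 B M4) ext_sq11 ext_sq22.

Lemma sq1_ext (x : ext_mod) : sq1 ext_mod x = (sq1 B x.1 + lam x.2 *: e, sq1 L x.2).
Proof. exact: ext1E. Qed.

Lemma sq2_ext (x : ext_mod) : sq2 ext_mod x = (sq2 B x.1, sq2 L x.2).
Proof. exact: dmapE. Qed.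

Lemma pr_ext d (x : ext_mod) : pr ext_mod d x = (pr B d x.1, pr L (d - 4) x.2).
Proof. exact: dmapE. Qed.

Lemma top_ext (x : ext_mod) : top x = (top x.1, @top L x.2).
Proof. by rewrite /top !sq2_ext. Qed.

Lemma ext_reduced : reduced B -> reduced L -> reduced ext_mod.
Proof.
move=> /reducedP rB /reducedP rL; apply/reducedP => x.
by rewrite top_ext rB rL.
Qed.

Lemma dim_ext : \dim {:ext_mod} = (\dim {:B} + \dim {:L})%N.
Proof. exact: dim_prod. Qed.

Lemma ext_mor k (X : amod) (f : B -> X) (g : L -> X) : mor k f ->
  addmap g -> (forall d m, g (pr L d m) = pr X (d + 4 + k) (g m)) ->
  (forall m, lam m *: f e + g (sq1 L m) = sq1 X (g m)) ->
  (forall m, g (sq2 L m) = sq2 X (g m)) ->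
  mor k (fun x : ext_mod => f x.1 + g x.2).
Proof.
move=> hf gD gp g1 g2; split.
- by move=> x y; rewrite /= (morD hf) gD addrACA.
- by move=> d x; rewrite pr_ext /= (mor_pr hf) gp subrK linearD.
- move=> x; rewrite sq1_ext /= (morD hf) (mor1 hf) (addmapZ _ _ (morD hf)) -addrA g1.
  by rewrite linearD.
- by move=> x; rewrite sq2_ext /= (mor2 hf) g2 linearD.
Qed.

End Ext.

(** * The extensions by A(1)/A(1)Sq1 and A(1)/A(1)Sq2Sq1 *)

Definition B4t1 : seq (seq nat) := [:: [::]; [:: 2]; [::]; [::]]%N.
Definition B4t2 : seq (seq nat) := [:: [:: 1]; [::]; [:: 3]; [::]]%N.
Lemma B4_ok : tab_ok 4 [:: 0; 2; 3; 5] B4t1 B4t2. Proof. by []. Qed.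
(* A(1)/A(1)Sq1, with basis 1, Sq2, Sq1Sq2, Sq2Sq1Sq2. *)
Definition B4 : amod := tab B4_ok.

Definition D5t1 : seq (seq nat) := [:: [:: 1]; [::]; [:: 3]; [::]; [::]]%N.
Definition D5t2 : seq (seq nat) := [:: [:: 2]; [::]; [::]; [:: 4]; [::]]%N.
Lemma D5_ok : tab_ok 5 [:: 0; 1; 2; 3; 5] D5t1 D5t2. Proof. by []. Qed.
(* A(1)/A(1)Sq2Sq1, with basis 1, Sq1, Sq2, Sq1Sq2, Sq2Sq1Sq2. *)
Definition D5 : amod := tab D5_ok.

Definition bvec n (k : nat) : 'rV['F_2]_n := \row_j ((j : nat) == k)%:R.

Lemma bvec_tmx n m k t : (k < n)%N -> bvec n k *m tabmx n m t =
  \row_j ((j : nat) \in nth [::] t k)%:R.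
Proof.
move=> kn; apply/rowP => j; rewrite !mxE (bigD1 (Ordinal kn)) //= !mxE eqxx mul1r.
rewrite big1 ?addr0 // => i ik; rewrite !mxE (_ : ((i : nat) == k) = false) ?mul0r //.
by apply/negbTE; apply: contra ik => /eqP e; apply/eqP/val_inj.
Qed.

Lemma row_nil n : \row_(j < n) ((j : nat) \in [::])%:R = 0 :> 'rV['F_2]_n.
Proof. by apply/rowP => j; rewrite !mxE. Qed.

Lemma row_bvec n k : \row_(j < n) ((j : nat) \in [:: k])%:R = bvec n k.
Proof. by apply/rowP => j; rewrite !mxE inE. Qed.

Definition bvecE := (bvec_tmx, row_nil, row_bvec).

Section TabElt.
Variables (n : nat) (ds : seq int) (t1 t2 : seq (seq nat)) (ok : tab_ok n ds t1 t2).

Lemma sq1_tab (x : tab ok) : sq1 (tab ok) x = (x : 'rV_n) *m tabmx n n t1.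
Proof. exact: mxopE. Qed.

Lemma sq2_tab (x : tab ok) : sq2 (tab ok) x = (x : 'rV_n) *m tabmx n n t2.
Proof. exact: mxopE. Qed.

Lemma pr_tab d k : (k < n)%N -> pr (tab ok) d (bvec n k) = (ds`_k == d)%:R *: (bvec n k : tab ok).
Proof.
move=> kn; apply/rowP => i; rewrite pr_based !mxE; case: (eqVneq (i : nat) k) => [->|_]; rewrite ?mulr0 //.
Qed.

End TabElt.

Definition b3 : B4 := bvec 4 3.
Lemma b3_5 : pr B4 5 b3 = b3. Proof. by rewrite pr_tab // scale1r. Qed.
Lemma b3_s1 : sq1 B4 b3 = 0. Proof. by rewrite sq1_tab !bvecE. Qed.
Lemma b3_s2 : sq2 B4 b3 = 0. Proof. by rewrite sq2_tab !bvecE. Qed.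

Definition d4 : D5 := bvec 5 4.
Lemma d4_5 : pr D5 5 d4 = d4. Proof. by rewrite pr_tab // scale1r. Qed.
Lemma d4_s1 : sq1 D5 d4 = 0. Proof. by rewrite sq1_tab !bvecE. Qed.
Lemma d4_s2 : sq2 D5 d4 = 0. Proof. by rewrite sq2_tab !bvecE. Qed.

Definition extB_mod (L : lmod) : amod := ext_mod b3_5 b3_s1 b3_s2 L.
Definition extD (L : lmod) : amod := ext_mod d4_5 d4_s1 d4_s2 L.

Definition cof n (c : seq (seq nat)) (x : 'rV['F_2]_n) : 'F_2 := (x *m tabmx n 1 c) 0 0.

Lemma cofD n c : {morph @cof n c : x y / x + y}.
Proof. by move=> x y; rewrite /cof mulmxDl mxE. Qed.

Lemma cof_mul n m c t x : cof c (x *m tabmx n m t) = cof (tmul n m 1 t c) x.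
Proof. by rewrite /cof -mulmxA tmxM. Qed.

Lemma cof_nil n k x : @cof n (nseq k [::]) x = 0.
Proof. by rewrite /cof tmx0 mulmx0 mxE. Qed.

Lemma cof_tab_pr n ds t1 t2 (ok : tab_ok n ds t1 t2) c e :
  all (fun i => (0%N \in nth [::] c i) ==> (ds`_i == e)) (iota 0 n) ->
  forall d (x : tab ok), cof c (pr (tab ok) d x) = (d == e)%:R * cof c x.
Proof.
move=> /allP h d x; rewrite /cof !mxE mulr_sumr; apply: eq_bigr => i _.
rewrite pr_based !mxE; have := h i; rewrite mem_iota /= => /(_ (ltn_ord i)).
case: (_ \in _) => [/= /eqP ->|_]; last by rewrite !mulr0.
by rewrite mulr1 eq_sym mulr1.
Qed.

Definition B4c : seq (seq nat) := [:: [:: 0]; [::]; [::]; [::]]%N.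

Section EBlmod.
Variable L : lmod.

Lemma EB_lamD : {morph (fun x : extB_mod L => cof B4c x.1) : x y / x + y}.
Proof. by move=> x y; rewrite -cofD. Qed.

Lemma cof_b3 : cof B4c b3 = 0.
Proof. by rewrite /cof /b3 bvec_tmx // mxE. Qed.

Lemma cofZ n c a (x : 'rV_n) : cof c (a *: x) = a * cof c x.
Proof. by rewrite /cof -scalemxAl mxE. Qed.

Lemma EB_lam_pr d (x : extB_mod L) : cof B4c (pr (extB_mod L) d x).1 = (d == 0)%:R * cof B4c x.1.
Proof. by rewrite pr_ext /= (cof_tab_pr (e := 0)). Qed.

Lemma EB_lam1 (x : extB_mod L) : cof B4c (sq1 (extB_mod L) x).1 = 0.
Proof. by rewrite sq1_ext /= cofD cofZ cof_b3 mulr0 addr0 sq1_tab cof_mul (cof_nil 4). Qed.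

Lemma EB_lam2 (x : extB_mod L) : cof B4c (sq2 (extB_mod L) x).1 = 0.
Proof. by rewrite sq2_ext /= sq2_tab cof_mul (cof_nil 4). Qed.

(** The new functional is the coefficient of 1 in B, which neither Sq1 nor Sq2 can reach. *)
Definition extB : lmod := @LMod (extB_mod L) (fun x => cof B4c x.1) EB_lamD EB_lam_pr EB_lam1
  (fun x => EB_lam2 _).

Lemma E_lin2 : lin2 extB. Proof. exact: EB_lam2. Qed.

End EBlmod.

Definition tabfun n m t (x : 'rV['F_2]_n) : 'rV['F_2]_m := x *m tabmx n m t.
Arguments tabfun {n m} t x.

Lemma tab_mor n ds t1 t2 (ok : tab_ok n ds t1 t2) m ds' t1' t2' (ok' : tab_ok m ds' t1' t2') k X :
  [&& all (fun i => all (fun j => ds'`_j == ds`_i + k) (nth [::] X i)) (iota 0 n),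
    tmul n n m t1 X == tmul n m m X t1' & tmul n n m t2 X == tmul n m m X t2'] ->
  mor k (tabfun X : tab ok -> tab ok').
Proof.
case/and3P=> hd /eqP e1 /eqP e2; apply: based_mor; first exact: (tab_deg hd).
  by rewrite !tmxM e1.
by rewrite !tmxM e2.
Qed.

Lemma tab_pr n ds t1 t2 (ok : tab_ok n ds t1 t2) m ds' t1' t2' (ok' : tab_ok m ds' t1' t2') k X :
  all (fun i => all (fun j => ds'`_j == ds`_i + k) (nth [::] X i)) (iota 0 n) ->
  forall d (x : tab ok), tabfun X (pr (tab ok) d x) = pr (tab ok') (d + k) (tabfun X x).
Proof. by move=> hd; apply: based_mul_pr; apply: (tab_deg hd). Qed.

Definition A1t1 : seq (seq nat) := [:: [:: 1]; [::]; [:: 3]; [::]; [:: 5]; [::]; [:: 7]; [::]]%N.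
Definition A1t2 : seq (seq nat) := [:: [:: 2]; [:: 4]; [:: 5]; [:: 6]; [::]; [:: 7]; [::]; [::]]%N.
Lemma A1_ok : tab_ok 8 [:: 0; 1; 2; 3; 3; 4; 5; 6] A1t1 A1t2. Proof. by []. Qed.
(** The same vector space as [A1], with the action rewritten in tables; the identity is an
    isomorphism. *)
Definition A1t : amod := tab A1_ok.

Lemma A1_tab : mor 0 (id : A1 -> A1t).
Proof.
have h1 : 1%:M *m tabmx 8 8 A1t1 = pmx 8 (A1tab 1) *m 1%:M.
  rewrite mul1mx mulmx1; apply/matrixP => -[i i8] [j j8]; rewrite !mxE /=.
  by move: i i8 j j8 => [|[|[|[|[|[|[|[|i]]]]]]]] // _ [|[|[|[|[|[|[|[|j]]]]]]]].
have h2 : 1%:M *m tabmx 8 8 A1t2 = pmx 8 (A1tab 2) *m 1%:M.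
  rewrite mul1mx mulmx1; apply/matrixP => -[i i8] [j j8]; rewrite !mxE /=.
  by move: i i8 j j8 => [|[|[|[|[|[|[|[|i]]]]]]]] // _ [|[|[|[|[|[|[|[|j]]]]]]]].
apply: (@mor_eq 0 A1 A1t (fun x => (x : 'rV_8) *m 1%:M)) => [x|]; first exact: mulmx1.
apply: based_mor (esym h1) (esym h2) => i j.
rewrite mxE; case: (eqVneq i j) => [->|]; last by rewrite eqxx.
by move=> _; rewrite addr0; move: j => -[[|[|[|[|[|[|[|[|j]]]]]]]] //].
Qed.

Lemma tab_A1 : mor 0 (id : A1t -> A1).
Proof. by have := mor_inv A1_tab (fun=> erefl) (fun=> erefl); rewrite oppr0. Qed.

Lemma mor_from_A1 k (M : amod) (f : A1t -> M) : mor k f -> mor k (f : A1 -> M).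
Proof. by move=> h; have := mor_comp A1_tab h; rewrite add0r. Qed.

Lemma mor_to_A1 k (M : amod) (f : M -> A1t) : mor k f -> mor k (f : M -> A1).
Proof. by move=> h; have := mor_comp h tab_A1; rewrite addr0. Qed.

Lemma tmK n m X Y : tmul n m n X Y = tid n -> cancel (@tabfun n m X) (tabfun Y).
Proof. by move=> e x; rewrite /tabfun -mulmxA tmxM e tmx1 mulmx1. Qed.

Lemma tm_tm n m p X Y x : tabfun (n:=m) (m:=p) Y (@tabfun n m X x) = tabfun (tmul n m p X Y) x.
Proof. by rewrite /tabfun -mulmxA tmxM. Qed.

Lemma tm_nil n m p x : @tabfun n m (nseq p [::]) x = 0.
Proof. by rewrite /tabfun tmx0 mulmx0. Qed.

Lemma cof_tm n m X c x : cof c (@tabfun n m X x) = cof (tmul n m 1 X c) x.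
Proof. exact: cof_mul. Qed.

Lemma tmZ n m X a x : @tabfun n m X (a *: x) = a *: tabfun X x.
Proof. by rewrite /tabfun scalemxAl. Qed.

Lemma tmD n m X x y : @tabfun n m X (x + y) = tabfun X x + tabfun X y.
Proof. by rewrite /tabfun mulmxDl. Qed.

Lemma dim_tab n ds t1 t2 (ok : tab_ok n ds t1 t2) : \dim {:tab ok} = n.
Proof. by rewrite dimvf; apply: mul1n. Qed.

Lemma ses_susp k (N P M : amod) (i : N -> P) (p : P -> M) :
  ses i p -> ses (i : susp k N -> susp k P) (p : susp k P -> susp k M).
Proof.
move=> [hi hp iI pS pi ex]; split=> //.
  by have := mor_susp hi k k; rewrite add0r subrr.
by have := mor_susp hp k k; rewrite add0r subrr.
Qed.

(** * The syzygy of an extension *)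

(* Right multiplication by Sq1, as a map from A(1)/A(1)Sq1, and the projection
   of A(1) onto A(1)/A(1)Sq1. *)
Definition XB : seq (seq nat) := [:: [:: 1]; [:: 4]; [:: 5]; [:: 7]]%N.
Definition QB : seq (seq nat) := [:: [:: 0]; [::]; [:: 1]; [:: 2]; [::]; [::]; [:: 3]; [::]]%N.

Lemma XB_mor : mor 1 (tabfun XB : B4 -> A1).
Proof. exact/mor_to_A1/tab_mor. Qed.

Lemma QB_mor : mor 0 (tabfun QB : A1 -> B4).
Proof. exact/mor_from_A1/tab_mor. Qed.

Lemma ses_B4 : ses (tabfun XB : susp 1 B4 -> A1) (tabfun QB : A1 -> B4).
Proof.
apply: ses_of_dim.
- by apply/mor_of_susp; rewrite add0r; apply: XB_mor.
- exact: QB_mor.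
- apply: (can_inj (g := tabfun [:: [::]; [:: 0]; [::]; [::]; [:: 1]; [:: 2]; [::]; [:: 3]]%N)).
  exact: tmK.
- by move=> y; exists (tabfun [:: [:: 0]; [:: 2]; [:: 3]; [:: 6]]%N y); apply: tmK.
- by move=> x; rewrite tm_tm (tm_nil 4 4).
- by have d : \dim {:B4} = 4%N := dim_tab _; rewrite dim_A1 -[\dim {:susp 1 B4}]/(\dim {:B4}) d.
Qed.

(** The element Sq2Sq1Sq2. It lifts the top class of B along [QB], and its Sq1 is the image of that
    class under [XB]; these two facts produce the extension terms of quotient and kernel. *)
Definition e6 : A1 := (bvec 8 6 : 'rV_8).

Lemma e6_sq1 : sq1 A1 e6 = tabfun XB b3.
Proof.
rewrite -(mor1 tab_A1) [sq1 A1t _]sq1_tab /tabfun !bvecE //.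
Qed.

Lemma e6_sq2 : sq2 A1 e6 = 0.
Proof. by rewrite -(mor2 tab_A1) [sq2 A1t _]sq2_tab !bvecE. Qed.

Lemma e6_pr d : pr A1 d e6 = (5 == d)%:R *: e6.
Proof. by have := mor_pr tab_A1 d e6; rewrite addr0 => <-; rewrite pr_tab. Qed.

Lemma e6_QB : tabfun QB e6 = b3.
Proof. by rewrite /tabfun !bvecE. Qed.

(** The coefficient of Sq1 in A(1). Composed with Sq1 it reads the coefficient of 1, and it vanishes
    on multiples of Sq2 from the left. *)
Definition eta1 : seq (seq nat) := [:: [::]; [:: 0]]%N.

(* N is Sigma^-1 Omega M up to free summands, compatibly with the functionals. *)
Record link (M N : lmod) : Prop := Link {
  link_ex : exists (P : amod) (i : N -> P) (p : P -> M) (eta : P -> 'F_2),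
  [/\ is_free P, ses (i : susp 1 N -> P) p,
      [/\ {morph eta : x y / x + y} & forall d z, eta (pr P d z) = (d == 1)%:R * eta z] &
      [/\ forall z, eta (sq1 P z) = lam (p z), forall z, eta (sq2 P z) = 0 &
          forall n, eta (i n) = lam n]] }.

Section Step.
Variables (M N : lmod) (P : amod) (i : N -> P) (p : P -> M) (eta : P -> 'F_2).
Hypothesis S : ses (i : susp 1 N -> P) p.
Hypothesis etaD : {morph eta : x y / x + y}.
Hypothesis eta_pr : forall d z, eta (pr P d z) = (d == 1)%:R * eta z.
Hypothesis eta1s : forall z, eta (sq1 P z) = lam (p z).
Hypothesis eta2 : forall z, eta (sq2 P z) = 0.
Hypothesis etai : forall n, eta (i n) = lam n.
Hypothesis N2 : lin2 N.

Let P' := dsum A1 (susp 4 P).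

Let hi : mor 1 i.
Proof. by have /mor_of_susp := ses_i S; rewrite add0r. Qed.

(** The term in [e6] makes Sq1 of a class of N produce [lam x *: tabfun XB b3], as the extension
    prescribes. Since Sq2 kills [e6], compatibility with Sq2 uses [lin2 N]. *)
Definition step_i (x : extB N) : P' := (tabfun XB x.1 + lam x.2 *: e6, i x.2).

Lemma step_i_mor : mor 1 step_i.
Proof.
have hg : mor 1 (fun b : B4 => (tabfun XB b, 0) : P').
  have h := mor_comp XB_mor (mor_inl A1 (susp 4 P)).
  by rewrite addr0 in h; apply: h.
apply: (mor_eq _ (ext_mor b3_5 b3_s1 b3_s2 (g := fun n => (lam n *: e6, i n) : P') hg _ _ _ _)).
- by move=> [b n]; rewrite /step_i /= -[LHS]/((tabfun XB b + lam n *: e6, 0 + i n)) add0r.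
- by move=> x y; rewrite lamD scalerDl (morD hi).
- move=> d n; rewrite pr_dsum /= lam_pr pr_susp (mor_pr hi); congr (_, pr P _ _); last lia.
  rewrite linearZ /= e6_pr scalerA (_ : (5 == d + 4 + 1) = (d == 0)) 1?mulrC //.
  by apply/eqP/eqP; lia.
- move=> n; rewrite sq1_dsum /= lam_sq1 scale0r linearZ /= e6_sq1 (mor1 hi).
  rewrite -[LHS]/((lam n *: tabfun XB b3 + 0, lam n *: (0 : susp 4 P) + sq1 P (i n))).
  by rewrite addr0 scaler0 add0r.
- move=> n; rewrite sq2_dsum /= N2 scale0r linearZ /= e6_sq2 scaler0 (mor2 hi) //.
Qed.

Section StepQuotient.
Variables (Q : amod) (q : Q) (q5 : pr Q 5 q = q) (qs1 : sq1 Q q = 0) (qs2 : sq2 Q q = 0).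
Variable h : A1 -> Q.
Hypothesis hh : mor 0 h.
Hypothesis hS : forall y, exists x, h x = y.
Hypothesis h6 : h e6 = q.

Let X := ext_mod q5 qs1 qs2 M.

(** The term [eta z.2 *: q] accounts for the extension term, as eta (Sq1 z) = lam (p z); on the
    image of [step_i] it cancels against h e6 = q, as eta (i n) = lam n. Q stays abstract to serve
    for both A(1)/A(1)Sq1 and A(1)/A(1)Sq2Sq1. *)
Definition step_p (z : P') : X := (h z.1 + eta z.2 *: q, p z.2).

Lemma step_p_mor : mor 0 step_p.
Proof.
have hp := ses_p S; split.
- move=> x y; rewrite /step_p /= (morD hh) etaD scalerDl (morD hp) addrACA.
  by [].
- move=> d z; rewrite addr0 pr_dsum /step_p pr_ext /= pr_susp.
  rewrite eta_pr (mor_pr hh) (mor_pr hp) !addr0 linearD linearZ /=.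
  congr (_ + _, _); rewrite -{2}q5 prprE.
  have [->|d5] := eqVneq d 5; first by rewrite mul1r q5.
  rewrite scaler0 (_ : d - 4 == 1 = false) ?mul0r ?scale0r //.
  by apply/eqP => ?; case/eqP: d5; lia.
- move=> z; rewrite sq1_dsum /step_p sq1_ext /= (mor1 hh) (mor1 hp).
  by rewrite linearD linearZ /= qs1 scaler0 addr0 -eta1s.
- move=> z; rewrite sq2_dsum /step_p sq2_ext /= (mor2 hh) (mor2 hp).
  by rewrite linearD linearZ /= qs2 scaler0 addr0 -[sq2 (susp 4 P) _]/(sq2 P z.2) eta2 scale0r addr0.
Qed.

Lemma step_p_surj y : exists x, step_p x = y.
Proof.
case: y => b m; have [z zm] := ses_surj S m.
have [a ab] := hS (b - eta z *: q); exists (a, z).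
by rewrite /step_p /= ab zm subrK.
Qed.

Lemma step_pi (x : extB N) : h (tabfun XB x.1) = 0 -> step_p (step_i x) = 0.
Proof.
move=> hx; rewrite /step_p /step_i /= (morD hh) hx add0r (addmapZ _ _ (morD hh)) h6 etai.
by rewrite addrr2 (ses_pi S).
Qed.

Lemma step_ex (z : P') : step_p z = 0 -> exists n, z.2 = i n /\
  h (z.1 + lam n *: e6) = 0.
Proof.
case: z => a z /= [e /(ses_ex S)[n nz]]; exists n; split=> //.
by rewrite (morD hh) (addmapZ _ _ (morD hh)) h6 -etai nz.
Qed.

End StepQuotient.

Lemma step_i_inj : injective step_i.
Proof.
apply: addmap_inj (morD step_i_mor) _ => -[b n] [e i0].
have n0 : n = 0 by apply: (ses_inj S); rewrite i0 (mor0 hi).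
move: e; rewrite n0 lam0 scale0r addr0 => e; congr (_, _).
by apply: (ses_inj ses_B4); rewrite e (mor0 (ses_i ses_B4)).
Qed.

Lemma step_ses : ses (step_i : susp 1 (extB N) -> P') (step_p b3_5 b3_s1 b3_s2 (tabfun QB) : P' -> extB M).
Proof.
split.
- by apply/mor_of_susp; rewrite add0r; apply: step_i_mor.
- exact: step_p_mor QB_mor.
- exact: step_i_inj.
- exact: step_p_surj (ses_surj ses_B4).
- move=> x; apply: step_pi => //; [exact: QB_mor | exact: e6_QB |].
  exact: (ses_pi ses_B4).
- move=> [a z] /(step_ex QB_mor e6_QB)[n [/= zn /(ses_ex ses_B4)[b bvec]]].
  by exists (b, n); rewrite /step_i /= bvec zn -addrA addrr2 addr0.
Qed.

(** For the new sequence the connecting functional is the coefficient of Sq1 in the added summand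
    A(1). *)
Lemma step_link : is_free P -> link (extB M) (extB N).
Proof.
move=> fP; split; exists P', step_i, (step_p b3_5 b3_s1 b3_s2 (tabfun QB)), (fun z => cof eta1 (z.1 : 'rV_8)).
split.
- apply: is_free_dsum (is_free_susp _ fP).
  by apply: is_free_iso (isom_susp0 _) _; apply: is_free_A1.
- exact: step_ses.
- split=> [x y|d z]; first by rewrite -cofD.
  rewrite pr_dsum /=; have := mor_pr A1_tab d z.1; rewrite addr0 => ->.
  by rewrite (cof_tab_pr (e := 1)).
- split.
  + move=> z; rewrite sq1_dsum /=; have := mor1 A1_tab z.1 => /= ->.
    rewrite sq1_tab -[_ *m _]/(tabfun _ _) cof_tm cofD cofZ cof_b3 mulr0 addr0.
    by rewrite cof_tm.
  + move=> z; rewrite sq2_dsum /=; have := mor2 A1_tab z.1 => /= ->.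
    by rewrite sq2_tab -[_ *m _]/(tabfun _ _) cof_tm (cof_nil 8).
  + move=> [b n]; rewrite /step_i /= cofD cofZ cof_tm.
    rewrite [X in _ + _ * X](_ : _ = 0) ?mulr0 ?addr0 //.
    by rewrite /cof /e6 bvec_tmx // mxE.
Qed.

(* The projection of A(1) onto A(1)/A(1)Sq2Sq1. *)
Definition QD : seq (seq nat) := [:: [:: 0]; [:: 1]; [:: 2]; [:: 3]; [::]; [::]; [:: 4]; [::]]%N.

Lemma QD_mor : mor 0 (tabfun QD : A1 -> D5).
Proof. exact/mor_from_A1/tab_mor. Qed.

Lemma QD_surj y : exists x : A1, @tabfun 8 5 QD x = y.
Proof. by exists (tabfun [:: [:: 0]; [:: 1]; [:: 2]; [:: 3]; [:: 6]]%N y); apply: tmK. Qed.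

Lemma e6_QD : @tabfun 8 5 QD e6 = d4.
Proof. by rewrite /tabfun !bvecE. Qed.

(** Right multiplication by Sq1 carries A(1)Sq2/(A(1)Sq1 cap A(1)Sq2), the part of B without the
    class 1, onto A(1)Sq2Sq1. This is why passing from B to D in the quotient cuts [extB N] down to
    the kernel of [lam]. *)
Lemma QD_XB (b : B4) : cof B4c b = 0 -> @tabfun 8 5 QD (@tabfun 4 8 XB b) = 0.
Proof.
move=> b0; rewrite tm_tm; apply/rowP => j; rewrite [RHS]mxE.
move: b0; rewrite /cof /tabfun !mxE !big_ord_recl !big_ord0 !mxE /= !mulr0 !addr0 mulr1 => ->.
by rewrite mul0r.
Qed.

Lemma QD_ex (a : A1) : @tabfun 8 5 QD a = 0 -> exists2 b : B4, @tabfun 4 8 XB b = a & cof B4c b = 0.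
Proof.
move=> a0.
have [b bvec] : exists b : B4, @tabfun 4 8 XB b = a.
  apply: (ses_ex ses_B4).
  (* [QB] factors through [QD], because A(1)Sq2Sq1 is contained in A(1)Sq1. *)
  have -> : @tabfun 8 4 QB a = @tabfun 5 4 [:: [:: 0]; [::]; [:: 1]; [:: 2]; [:: 3]]%N (@tabfun 8 5 QD a : 'rV_5).
    by rewrite tm_tm.
  by rewrite a0 /tabfun mul0mx.
exists b => //.
have -> : cof B4c b = cof [:: [::]; [:: 0]]%N (@tabfun 8 5 QD (@tabfun 4 8 XB b) : 'rV_5).
  by rewrite !cof_tm.
by rewrite bvec a0 /cof mul0mx mxE.
Qed.

Lemma stepD_ses (K : amod) (j : K -> extB N) : mor 0 j -> injective j ->
  (forall k, lam (j k) = 0) -> (forall x : extB N, lam x = 0 -> exists k, j k = x) ->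
  ses (fun k : susp 1 K => step_i (j k)) (step_p d4_5 d4_s1 d4_s2 (tabfun QD) : P' -> extD M).
Proof.
move=> hj jI lj jS; split.
- apply/mor_of_susp; rewrite add0r; have := mor_comp hj step_i_mor.
  by rewrite add0r.
- exact: step_p_mor QD_mor.
- by move=> x y /step_i_inj/jI.
- by apply: step_p_surj => y; apply: QD_surj.
- move=> x; apply: step_pi => //; [exact: QD_mor | exact: e6_QD |].
  exact: QD_XB (lj x).
- move=> [a z] /(step_ex QD_mor e6_QD)[n [/= zn /QD_ex[b bvec b0]]].
  have [k kE] := jS (b, n) b0; exists k; rewrite kE /step_i /= bvec zn.
  by rewrite -addrA addrr2 addr0.
Qed.

End Step.

Lemma link_step M N : lin2 N -> link M N -> link (extB M) (extB N).
Proof.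
move=> N2 [[P [i [p [eta [fP S [eD ep] [e1 e2 ei]]]]]]].
exact: (step_link S eD ep e1 e2 ei N2 fP).
Qed.

(** * The four initial modules and their syzygies *)

Lemma F_lam1 (x : unit_mod) : uc (sq1 unit_mod x) = 0.
Proof. by rewrite sq1_unit /uc mxE. Qed.
Lemma F_lam2 (x : unit_mod) : uc (sq2 unit_mod x) = 0.
Proof. by rewrite sq2_unit /uc mxE. Qed.

Definition Flm : lmod := @LMod unit_mod uc ucD uc_pr F_lam1 (fun x => F_lam2 _).

Section TabLmod.
Variables (n : nat) (ds : seq int) (t1 t2 : seq (seq nat)) (ok : tab_ok n ds t1 t2).
Variable c : seq (seq nat).
Definition tablm_ok := [&& all (fun i => (0%N \in nth [::] c i) ==> (ds`_i == 0)) (iota 0 n),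
  tmul n n 1 t1 c == nseq n [::] & tmul n n 1 (tmul n n n t1 t2) c == nseq n [::]].
Hypothesis h : tablm_ok.

Lemma tablm_pr d (x : tab ok) : cof c (pr (tab ok) d x) = (d == 0)%:R * cof c x.
Proof. by case/and3P: h => h1 _ _; apply: cof_tab_pr. Qed.

Lemma tablm1 (x : tab ok) : cof c (sq1 (tab ok) x) = 0.
Proof. by case/and3P: h => _ /eqP e _; rewrite sq1_tab cof_mul e cof_nil. Qed.

Lemma tablm21 (x : tab ok) : cof c (sq2 (tab ok) (sq1 (tab ok) x)) = 0.
Proof.
by case/and3P: h => _ _ /eqP e; rewrite sq2_tab sq1_tab -mulmxA tmxM cof_mul e cof_nil.
Qed.

Definition tablm : lmod := @LMod (tab ok) (cof c) (@cofD n c) tablm_pr tablm1 tablm21.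
End TabLmod.

Definition J5t1 : seq (seq nat) := [:: [:: 1]; [::]; [::]; [:: 4]; [::]]%N.
Definition J5t2 : seq (seq nat) := [:: [:: 2]; [:: 3]; [:: 4]; [::]; [::]]%N.
Lemma J5_ok : tab_ok 5 [:: -2; -1; 0; 1; 2] J5t1 J5t2. Proof. by []. Qed.
Definition J5c : seq (seq nat) := [:: [::]; [::]; [:: 0]; [::]; [::]]%N.
Lemma J5l_ok : tablm_ok 5 [:: -2; -1; 0; 1; 2] J5t1 J5t2 J5c. Proof. by []. Qed.
(** The functional reads the middle class of the Joker, in degree 0. *)
Definition J5 : lmod := tablm J5_ok J5l_ok.

Definition Z7d : seq int := [:: 0; 1; 2; 2; 3; 4; 5].
Definition Z7t1 : seq (seq nat) := [:: [::]; [:: 2]; [::]; [:: 4]; [::]; [:: 6]; [::]]%N.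
Definition Z7t2 : seq (seq nat) := [:: [:: 3]; [:: 4]; [:: 5]; [::]; [:: 6]; [::]; [::]]%N.
Lemma Z7_ok : tab_ok 7 Z7d Z7t1 Z7t2. Proof. by []. Qed.
Definition Z7c : seq (seq nat) := [:: [:: 0]; [::]; [::]; [::]; [::]; [::]; [::]]%N.
Lemma Z7l_ok : tablm_ok 7 Z7d Z7t1 Z7t2 Z7c. Proof. by []. Qed.
(** Sigma^-1 Omega F: the words of positive degree, with the functional reading Sq1. *)
Definition Z7 : lmod := tablm Z7_ok Z7l_ok.

Definition Y3t1 : seq (seq nat) := [:: [::]; [:: 2]; [::]]%N.
Definition Y3t2 : seq (seq nat) := [:: [:: 1]; [::]; [::]]%N.
Lemma Y3_ok : tab_ok 3 [:: 0; 2; 3] Y3t1 Y3t2. Proof. by []. Qed.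
Definition Y3c : seq (seq nat) := [:: [:: 0]; [::]; [::]]%N.
Lemma Y3l_ok : tablm_ok 3 [:: 0; 2; 3] Y3t1 Y3t2 Y3c. Proof. by []. Qed.
(** Sigma^-1 Omega J: the left ideal spanned by Sq1Sq2, Sq2Sq1Sq2 and the top class, moved down from
    degrees 3, 5, 6. *)
Definition Y3 : lmod := tablm Y3_ok Y3l_ok.

Lemma Z7_lin2 : lin2 Z7.
Proof. by move=> x; rewrite /= sq2_tab cof_mul (cof_nil 7). Qed.

Lemma Y3_lin2 : lin2 Y3.
Proof. by move=> x; rewrite /= sq2_tab cof_mul (cof_nil 3). Qed.

Lemma tab_reduced n ds t1 t2 (ok : tab_ok n ds t1 t2) :
  tmul n n n t2 (tmul n n n t2 t2) == nseq n [::] -> reduced (tab ok).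
Proof.
move/eqP=> e; apply/reducedP => x.
by rewrite /top !sq2_tab -!mulmxA !tmxM e tmx0 mulmx0.
Qed.

Lemma is_free_A1' : is_free A1.
Proof. by apply: is_free_iso (isom_susp0 _) _; apply: is_free_A1. Qed.

Definition c0 : seq (seq nat) := [:: [:: 0]; [::]; [::]; [::]; [::]; [::]; [::]; [::]]%N.

Lemma coefA0_cof (a : A1) : coefA 0 a = cof c0 a.
Proof.
rewrite /coefA /cof mxE (bigD1 0) //= mxE mulr1 big1 ?addr0.
  by congr (fun_of_matrix a _ _); apply: val_inj; rewrite /= inordK.
by move=> -[[|[|[|[|[|[|[|[|i]]]]]]]] // i8] _; rewrite mxE mulr0.
Qed.

Lemma cofA_pr c e : all (fun i => (0%N \in nth [::] c i) ==>
    ([:: 0; 1; 2; 3; 3; 4; 5; 6]`_i == e)) (iota 0 8) ->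
  forall d (a : A1), cof c (pr A1 d a) = (d == e)%:R * cof c a.
Proof.
move=> h d a; have := mor_pr A1_tab d a; rewrite addr0 => ->.
exact: (@cof_tab_pr 8 _ _ _ A1_ok).
Qed.

Lemma sq1_A1 (a : A1) : sq1 A1 a = tabfun A1t1 (a : 'rV_8).
Proof. by have := mor1 A1_tab a => /= ->; apply: sq1_tab. Qed.

Lemma sq2_A1 (a : A1) : sq2 A1 a = tabfun A1t2 (a : 'rV_8).
Proof. by have := mor2 A1_tab a => /= ->; apply: sq2_tab. Qed.

Definition I7 : seq (seq nat) := [:: [:: 1]; [:: 2]; [:: 3]; [:: 4]; [:: 5]; [:: 6]; [:: 7]]%N.

Lemma link_F_Z7 : link Flm Z7.
Proof.
have hi : mor 1 (tabfun I7 : Z7 -> A1) by exact/mor_to_A1/tab_mor.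
split; exists A1, (tabfun I7 : Z7 -> A1), aug, (cof eta1); split.
- exact: is_free_A1'.
- apply: ses_of_dim.
  + by apply/mor_of_susp; rewrite add0r.
  + exact: ahom_mor.
  + apply: (can_inj (g := tabfun [:: [::]; [:: 0]; [:: 1]; [:: 2]; [:: 3]; [:: 4]; [:: 5]; [:: 6]]%N)).
    exact: tmK.
  + exact: ses_surj ses_aug.
  + by move=> x; rewrite -[LHS]ucK aug_co coefA0_cof cof_tm (cof_nil 7); apply/rowP => i; rewrite !mxE.
  + by rewrite dim_A1 [\dim {:unit_mod}]dim_unit -[\dim {:susp 1 Z7}]/(\dim {:tab Z7_ok}) dim_tab.
- by split=> [x y|d z]; [rewrite -cofD | rewrite (cofA_pr (e := 1))].
- split=> [z|z|n].
  + by rewrite /= aug_co coefA0_cof sq1_A1 cof_tm.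
  + by rewrite sq2_A1 cof_tm (cof_nil 8).
  + by rewrite cof_tm.
Qed.

Definition PJ : seq (seq nat) := [:: [:: 0]; [:: 1]; [:: 2]; [::]; [:: 3]; [:: 4]; [::]; [::]]%N.
Definition IJ : seq (seq nat) := [:: [:: 3]; [:: 6]; [:: 7]]%N.
(** The coefficient of Sq1Sq2, whose degree 3 in A(1) becomes degree 1 in the cover Sigma^-2 A(1) of
    the Joker. *)
Definition eta3 : seq (seq nat) := [:: [::]; [::]; [::]; [:: 0]; [::]; [::]; [::]; [::]]%N.

Lemma PJ_mor : mor (- 2) (tabfun PJ : A1 -> J5).
Proof. exact/mor_from_A1/tab_mor. Qed.

Lemma PJ_surj (y : J5) : exists x : A1, @tabfun 8 5 PJ x = y.
Proof. by exists (tabfun [:: [:: 0]; [:: 1]; [:: 2]; [:: 4]; [:: 5]]%N (y : 'rV_5)); apply: tmK. Qed.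

Lemma link_J5_Y3 : link J5 Y3.
Proof.
have hi : mor 3 (tabfun IJ : Y3 -> A1) by exact/mor_to_A1/tab_mor.
split; exists (susp (- 2) A1), (tabfun IJ : Y3 -> A1), (tabfun PJ : A1 -> J5), (cof eta3); split.
- exact: is_free_A1.
- apply: ses_of_dim.
  + apply/mor_to_susp/mor_of_susp; exact: hi.
  + apply/mor_of_susp; exact: PJ_mor.
  + apply: (can_inj (g := tabfun [:: [::]; [::]; [::]; [:: 0]; [::]; [::]; [:: 1]; [:: 2]]%N)).
    exact: tmK.
  + exact: PJ_surj.
  + by move=> x; rewrite tm_tm (tm_nil 5 3).
  + rewrite -[\dim {:susp _ A1}]/(\dim {:A1}) dim_A1.
    by rewrite -[\dim {:susp 1 Y3}]/(\dim {:tab Y3_ok}) dim_tab -[\dim {:J5}]/(\dim {:tab J5_ok}) dim_tab.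
- split=> [x y|d z]; first by rewrite -cofD.
  rewrite pr_susp (cofA_pr (e := 3)) //; congr ((nat_of_bool _)%:R * _).
  by apply/eqP/eqP; lia.
- split=> [z|z|n].
  + by rewrite -[sq1 (susp _ _) z]/(sq1 A1 z) sq1_A1 cof_tm [RHS]cof_tm.
  + by rewrite -[sq2 (susp _ _) z]/(sq2 A1 z) sq2_A1 cof_tm (cof_nil 8).
  + by rewrite cof_tm.
Qed.

Lemma dim_E (L : lmod) : \dim {:extB L} = (4 + \dim {:L})%N.
Proof. by rewrite [LHS]dim_ext; congr (_ + _)%N; apply: dim_tab. Qed.

Definition LB : seq (seq nat) := [:: [::]; [:: 0]; [::]; [::]; [:: 1]; [:: 2]; [::]; [:: 3]]%N.
Definition c6 : seq (seq nat) := [:: [::]; [::]; [::]; [::]; [::]; [::]; [:: 0]; [::]]%N.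

Definition iF (x : extB Flm) : A1 := tabfun XB x.1 + uc x.2 *: e6.

Lemma cof_c6_iF x : cof c6 (iF x) = uc x.2.
Proof.
rewrite /iF cofD cofZ cof_tm (cof_nil 4) add0r.
by rewrite [X in _ * X](_ : _ = 1) ?mulr1 // /cof /e6 bvec_tmx // mxE.
Qed.

Lemma LB_iF x : @tabfun 8 4 LB (iF x) = x.1.
Proof.
rewrite /iF tmD tmZ tm_tm -[X in _ + _ *: X]/(bvec 8 6 *m tabmx 8 4 LB) !bvecE // scaler0 addr0.
by rewrite /tabfun -[tmul _ _ _ _ _]/(tid 4) tmx1 mulmx1.
Qed.

Lemma iF_inj : injective iF.
Proof.
move=> [b c] [b' c'] e; have := congr1 (@tabfun 8 4 LB) e; rewrite !LB_iF /= => ->.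
have := congr1 (cof c6) e; rewrite !cof_c6_iF /= => ec.
by rewrite -(ucK c) -(ucK c') ec.
Qed.

Lemma iF_mor : mor 1 iF.
Proof.
apply: (mor_eq _ (ext_mor b3_5 b3_s1 b3_s2 (L := Flm) (g := fun c : unit_mod => uc c *: e6) XB_mor _ _ _ _)) => [x||||] //.
- by move=> x y; rewrite ucD scalerDl.
- move=> d m; rewrite uc_pr linearZ /= e6_pr scalerA (_ : (5 == d + 4 + 1) = (d == 0)) 1?mulrC //.
  by apply/eqP/eqP; lia.
- by move=> m; rewrite F_lam1 scale0r addr0 linearZ /= e6_sq1.
- by move=> m; rewrite F_lam2 scale0r linearZ /= e6_sq2 scaler0.
Qed.

Definition PY : seq (seq nat) := [:: [:: 0]; [::]; [:: 1]; [:: 2]; [::]; [::]; [::]; [::]]%N.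

(** Y3 is cyclic on its bottom class. The kernel of A(1) -> Y3 is A(1)Sq1, a copy of Sigma B,
    together with Sq2Sq1Sq2, whose Sq1 is the top class: this is Sigma E F. *)
Lemma link_Y3_EF : link Y3 (extB Flm).
Proof.
split; exists A1, iF, (tabfun PY : A1 -> Y3), (cof eta1); split.
- exact: is_free_A1'.
- apply: ses_of_dim.
  + apply/mor_of_susp; exact: iF_mor.
  + exact/mor_from_A1/tab_mor.
  + exact: iF_inj.
  + by move=> y; exists (tabfun [:: [:: 0]; [:: 2]; [:: 3]]%N (y : 'rV_3)); apply: tmK.
  + move=> x; rewrite /iF tmD tmZ tm_tm (tm_nil 3 4) add0r.
    by rewrite -[X in _ *: X]/(bvec 8 6 *m tabmx 8 3 PY) !bvecE // scaler0.
  + rewrite dim_A1 -[\dim {:susp _ _}]/(\dim {:extB Flm}) dim_E dim_unit.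
    by rewrite -[\dim {:Y3}]/(\dim {:tab Y3_ok}) dim_tab.
- by split=> [x y|d z]; [rewrite -cofD | rewrite (cofA_pr (e := 1))].
- split=> [z|z|n].
  + by rewrite sq1_A1 cof_tm [RHS]cof_tm.
  + by rewrite sq2_A1 cof_tm (cof_nil 8).
  + rewrite /iF cofD cofZ cof_tm [X in _ + _ * X](_ : _ = 0) ?mulr0 ?addr0 //.
    by rewrite /cof /e6 bvec_tmx // mxE.
Qed.

(** Z7 is generated by Sq1 and Sq2, and [PZ1], [PZ2] are the right multiplications by them. In the
    kernel, Sq1 Sq1 = 0 yields B, and the relation Sq1Sq2 Sq1 + Sq2 Sq2 = 0 yields, modulo B, the
    Joker, with coordinates [XJ1] and [XJ2]. *)
Definition XJ1 : seq (seq nat) := [:: [:: 3]; [::]; [:: 6]; [::]; [::]]%N.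
Definition XJ2 : seq (seq nat) := [:: [:: 2]; [:: 3]; [:: 5]; [:: 6]; [:: 7]]%N.
Definition PZ1 : seq (seq nat) := [:: [:: 0]; [::]; [:: 3]; [:: 4]; [::]; [::]; [:: 6]; [::]]%N.
Definition PZ2 : seq (seq nat) := [:: [:: 1]; [:: 2]; [:: 4]; [::]; [:: 5]; [:: 6]; [::]; [::]]%N.

Definition iJ (x : extB J5) : dsum A1 (susp 1 A1) := (tabfun XB x.1 + tabfun XJ1 (x.2 : 'rV_5), tabfun XJ2 (x.2 : 'rV_5)).
Definition pZ (z : dsum A1 (susp 1 A1)) : Z7 := (tabfun PZ1 z.1 + tabfun PZ2 z.2).

Lemma tm_add n m t u (x : 'rV_n) : @tabfun n m t x + tabfun u x = tabfun (tadd n m t u) x.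
Proof. by rewrite /tabfun -mulmxDr tmxD. Qed.

Lemma cof_be n m c k (x : 'rV_n) : cof c x *: bvec m k = tabfun (tmul n 1 m c [:: [:: k]]) x.
Proof.
rewrite /tabfun -tmxM mulmxA (_ : x *m tabmx n 1 c = (cof c x)%:M).
  by rewrite mul_scalar_mx; congr (_ *: _); apply/rowP => j; rewrite !mxE inE.
by apply/matrixP => i j; rewrite !ord1 [RHS]mxE eqxx mulr1n.
Qed.

Lemma iJ_mor : mor 1 iJ.
Proof.
have hf : mor 1 (fun b : B4 => (tabfun XB b, 0) : dsum A1 (susp 1 A1)).
  by have := mor_comp XB_mor (mor_inl A1 (susp 1 A1)); rewrite addr0.
have h2 : mor 4 (tabfun XJ2 : J5 -> A1) by exact/mor_to_A1/tab_mor.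
apply: (mor_eq _ (ext_mor b3_5 b3_s1 b3_s2 (L := J5)
  (g := fun m : J5 => (tabfun XJ1 (m : 'rV_5), tabfun XJ2 (m : 'rV_5)) : dsum A1 (susp 1 A1)) hf _ _ _ _)).
- move=> [b m]; rewrite /iJ /= -[LHS]/((tabfun XB b + tabfun XJ1 (m : 'rV_5), 0 + tabfun XJ2 (m : 'rV_5))).
  by rewrite add0r.
- by move=> x y; rewrite !tmD.
- move=> d m; rewrite pr_dsum; congr (_, _).
    transitivity (pr A1t (d + 5) (tabfun XJ1 (m : 'rV_5)) : A1).
      exact: tab_pr.
    rewrite (_ : d + 4 + 1 = d + 5); last lia.
    by have := mor_pr tab_A1 (d + 5) (tabfun XJ1 (m : 'rV_5)); rewrite addr0.
  by rewrite pr_susp addrK; apply: (mor_pr h2).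
(* The middle class of the Joker has first coordinate Sq2Sq1Sq2, whose Sq1 is the image of [b3]:
   this is the extension term. *)
- move=> m; rewrite sq1_dsum /= (mor1 h2).
  have eb : tabfun XB b3 = bvec 8 7 by rewrite /tabfun !bvecE.
  rewrite -[LHS]/((cof J5c m *: (tabfun XB b3 : 'rV_8) + tabfun XJ1 (sq1 J5 m : 'rV_5), cof J5c m *: (0 : susp 1 A1) + sq1 A1 (tabfun XJ2 (m : 'rV_5)))).
  rewrite scaler0 add0r eb cof_be; congr (_, _).
  by rewrite sq1_tab -[_ *m _]/(tabfun _ _) !tm_tm tm_add [RHS]sq1_A1 tm_tm.
- move=> m; rewrite sq2_dsum /= (mor2 h2); congr (_, _).
  by rewrite sq2_tab -[_ *m _]/(tabfun _ _) !tm_tm [RHS]sq2_A1 tm_tm.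
Qed.

Lemma pZ_mor : mor 0 pZ.
Proof.
apply: mor_case; first exact/mor_from_A1/tab_mor.
by apply/mor_of_susp; exact/mor_from_A1/tab_mor.
Qed.

Lemma link_Z7_EJ : link Z7 (extB J5).
Proof.
split; exists (dsum A1 (susp 1 A1)), iJ, pZ, (fun z => cof eta1 (z.1 : 'rV_8)); split.
- by apply: is_free_dsum; [apply: is_free_A1' | apply: is_free_A1].
- apply: ses_of_dim.
  + apply/mor_of_susp; exact: iJ_mor.
  + exact: pZ_mor.
  + apply: addmap_inj; first exact: morD iJ_mor.
    move=> [b m] [e1 e2].
    have m0 : m = 0.
      rewrite -[m](@tmK 5 8 XJ2 [:: [::]; [::]; [:: 0]; [:: 1]; [::]; [:: 2]; [:: 3]; [:: 4]]%N) //.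
      by rewrite [tabfun XJ2 _]e2 /tabfun mul0mx.
    congr (_, _) => //; apply: (ses_inj ses_B4); rewrite (mor0 (ses_i ses_B4)).
    by move: e1; rewrite /= m0 /tabfun mul0mx addr0.
  + move=> y; exists (tabfun [:: [:: 0]; [::]; [::]; [:: 2]; [:: 3]; [::]; [:: 6]]%N (y : 'rV_7),
       tabfun [:: [::]; [:: 0]; [:: 1]; [::]; [::]; [:: 4]; [::]]%N (y : 'rV_7)).
    rewrite /pZ /= !tm_tm [LHS]tm_add /tabfun -[tadd _ _ _ _]/(tid 7) tmx1 mulmx1 //.
  + move=> [b m]; rewrite /pZ /iJ /= tmD !tm_tm (tm_nil 7 4) add0r [LHS]tm_add.
    exact: (tm_nil 7 5).
  + rewrite dim_prod -[\dim {:susp 1 A1}]/(\dim {:A1}) dim_A1 -[\dim {:susp _ _}]/(\dim {:extB J5}) dim_E.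
    by rewrite -[\dim {:J5}]/(\dim {:tab J5_ok}) dim_tab -[\dim {:Z7}]/(\dim {:tab Z7_ok}) dim_tab.
- by split=> [x y|d z]; [rewrite -cofD | rewrite pr_dsum (cofA_pr (e := 1))].
- split=> [z|z|[b m]].
  + rewrite sq1_dsum /= sq1_A1 cof_tm cofD !cof_tm.
    by rewrite [X in _ + X](cof_nil 8) addr0.
  + by rewrite sq2_dsum /= sq2_A1 cof_tm (cof_nil 8).
  + rewrite /iJ /= cofD !cof_tm [X in _ + X](cof_nil 5) addr0 //.
Qed.

(** * The modules Omega^s J^eps *)

Lemma A1one_be : A1one = bvec 8 0 :> 'rV_8.
Proof. by apply/rowP => i; rewrite !mxE eqxx. Qed.

Lemma A1_12_be : A1_12 = bvec 8 3 :> 'rV_8.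
Proof. by rewrite /A1_12 sq2_A1 sq1_A1 A1one_be /tabfun !bvecE. Qed.

(** The kernel of [PJ] is spanned by Sq1Sq2, Sq2Sq1Sq2 and the top class; these are the words with
    index 0, 2 and 3 applied to [A1_12]. *)
Lemma cyc_joker (x : A1) : (x \in cyc A1_12) <-> @tabfun 8 5 PJ x = 0.
Proof.
split=> [xc|x0].
  have : (cyc A1_12 <= lker (lin_of (morD PJ_mor)))%VS.
    apply/span_subvP => y /mapP[k]; rewrite mem_iota => /andP[_ k8] ->.
    rewrite evw_word // memv_ker lin_ofE (mor_word _ _ PJ_mor) [tabfun PJ A1_12](_ : _ = 0).
      by rewrite (addmap0 (@wordD _ k)).
    by rewrite A1_12_be /tabfun !bvecE.
  by move/subvP => h; have := h x xc; rewrite memv_ker lin_ofE => /eqP.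
have xE : x = @tabfun 3 8 IJ (tabfun [:: [::]; [::]; [::]; [:: 0]; [::]; [::]; [:: 1]; [:: 2]]%N (x : 'rV_8)).
  have e : @tabfun 8 8 (tid 8) x = @tabfun 5 8 [:: [:: 0]; [:: 1]; [:: 2]; [:: 4]; [:: 5]]%N (@tabfun 8 5 PJ x)
     + @tabfun 3 8 IJ (tabfun [:: [::]; [::]; [::]; [:: 0]; [::]; [::]; [:: 1]; [:: 2]]%N (x : 'rV_8)).
    by rewrite !tm_tm tm_add.
  by move: e; rewrite x0 /tabfun mul0mx add0r tmx1 mulmx1.
have inC k : (k < 8)%N -> word k A1_12 \in cyc A1_12.
  move=> k8; rewrite -evw_word //; apply: memv_span; apply/mapP; exists k => //.
  by rewrite mem_iota.
rewrite xE /tabfun mulmx_sum_row; apply: memv_suml => i _; apply: memvZ.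
have rE (j : 'I_3) : row j (tabmx 3 8 IJ) = bvec 3 j *m tabmx 3 8 IJ.
  by rewrite rowE; congr (_ *m _); apply/rowP => l; rewrite !mxE.
have -> : row i (tabmx 3 8 IJ) = word (nth 0 [:: 0; 2; 3] i)%N A1_12 :> A1.
  rewrite rE; case: i => -[|[|[|i]]] // hi; rewrite /= ?sq2_A1 ?sq1_A1 A1_12_be /tabfun !bvecE //.
by case: i => -[|[|[|i]]] // hi; apply: inC.
Qed.

Lemma isom_joker : isom joker J5.
Proof.
have hf : mor 0 (tabfun PJ : A1 -> susp 2 J5) by apply/mor_to_susp; exact: PJ_mor.
have hq := quo_mor A1_12_stable.
have [g hg gE] : exists2 g : quo A1_12_stable -> susp 2 J5, mor 0 g &
    forall x : A1, g (quo_proj _ x) = tabfun PJ (x : 'rV_8).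
  apply: (coker_desc hq (@quo_proj_surj _ _) hf) => x /eqP.
  by rewrite quo_proj_ker => /cyc_joker.
have iso1 : isom (quo A1_12_stable) (susp 2 J5).
  apply: (bij_isom hg) => [y|y].
    have [x <-] := @quo_proj_surj _ _ y.
    by rewrite gE => /cyc_joker; rewrite -quo_proj_ker => /eqP.
  by have [x <-] := PJ_surj y; exists (quo_proj _ x); rewrite gE.
apply: isom_trans (isom_susp (erefl (-2)) iso1) _.
apply: isom_trans (isom_susp2 _ _ _) _; exact: isom_susp0.
Qed.

Lemma isom_unit_tens M : isom (tensor unit_mod M) M.
Proof.
have h : mor 0 (contrl uc : tensor unit_mod M -> M).
  by apply: mor_contrl; [exact: ucD | exact: uc_pr | exact: F_lam1 | exact: F_lam2].
have hS y : exists x, (contrl uc : tensor unit_mod M -> M) x = y.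
  by exists (ptens (rv1 1) y); rewrite contrl_ptens ?rv1K ?scale1r //; apply: ucD.
apply: (bij_isom h _ hS) => x x0; apply: (surj_dim_inj (morD h) hS); last by rewrite x0 (mor0 h).
by rewrite [X in (X <= _)%N]dim_tens dim_unit mul1n.
Qed.

Lemma isom_tens_unit M : isom (tensor M unit_mod) M.
Proof.
have h : mor 0 (contrr uc : tensor M unit_mod -> M).
  by apply: mor_contrr; [exact: ucD | exact: uc_pr | exact: F_lam1 | exact: F_lam2].
have hS y : exists x, (contrr uc : tensor M unit_mod -> M) x = y.
  by exists (ptens y (rv1 1)); rewrite contrr_ptens ?rv1K ?scale1r //; apply: ucD.
apply: (bij_isom h _ hS) => x x0; apply: (surj_dim_inj (morD h) hS); last by rewrite x0 (mor0 h).
by rewrite [X in (X <= _)%N]dim_tens dim_unit muln1.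
Qed.

(** Cyclic order of syzygies, up to suspension: [Flm] leads to [Z7], [Z7] to [extB J5], [J5] to
    [Y3], and [Y3] to [extB Flm]. *)
Definition bmod (b : nat) : lmod := nth Flm [:: Flm; Z7; J5; Y3] b.

(* [OmegaR eps s] is the desuspension of Omega^s J^eps. *)
Definition OmegaR (eps : bool) (s : nat) : lmod := iter s./2 extB (bmod ((s + eps.*2) %% 4)).

Lemma R_E eps s : OmegaR eps s.+2 = extB (OmegaR (~~ eps) s).
Proof.
rewrite /OmegaR /=; congr (extB (iter _ extB (bmod _))); case: eps => /=; last by rewrite addn0 addn2.
by rewrite addn0 -addn2 -addnA modnDr.
Qed.

Lemma lin2_R eps s : lin2 (OmegaR eps s.+1).
Proof.
case: s => [|s]; last by rewrite R_E; apply: E_lin2.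
by case: eps; [exact: Y3_lin2 | exact: Z7_lin2].
Qed.

Lemma link_R eps s : link (OmegaR eps s) (OmegaR eps s.+1).
Proof.
have [m] := ubnP s; elim: m s eps => // m IH [|[|s]] eps sm.
- by case: eps; [exact: link_J5_Y3 | exact: link_F_Z7].
- by case: eps; [exact: link_Y3_EF | exact: link_Z7_EJ].
rewrite !R_E; apply: link_step; [exact: lin2_R | apply: IH; lia].
Qed.

Lemma reduced_E (L : lmod) : reduced L -> reduced (extB L).
Proof. by apply: ext_reduced; apply: tab_reduced. Qed.

Lemma reduced_R eps s : reduced (OmegaR eps s).
Proof.
have rF : reduced unit_mod by apply/reducedP => x; rewrite /top !sq2_unit.
rewrite /OmegaR; elim: s./2 => [|e IH] /=; last exact: reduced_E.
have : ((s + eps.*2) %% 4 < 4)%N by rewrite ltn_mod.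
by case: (_ %% 4)%N => [|[|[|[|b]]]] // _; try exact: rF; apply: tab_reduced.
Qed.

Lemma reduced_susp k (M : amod) : reduced M -> reduced (susp k M).
Proof. by []. Qed.

Lemma steq_R (eps : bool) s : stable_iso (tensor (tpow OmegaF s) (tpow joker eps)) (susp s%:Z (OmegaR eps s)).
Proof.
elim: s => [|s IH].
  apply: isom_steq; apply: isom_trans (isom_unit_tens _) _.
  apply: isom_trans _ (isom_sym (isom_susp0 _)); case: eps; last exact: isom_refl.
  apply: isom_trans (isom_tens_unit _) _; exact: isom_joker.
have [[P [i [p [eta [fP S _ _]]]]]] := link_R eps s.
apply: (steq_trans (N := susp s (susp 1 (OmegaR eps s.+1)))).
  exact: (steq_Omega (ses_susp s S) (is_free_susp _ fP) IH).
apply: isom_steq; apply: isom_trans (isom_susp2 _ _ _) _.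
by apply: isom_susp (isom_refl _); lia.
Qed.

Lemma isom_OmegaR k (eps : bool) :
  isom (susp (- (k.+1)%:Z) (Omega k.+1 (tpow joker eps))) (OmegaR eps k.+1).
Proof.
have h : isom (Omega k.+1 (tpow joker eps)) (susp k.+1 (OmegaR eps k.+1)).
  by apply: red_isom; [exact/reduced_susp/reduced_R | exact: steq_R].
apply: isom_trans (isom_susp (erefl _) h) _.
apply: isom_trans (isom_susp2 _ _ _) _.
by apply: isom_trans (isom_susp0 _); apply: isom_susp (isom_refl _); lia.
Qed.

(** * The kernel of the morphism to F *)

Definition bottom (L : lmod) := (exists2 x : L, pr L 0 x = x & lam x = 1) /\
  (forall x : L, pr L 0 x = x -> lam x = 0 -> x = 0).

(** Places Sigma^4 L in positive degrees, so that the degree 0 part of E L is that of B. *)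
Definition low (L : lmod) := forall d, d <= - 4 -> forall x, pr L d x = 0.

Lemma low_E L : low L -> low (extB L).
Proof.
move=> h d hd x; rewrite pr_ext h; last by lia.
rewrite [X in (X, _)](_ : _ = 0) //.
by apply: based_pr_out => -[[|[|[|[|i]]]] //= hi]; apply/eqP; lia.
Qed.

Lemma low_bmod b : (b < 4)%N -> low (bmod b).
Proof.
move: b => [|[|[|[|b]]]] // _ d hd x; apply: based_pr_out.
- by move=> i; apply/eqP; lia.
- by move=> -[[|[|[|[|[|[|[|i]]]]]]] //= hi]; apply/eqP; lia.
- by move=> -[[|[|[|[|[|i]]]]] //= hi]; apply/eqP; lia.
- by move=> -[[|[|[|i]]] //= hi]; apply/eqP; lia.
Qed.

Lemma low_R eps s : low (OmegaR eps s).
Proof.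
rewrite /OmegaR; elim: s./2 => [|e IH] /=; last exact: low_E.
by apply: low_bmod; rewrite ltn_mod.
Qed.

Lemma bottom_E L : low L -> bottom (extB L).
Proof.
move=> hL; split.
  exists ((bvec 4 0 : B4), 0); last by rewrite /= /cof bvec_tmx // mxE.
  by rewrite pr_ext /= linear0 pr_tab // scale1r.
move=> [b m]; rewrite pr_ext /= hL // => -[b0 m0] c0'; rewrite -m0.
congr (_, _); apply/rowP => i; rewrite [RHS]mxE -b0 pr_based.
case: i => -[|[|[|[|i]]]] //= hi; rewrite ?mul0r // mul1r.
move: c0'; rewrite /cof mxE !big_ord_recl big_ord0 !mxE /= !mulr0 !addr0 mulr1 => <-.
by congr (fun_of_matrix b _ _); apply: val_inj.
Qed.

Section KerUnit.
Variables (X : amod) (L : lmod).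
Hypothesis XL : isom X L.
Hypothesis L2 : lin2 L.
Hypothesis Lb : bottom L.

(** The chosen [to_unit X] has a meaning only once existence and uniqueness are known. A morphism to
    F is determined on degree 0, where L is one-dimensional, so every nontrivial one corresponds to
    [lam] under [XL]. *)
Lemma ker_to_unit : exists j : ker (to_unit X) -> L, [/\ mor 0 j, injective j,
  forall k, lam (j k) = 0 & forall x, lam x = 0 -> exists k, j k = x].
Proof.
have [f [g [hf hg fK gK]]] := XL; have [[x0 x0d x01] bot] := Lb.
have key (h : ahom X unit_mod) : nontrivial h -> forall x, uc (h x) = lam (f x).
  move=> nh.
  have hE x : h x = lam (f x) *: h (g x0).
    have e : pr L 0 (f x) = lam (f x) *: x0.
      apply/eqP; rewrite -subr_eq0 oppF2; apply/eqP/bot.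
        by rewrite linearD linearZ /= x0d prprE eqxx.
      rewrite lamD lam_pr mul1r (_ : lam (lam (f x) *: x0) = lam (f x)).
        exact: (addrr2 (lam (f x) : ('F_2)^o)).
      by have [->|->] := F2P (lam (f x)); rewrite ?scale0r ?scale1r ?lam0.
    have e2 : h x = h (pr X 0 x).
      rewrite (mor_pr (ahom_mor h)) addr0 -[LHS]ucK -[RHS]ucK.
      by rewrite uc_pr mul1r.
    rewrite e2 -[pr X 0 x]fK (mor_pr hf) addr0 e (addmapZ _ _ (morD hg)).
    by rewrite linearZ.
  move=> x; rewrite hE; have [u0|u1] := F2P (uc (h (g x0))).
    case: nh; apply/lfunP => y; rewrite zero_lfunE hE.
    by rewrite -[h (g x0)]ucK u0; apply/rowP => i; rewrite !mxE mulr0.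
  have [->|->] := F2P (lam (f x)); last by rewrite scale1r.
  by rewrite scale0r /uc mxE.
have hl : mor 0 (fun x => rv1 (lam (f x))).
  split=> [x y|d x|x|x].
  - by rewrite (morD hf) lamD rv1D.
  - by rewrite (mor_pr hf) !addr0 lam_pr -[RHS]ucK uc_pr rv1K.
  - by rewrite (mor1 hf) lam_sq1 sq1_unit; apply/rowP => i; rewrite !mxE.
  - by rewrite (mor2 hf) L2 sq2_unit; apply/rowP => i; rewrite !mxE.
have [F FE] := mor_ahom hl.
have nF : nontrivial F.
  move=> F0; have := FE (g x0); rewrite F0 zero_lfunE gK x01 => e.
  by have := congr1 uc e; rewrite rv1K /uc mxE.
have [nT _] : nontrivial (to_unit X) /\ forall g : ahom X unit_mod, nontrivial g ->
    (g : 'Hom(X, unit_mod)) = to_unit X.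
  apply: (epsilon_spec (inhabits (hom0 X unit_mod)) (fun f => nontrivial f /\
    forall g : ahom X unit_mod, nontrivial g -> (g : 'Hom(X, unit_mod)) = f)).
  exists F; split=> // G nG; apply/lfunP => x.
  by rewrite -[LHS]ucK -[RHS]ucK !key.
exists (fun k => f (vsval k)); split.
- by apply: mor_comp0 hf; apply: sub_mor.
- by move=> x y /(can_inj fK)/val_inj.
- move=> k; rewrite -(key _ nT); have := subvsP k; rewrite memv_ker => /eqP ->.
  by rewrite /uc mxE.
- move=> x lx; have xk : g x \in lker (to_unit X).
    by rewrite memv_ker -[to_unit X _]ucK key // gK lx; apply/eqP/rowP => i; rewrite !mxE.
  by exists (Subvs xk) => /=; rewrite gK.
Qed.

End KerUnit.

Lemma dim_ker_lam (K : amod) (L : lmod) (j : K -> L) : bottom L -> mor 0 j -> 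
  (forall x, lam x = 0 -> exists k, j k = x) -> (\dim {:L} <= \dim {:K} + 1)%N.
Proof.
move=> [[x0 _ x01] _] hj jS.
have -> : (\dim {:K} + 1 = \dim {:(K * unit_mod)%type})%N by rewrite dim_prod dim_unit.
apply: (@addmap_surj_dim _ _ (fun z => j z.1 + uc z.2 *: x0)).
  by move=> x y; rewrite /= (morD hj) ucD scalerDl addrACA.
move=> x; have [k kE] : exists k, j k = x - lam x *: x0.
  apply: jS; rewrite oppF2 lamD; have [->|e] := F2P (lam x).
    by rewrite scale0r lam0 addr0.
  by rewrite e scale1r x01; apply: val_inj.
by exists (k, rv1 (lam x)); rewrite /= kE rv1K subrK.
Qed.

(** * Truncated projective spaces *)

(* [v] multiplies like the family u^a, u^(a+1), ..., u^(a+n-1). *)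
Record pfam (a : int) (X : amod) (c : int) (n : nat) (v : nat -> X) : Prop := Pfam {
  pf_pr : forall j, pr X (j%:Z + c) (v j) = v j;
  pf_sq1 : forall j, sq1 X (v j) = (odd `|a + j%:Z|)%:R *: v j.+1;
  pf_sq2 : forall j, sq2 X (v j) = (odd `|binz (a + j%:Z) 2|)%:R *: v j.+2;
  pf_out : forall j, (n <= j)%N -> v j = 0 }.

(** Spanning makes the map from the basis u^a, ..., u^b surjective, and the dimension bound makes it
    injective. The family starts in degree c, whence the suspension a - c. *)
Lemma pfam_isom a b (X : amod) c v : pfam a c (Psize a b) v ->
  (forall x : X, exists d : nat -> 'F_2, x = \sum_(j < Psize a b) d j *: v j) ->
  (Psize a b <= \dim {:X})%N -> isom (Pmod a b) (susp (a - c) X).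
Proof.
move=> [vp v1 v2 v0]; set n := Psize a b in v0 * => sp dX.
pose f (x : Pmod a b) : susp (a - c) X := \sum_(j < n) (x : 'rV_n) 0 j *: v j.
have fD : addmap f.
  by move=> x y; rewrite /f -big_split; apply: eq_bigr => j _; rewrite mxE scalerDl.
have fS i (s : X -> X) : {morph s : x y / x + y} ->
    (forall j, s (v j) = (binz (a + j%:Z) i)%:~R *: v (j + i)%N) ->
    forall x : 'rV_n, s (f x) = f (x *m Pmx a n i).
  move=> sD sv x; rewrite /f (addmap_sum _ _ _ sD).
  have vjE (j : 'I_n) : v (j + i)%N = \sum_(l < n) ((l : nat) == (j + i)%N)%:R *: v l.
    have [lt|ge] := ltnP (j + i) n; last first.
      rewrite v0 // big1 // => l _; rewrite (_ : (_ == _) = false) ?scale0r //.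
      by apply/negbTE; rewrite neq_ltn (leq_trans (ltn_ord l) ge).
    rewrite (bigD1 (Ordinal lt)) //= eqxx scale1r big1 ?addr0 // => l ll.
    rewrite (_ : (_ == _) = false) ?scale0r //.
    by apply/negbTE; apply: contra ll => /eqP e; apply/eqP/val_inj.
  transitivity (\sum_(j < n) \sum_(l < n)
      (x 0 j * (if (l : nat) == (j + i)%N then (binz (a + (j : nat)%:Z) i)%:~R else 0)) *: v l).
    apply: eq_bigr => j _; rewrite (addmapZ _ _ sD) sv vjE !scaler_sumr.
    apply: eq_bigr => l _; rewrite !scalerA; case: eqP => _; by rewrite ?mulr1 ?mulr0.
  rewrite exchange_big /=; apply: eq_bigr => l _; rewrite mxE scaler_suml.
  by apply: eq_bigr => j _; rewrite mxE.
have hf : mor 0 f.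
  split=> [//|d x|x|x].
  - rewrite addr0 /f pr_susp linear_sum; apply: eq_bigr => j _.
    rewrite linearZ /= pr_based -[v j in RHS]vp prprE.
    have -> : (d - (a - c) == (j : nat)%:Z + c) = (a + (j : nat)%:Z == d).
      by apply/eqP/eqP; lia.
    case: eqP => [e|_]; last by rewrite mul0r scale0r scaler0.
    rewrite mul1r (_ : d - (a - c) = (j : nat)%:Z + c) ?vp //.
    by rewrite -e opprB [a + _]addrC -addrA [a + _]addrC subrK.
  - rewrite sq1_based -[sq1 (susp _ _) _]/(sq1 X (f x)) (fS 1%N _ (@sq1D X)) // => j.
    by rewrite v1 binz1 intrF2 addn1.
  - rewrite sq2_based -[sq2 (susp _ _) _]/(sq2 X (f x)) (fS 2 _ (@sq2D X)) // => j.
    by rewrite v2 intrF2 addn2.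
have fS' y : exists x, f x = y.
  have [d ->] := sp y; exists (\row_j d j : 'rV_n).
  by apply: eq_bigr => j _; rewrite mxE.
apply: (bij_isom hf _ fS') => x x0; apply: (surj_dim_inj fD fS'); last by rewrite x0 (addmap0 fD).
by rewrite -[\dim {:susp _ _}]/(\dim {:X}); apply: leq_trans dX; rewrite dimvf; apply: (eq_leq (mul1n n)).
Qed.

(** M is the suspension of the span of u^-1, u^1, ..., u^n with u^0 divided out: [y0] stands for
    u^-1, since binom(-1, 2) = 1 gives Sq2 u^-1 = u^1, and [g j] stands for u^(j+1). *)
Record ystr (M : lmod) (n : nat) (y0 : M) (g : nat -> M) : Prop := Ystr {
  y_pr : pr M 0 y0 = y0;
  y_lam : lam y0 = 1;
  y_sq1 : sq1 M y0 = 0;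
  y_sq2 : sq2 M y0 = g 0%N;
  g_fam : pfam 1 2 n g;
  g_lam : forall j, lam (g j) = 0;
  y_span : forall x, exists d : nat -> 'F_2, x = lam x *: y0 + \sum_(j < n) d j *: g j;
  y_dim : \dim {:M} = n.+1 }.

Lemma odd_absz1 j : odd `|1 + j%:Z| = ~~ odd j. Proof. lia. Qed.
Lemma odd_absz3 j : odd `|3 + j%:Z| = ~~ odd j. Proof. lia. Qed.

Lemma odd_bin1 (j : nat) : odd `|binz (1 + j%:Z) 2| = ((j %% 4 == 1) || (j %% 4 == 2))%N.
Proof. rewrite odd_binz2; lia. Qed.
Lemma odd_bin3 (j : nat) : odd `|binz (3 + j%:Z) 2| = ((j %% 4 == 3) || (j %% 4 == 0))%N.
Proof. rewrite odd_binz2; lia. Qed.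

Lemma ystr_F : ystr (M := Flm) 0 (rv1 1) (fun=> 0).
Proof.
split=> //.
- by rewrite -[LHS]ucK uc_pr rv1K mul1r.
- exact: rv1K.
- exact: sq1_unit.
- by rewrite sq1_unit.
- by split=> *; rewrite ?linear0 ?scaler0.
- by move=> _; rewrite /= /uc mxE.
- move=> x; exists (fun=> 0); rewrite big_ord0 addr0.
  by apply/rowP => i; rewrite ord1 !mxE mulr1.
- exact: dim_unit.
Qed.

Lemma ystr_Y3 : ystr (M := Y3) 2 (bvec 3 0) (fun j => if (j < 2)%N then bvec 3 j.+1 else 0).
Proof.
split=> //=.
- by rewrite pr_tab // scale1r.
- by rewrite /cof bvec_tmx // mxE.
- by rewrite sq1_tab !bvecE.
- by rewrite sq2_tab !bvecE.
- split=> [j|j|j|j].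
  + by move: j => [|[|j]]; rewrite /= ?linear0 // pr_tab // scale1r.
  + by move: j => [|[|j]]; rewrite /= ?linear0 ?scaler0 // sq1_tab !bvecE // scale1r.
  + by move: j => [|[|j]]; rewrite /= ?linear0 ?scaler0 // sq2_tab !bvecE.
  + by move=> j2; rewrite ltnNge j2.
- move=> [|[|j]] /=; [by rewrite /cof bvec_tmx // mxE | by rewrite /cof bvec_tmx // mxE |].
  by rewrite /cof mul0mx mxE.
- move=> x; exists (fun j => (x : 'rV_3) 0 (inord j.+1)).
  apply/rowP => i; rewrite !big_ord_recl big_ord0 /= !mxE /=.
  rewrite /cof mxE !big_ord_recl big_ord0 !mxE /= !mulr0 !mulr1 !addr0.
  case: i => -[|[|[|i]]] //= hi; rewrite ?mulr0 ?mulr1 ?addr0 ?add0r;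
    by congr (fun_of_matrix x _ _); apply: val_inj; rewrite /= ?inordK.
- by rewrite -[\dim {:Y3}]/(\dim {:tab Y3_ok}) dim_tab.
Qed.

Section YE.
Variables (M : lmod) (n : nat) (y0 : M) (g : nat -> M).
Hypothesis Y : ystr n y0 g.

(** The classes of B supply u^1, u^2 and u^4, and the old [y0] becomes u^3: Sq1 u^3 = u^4 is the
    extension term and Sq2 u^3 = u^5 the old Sq2 of [y0]. *)
Definition gE (j : nat) : extB M :=
  match j with
  | 0%N => (bvec 4 1, 0) | 1%N => (bvec 4 2, 0) | 2%N => (0, y0) | 3%N => (bvec 4 3, 0)
  | j'.+4 => (0, g j') end.

Definition y0E : extB M := (bvec 4 0, 0).

Lemma sq1_inr (m : M) : sq1 (extB M) ((0 : B4), m) = (lam m *: b3, sq1 M m).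
Proof. by rewrite sq1_ext /= linear0 add0r. Qed.

Lemma sq1_inl (b : B4) : sq1 (extB M) (b, 0 : M) = (sq1 B4 b, 0).
Proof. by rewrite sq1_ext /= lam0 scale0r addr0 linear0. Qed.

Lemma sq2_inr (m : M) : sq2 (extB M) ((0 : B4), m) = ((0 : B4), sq2 M m).
Proof. by rewrite sq2_ext /= linear0. Qed.

Lemma sq2_inl (b : B4) : sq2 (extB M) (b, 0 : M) = (sq2 B4 b, 0).
Proof. by rewrite sq2_ext /= linear0. Qed.

Lemma lam_E (x : extB M) : lam x = cof B4c x.1. Proof. by []. Qed.

Lemma B4_sum (b : B4) : b = cof B4c b *: (bvec 4 0 : B4) + (b : 'rV_4) 0 (inord 1) *: (bvec 4 1 : B4)
  + (b : 'rV_4) 0 (inord 2) *: (bvec 4 2 : B4) + (b : 'rV_4) 0 (inord 3) *: (bvec 4 3 : B4).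
Proof.
apply/rowP => i; rewrite !mxE /cof mxE !big_ord_recl big_ord0 !mxE /= !mulr0 !mulr1 !addr0.
by case: i => -[|[|[|[|i]]]] //= hi; rewrite ?mulr0 ?mulr1 ?addr0 ?add0r;
  congr (fun_of_matrix b _ _); apply: val_inj; rewrite /= ?inordK.
Qed.

Lemma ystr_E : ystr (M := extB M) (n + 4) y0E gE.
Proof.
have [gp g1 g2 g0] := g_fam Y.
have fam : pfam 1 2 (n + 4) gE.
  split.
  - move=> [|[|[|[|j]]]]; rewrite /gE pr_ext /=.
    + by rewrite linear0 pr_tab // scale1r.
    + by rewrite linear0 pr_tab // scale1r.
    + by rewrite linear0 (y_pr Y).
    + by rewrite linear0 pr_tab // scale1r.
    + rewrite linear0 (_ : j.+4%:Z + 2 - 4 = j%:Z + 2) ?gp //; lia.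
  - move=> j; rewrite odd_absz1; move: j => [|[|[|[|j]]]]; rewrite /gE.
    + by rewrite sq1_inl sq1_tab !bvecE // scale1r.
    + by rewrite sq1_inl sq1_tab !bvecE // scale0r.
    + by rewrite sq1_inr (y_lam Y) (y_sq1 Y) !scale1r.
    + by rewrite sq1_inl b3_s1 scale0r.
    + rewrite sq1_inr (g_lam Y) scale0r g1 odd_absz1 /= !negbK.
      by case: (odd j); rewrite ?scale0r ?scale1r.
  - move=> j; rewrite odd_bin1; move: j => [|[|[|[|j]]]]; rewrite /gE.
    + by rewrite sq2_inl sq2_tab !bvecE // scale0r.
    + by rewrite sq2_inl sq2_tab !bvecE // scale1r.
    + by rewrite sq2_inr (y_sq2 Y) scale1r.
    + by rewrite sq2_inl b3_s2 scale0r.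
    + have e4 : (j.+4 %% 4 = j %% 4)%N by lia.
      rewrite sq2_inr g2 odd_bin1 e4; by case: (_ || _); rewrite ?scale0r ?scale1r.
  - move=> [|[|[|[|j]]]] h; try by lia.
    by rewrite /gE g0 //; lia.
split=> //.
- by rewrite pr_ext /= linear0 pr_tab // scale1r.
- by rewrite lam_E /cof bvec_tmx // mxE.
- by rewrite sq1_inl sq1_tab !bvecE.
- by rewrite sq2_inl sq2_tab !bvecE.
- move=> [|[|[|[|j]]]]; rewrite lam_E /=; try by rewrite /cof bvec_tmx // mxE.
  + by rewrite /cof mul0mx mxE.
  + by rewrite /cof mul0mx mxE.
- move=> [b m]; have [d mE] := y_span Y m.
  exists (fun j => match j with 0%N => (b : 'rV_4) 0 (inord 1) | 1%N => (b : 'rV_4) 0 (inord 2)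
    | 2%N => lam m | 3%N => (b : 'rV_4) 0 (inord 3) | j'.+4 => d j' end).
  pose il (u : B4) : extB M := (u, 0); pose ir (u : M) : extB M := (0, u).
  have ilD : addmap il by move=> u u'; rewrite /il -[RHS]/((u + u', 0 + 0)) addr0.
  have irD : addmap ir by move=> u u'; rewrite /ir -[RHS]/((0 + 0, u + u')) addr0.
  rewrite lam_E /=; transitivity (il b + ir m).
    by rewrite -[RHS]/((b + 0, 0 + m)) addr0 add0r.
  rewrite [X in il X]B4_sum [X in ir X]mE !ilD !irD (addmap_sum _ _ _ irD) !(addmapZ _ _ ilD, addmapZ _ _ irD).
  have -> : \sum_(i < n) ir (d i *: g i) = \sum_(i < n) d i *: ir (g i).
    by apply: eq_bigr => i _; rewrite (addmapZ _ _ irD).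
  rewrite addnC !big_ord_recl /=.
  rewrite [LHS](AC (4*2) (1*(2*(3*(5*(4*6))))))%AC //.
- by rewrite dim_E (y_dim Y) addnC addSn.
Qed.
End YE.

(** Residues 0 and 3 are those whose initial module is F or [Y3]. Each extension raises s by 2 and
    the number of powers of u by 4. *)
Lemma ystr_R (eps : bool) s : ((s + eps.*2) %% 4 == 0)%N || ((s + eps.*2) %% 4 == 3)%N ->
  exists y0 g, ystr (M := OmegaR eps s) (2 * s) y0 g.
Proof.
have [m] := ubnP s; elim: m s eps => // m IH [|[|s]] eps sm.
- by case: eps => // _; exists (rv1 1), (fun=> 0); apply: ystr_F.
- by case: eps => // _; exists (bvec 3 0), (fun j => if (j < 2)%N then bvec 3 j.+1 else 0); apply: ystr_Y3.
move=> h; rewrite R_E.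
have [y0 [g Y]] : exists y0 g, ystr (M := OmegaR (~~ eps) s) (2 * s) y0 g.
  by apply: IH; [lia | case: eps h => /=; rewrite ?addn0; lia].
by exists (@y0E _), (gE y0 g); rewrite (_ : (2 * s.+2 = 2 * s + 4)%N); [apply: ystr_E | lia].
Qed.

(** The parities of j and of binom(j, 2) depend only on j modulo 4. *)
Lemma pfam_mod a a' q (X : amod) c n v : a = a' + 4 * q -> pfam a' c n v ->
  @pfam a X c n v.
Proof.
move=> -> [vp v1 v2 v0]; split=> // j.
  by rewrite v1; congr ((nat_of_bool _)%:R *: _); lia.
by rewrite v2 !odd_binz2; congr ((nat_of_bool _)%:R *: _); lia.
Qed.

(** The kernel of [lam] discards [y0] and keeps the family [g], which starts in degree 2; hence the
    suspension a - 2. *)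
Lemma ker_pmod (L : lmod) n (y0 : L) (g : nat -> L) (K : amod) (j : K -> L) a b q :
  ystr n y0 g -> bottom L -> mor 0 j -> injective j -> (forall k, lam (j k) = 0) ->
  (forall x, lam x = 0 -> exists k, j k = x) -> a = 1 + 4 * q -> Psize a b = n ->
  isom (Pmod a b) (susp (a - 2) K).
Proof.
move=> Y bL hj jI jl jS aE nE; have [gp g1 g2 g0] := g_fam Y.
have [r rD rK] := addmap_retract (morD hj) jI.
have jr i : j (r (g i)) = g i by have [k <-] := jS _ (g_lam Y i); rewrite rK.
have jZ (c : 'F_2) x : j (c *: x) = c *: j x := addmapZ c x (morD hj).
apply: (pfam_isom (v := fun i => r (g i))).
- apply: (pfam_mod aE); rewrite nE; split=> i.
  + by apply: jI; rewrite (mor_pr hj) addr0 jr gp.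
  + by apply: jI; rewrite (mor1 hj) jZ !jr g1.
  + by apply: jI; rewrite (mor2 hj) jZ !jr g2.
  + by move=> ni; rewrite g0 // (addmap0 rD).
- move=> x; have [d dE] := y_span Y (j x); exists d; apply: jI.
  rewrite dE jl scale0r add0r nE (addmap_sum _ _ _ (morD hj)).
  by apply: eq_bigr => i _; rewrite jZ jr.
- by have := dim_ker_lam bL hj jS; rewrite (y_dim Y) nE; lia.
Qed.

Section YD.
Variables (M : lmod) (n : nat) (y0 : M) (g : nat -> M).
Hypothesis Y : ystr n y0 g.

(** D supplies u^3, u^4, u^5, u^6 and u^8, [y0] becomes u^7 with Sq1 u^7 = u^8 as extension term,
    and [g j] becomes u^(9+j). *)
Definition gD (j : nat) : extD M :=
  match j with
  | 0%N => (bvec 5 0, 0) | 1%N => (bvec 5 1, 0) | 2%N => (bvec 5 2, 0) | 3%N => (bvec 5 3, 0)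
  | 4%N => (0, y0) | 5%N => (bvec 5 4, 0) | j'.+4.+2 => (0, g j') end.

Lemma sq1D_inr (m : M) : sq1 (extD M) ((0 : D5), m) = (lam m *: d4, sq1 M m).
Proof. by rewrite sq1_ext /= linear0 add0r. Qed.

Lemma sq1D_inl (b : D5) : sq1 (extD M) (b, 0 : M) = (sq1 D5 b, 0).
Proof. by rewrite sq1_ext /= lam0 scale0r addr0 linear0. Qed.

Lemma sq2D_inr (m : M) : sq2 (extD M) ((0 : D5), m) = ((0 : D5), sq2 M m).
Proof. by rewrite sq2_ext /= linear0. Qed.

Lemma sq2D_inl (b : D5) : sq2 (extD M) (b, 0 : M) = (sq2 D5 b, 0).
Proof. by rewrite sq2_ext /= linear0. Qed.

Lemma D5_sum (b : D5) : b = (b : 'rV_5) 0 (inord 0) *: (bvec 5 0 : D5) + (b : 'rV_5) 0 (inord 1) *: (bvec 5 1 : D5)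
  + (b : 'rV_5) 0 (inord 2) *: (bvec 5 2 : D5) + (b : 'rV_5) 0 (inord 3) *: (bvec 5 3 : D5)
  + (b : 'rV_5) 0 (inord 4) *: (bvec 5 4 : D5).
Proof.
apply/rowP => i; rewrite !mxE.
by case: i => -[|[|[|[|[|i]]]]] //= hi; rewrite !mulr0 ?mulr1 ?addr0 ?add0r;
  congr (fun_of_matrix b _ _); apply: val_inj; rewrite /= ?inordK.
Qed.

Lemma gD_fam : pfam 3 0 (n + 6) gD.
Proof.
have [gp g1 g2 g0] := g_fam Y.
split.
- move=> [|[|[|[|[|[|j]]]]]]; rewrite /gD pr_ext /= ?linear0; try by rewrite pr_tab // scale1r.
  + by rewrite (y_pr Y).
  + rewrite (_ : j.+4.+2%:Z + 0 - 4 = j%:Z + 2) ?gp //; lia.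
- move=> j; rewrite odd_absz3; move: j => [|[|[|[|[|[|j]]]]]]; rewrite /gD.
  + by rewrite sq1D_inl sq1_tab !bvecE // scale1r.
  + by rewrite sq1D_inl sq1_tab !bvecE // scale0r.
  + by rewrite sq1D_inl sq1_tab !bvecE // scale1r.
  + by rewrite sq1D_inl sq1_tab !bvecE // scale0r.
  + by rewrite sq1D_inr (y_lam Y) (y_sq1 Y) !scale1r.
  + by rewrite sq1D_inl d4_s1 scale0r.
  + rewrite sq1D_inr (g_lam Y) scale0r g1 odd_absz1 /= !negbK.
    by case: (odd j); rewrite ?scale0r ?scale1r.
- move=> j; rewrite odd_bin3; move: j => [|[|[|[|[|[|j]]]]]]; rewrite /gD.
  + by rewrite sq2D_inl sq2_tab !bvecE // scale1r.
  + by rewrite sq2D_inl sq2_tab !bvecE // scale0r.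
  + by rewrite sq2D_inl sq2_tab !bvecE // scale0r.
  + by rewrite sq2D_inl sq2_tab !bvecE // scale1r.
  + by rewrite sq2D_inr (y_sq2 Y) scale1r.
  + by rewrite sq2D_inl d4_s2 scale0r.
  + have e4 : ((j.+4.+2 %% 4 == 3) || (j.+4.+2 %% 4 == 0) = ((j %% 4 == 1) || (j %% 4 == 2)))%N by lia.
    by rewrite sq2D_inr g2 odd_bin1 e4; case: (_ || _); rewrite ?scale0r ?scale1r.
- move=> [|[|[|[|[|[|j]]]]]] h; try by lia.
  by rewrite /gD g0 //; lia.
Qed.

Lemma ED_pmod a b q : a = 3 + 4 * q -> Psize a b = (n + 6)%N ->
  isom (Pmod a b) (susp a (extD M)).
Proof.
move=> aE nE; rewrite -[a in susp a]subr0; apply: (pfam_isom (v := gD)).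
- by apply: (pfam_mod aE); rewrite nE; apply: gD_fam.
- move=> [b' m]; have [d mE] := y_span Y m; rewrite nE.
  exists (fun j => match j with 0%N => (b' : 'rV_5) 0 (inord 0) | 1%N => (b' : 'rV_5) 0 (inord 1)
    | 2%N => (b' : 'rV_5) 0 (inord 2) | 3%N => (b' : 'rV_5) 0 (inord 3)
    | 4%N => lam m | 5%N => (b' : 'rV_5) 0 (inord 4) | j'.+4.+2 => d j' end).
  pose il (u : D5) : extD M := (u, 0); pose ir (u : M) : extD M := (0, u).
  have ilD : addmap il by move=> u u'; rewrite /il -[RHS]/((u + u', 0 + 0)) addr0.
  have irD : addmap ir by move=> u u'; rewrite /ir -[RHS]/((0 + 0, u + u')) addr0.
  transitivity (il b' + ir m); first by rewrite -[RHS]/((b' + 0, 0 + m)) addr0 add0r.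
  rewrite [X in il X]D5_sum [X in ir X]mE !ilD !irD (addmap_sum _ _ _ irD) !(addmapZ _ _ ilD, addmapZ _ _ irD).
  have -> : \sum_(i < n) ir (d i *: g i) = \sum_(i < n) d i *: ir (g i).
    by apply: eq_bigr => i _; rewrite (addmapZ _ _ irD).
  rewrite addnC !big_ord_recl /=.
  by rewrite [LHS](AC (5*2) (1*(2*(3*(4*(6*(5*7)))))))%AC.
- by rewrite [X in (_ <= X)%N]dim_ext (y_dim Y) nE [\dim {:D5}]dim_tab; lia.
Qed.

End YD.

(** * The two cases of the theorem *)

Lemma Amod_ker (k : nat) (eps : bool) : (0 < k)%N -> exists j : Amod k eps -> OmegaR eps k.+1,
  [/\ mor 0 j, injective j, forall x, lam (j x) = 0 & forall x, lam x = 0 -> exists y, j y = x].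
Proof.
(* The index is now at least 2, so [R_E] exhibits the module as an extension, whose bottom class is
   that of B. *)
case: k => // k _; apply: ker_to_unit (isom_OmegaR _ _) _ _.
  by rewrite R_E; apply: E_lin2.
by rewrite R_E; apply: bottom_E; apply: low_R.
Qed.

Lemma bottom_R (eps : bool) k : (0 < k)%N -> bottom (OmegaR eps k.+1).
Proof. by case: k => // k _; rewrite R_E; apply/bottom_E/low_R. Qed.

Lemma case1 (m n : nat) (eps : bool) : (m < n)%N -> (m %% 2 = 1)%N ->
  ((n - m + 1 + eps.*2) %% 4 == 0)%N || ((n - m + 1 + eps.*2) %% 4 == 3)%N ->
  isom (Pmod (2 * m%:Z - 1) (2 * n%:Z)) (susp (2 * m%:Z - 3) (Amod (n - m) eps)).
Proof.
move=> mn m1; rewrite addn1 => h.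
have k0 : (0 < n - m)%N by lia.
have [j [hj jI jl jS]] := Amod_ker eps k0; have [y0 [g Y]] := ystr_R h.
rewrite (_ : 2 * m%:Z - 3 = 2 * m%:Z - 1 - 2); last lia.
apply: (ker_pmod (q := (m./2)%:Z) Y (bottom_R _ k0) hj jI jl jS); first lia.
rewrite /Psize ifT; lia.
Qed.

(** The sequence, suspended twice, presents Sigma^2 N as a cosyzygy of Sigma^3 K. *)
Lemma Omega_inv (K P N : amod) (i : K -> P) (p : P -> N) :
  ses (i : susp 1 K -> P) p -> is_free P -> reduced N ->
  isom (Omega (- 1) (susp 3 K)) (susp 2 N).
Proof.
move=> S fP rN; rewrite -[Omega _ _]/(red (tensor (tensor (dual OmegaF) unit_mod) (susp 3 K))).
apply: red_isom; first exact: reduced_susp.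
apply: steq_dual_Omega (ses_susp 2 S) (is_free_susp _ fP) _.
exact/isom_steq/isom_susp2.
Qed.

Definition C4t1 : seq (seq nat) := [:: [:: 1]; [::]; [:: 3]; [::]]%N.
Definition C4t2 : seq (seq nat) := [:: [:: 2]; [::]; [::]; [::]]%N.
Lemma C4_ok : tab_ok 4 [:: 0; 1; 2; 3] C4t1 C4t2. Proof. by []. Qed.
(* The desuspension of P_3^6; the only case of (2) which is not obtained from
   [extD]. *)
Definition C4 : amod := tab C4_ok.

Definition PC : seq (seq nat) := [:: [:: 0]; [:: 1]; [:: 2]; [:: 3]; [::]; [::]; [::]; [::]]%N.

Lemma C4_pmod a b q : a = 3 + 4 * q -> Psize a b = 4 -> isom (Pmod a b) (susp a C4).
Proof.
move=> aE nE; rewrite -[a in susp a]subr0.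
apply: (pfam_isom (v := fun j => if (j < 4)%N then (bvec 4 j : C4) else 0)).
- apply: (pfam_mod aE); rewrite nE; split=> j.
  + by move: j => [|[|[|[|j]]]]; rewrite /= ?linear0 // pr_tab // scale1r.
  + rewrite odd_absz3; move: j => [|[|[|[|j]]]];
      rewrite /= ?linear0 ?scaler0 // sq1_tab !bvecE // ?scale1r ?scale0r //.
  + rewrite odd_bin3; move: j => [|[|[|[|j]]]];
      rewrite /= ?linear0 ?scaler0 // sq2_tab !bvecE // ?scale1r ?scale0r //.
  + by move=> j4; rewrite ltnNge j4.
- move=> x; exists (fun j => (x : 'rV_4) 0 (inord j)); rewrite nE.
  apply/rowP => i; rewrite !big_ord_recl big_ord0 /= !mxE /=.
  case: i => -[|[|[|[|i]]]] //= hi; rewrite !mulr0 ?mulr1 ?addr0 ?add0r;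
    by congr (fun_of_matrix x _ _); apply: val_inj; rewrite /= ?inordK.
- by rewrite nE [\dim {:C4}]dim_tab.
Qed.

(** [PC] kills the words with index 4 to 7, so on the image of [iF] it sees only Sq1, that is the
    coefficient of 1 in B, which is [lam]. *)
Lemma ses_C4 (K : amod) (j : K -> extB Flm) : mor 0 j -> injective j ->
  (forall k, lam (j k) = 0) -> (forall x : extB Flm, lam x = 0 -> exists k, j k = x) ->
  ses (fun k : susp 1 K => iF (j k)) (@tabfun 8 4 PC : A1 -> C4).
Proof.
move=> hj jI jl jS; apply: ses_of_dim.
- by apply/mor_of_susp; rewrite add0r; have := mor_comp hj iF_mor; rewrite add0r.
- exact/mor_from_A1/tab_mor.
- by move=> x y /iF_inj/jI.
- by move=> y; exists (@tabfun 4 8 (tid 4) (y : 'rV_4)); apply: tmK.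
- move=> k; have := jl k; case: (j k) => b c /= b0.
  rewrite /iF /= tmD tmZ tm_tm -[X in _ + _ *: X]/(bvec 8 6 *m tabmx 8 4 PC) !bvecE // scaler0 addr0.
  rewrite -[tmul _ _ _ _ _]/(tmul 4 1 4 B4c [:: [:: 1%N]]) -cof_be b0.
  exact: scale0r.
- have bF : bottom (extB Flm) by apply: bottom_E; apply: (@low_bmod 0).
  have := dim_ker_lam bF hj jS; rewrite dim_E dim_unit dim_A1.
  by rewrite -[\dim {:susp 1 K}]/(\dim {:K}) [\dim {:C4}]dim_tab; lia.
Qed.

Lemma case2 (m n : nat) (eps : bool) : (m < n)%N -> (0 < m)%N -> (m %% 2 = 0)%N ->
  ((n - m + eps.*2) %% 4 == 0)%N || ((n - m + eps.*2) %% 4 == 3)%N ->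
  isom (Pmod (2 * m%:Z - 1) (2 * n%:Z))
    (susp (2 * m%:Z - 3) (Omega (- 1) (susp 3 (Amod (n - m) eps)))).
Proof.
move=> mn m0 m2 h.
have k0 : (0 < n - m)%N by lia.
have [j [hj jI jl jS]] := Amod_ker eps k0.
have aE : 2 * m%:Z - 1 = 3 + 4 * (m./2%:Z - 1) by lia.
have nE : Psize (2 * m%:Z - 1) (2 * n%:Z) = (2 * (n - m) + 2)%N by rewrite /Psize ifT; lia.
suff [N [iP rN [P [i [p [S fP]]]]]] : exists N : amod,
    [/\ isom (Pmod (2 * m%:Z - 1) (2 * n%:Z)) (susp (2 * m%:Z - 1) N), reduced N &
    exists (P : amod) (i : Amod (n - m) eps -> P) (p : P -> N),
      ses (i : susp 1 (Amod (n - m) eps) -> P) p /\ is_free P].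
  apply: isom_trans iP _; have H := Omega_inv S fP rN.
  apply: isom_trans _ (isom_sym (isom_susp (erefl _) H)).
  apply: isom_trans _ (isom_sym (isom_susp2 _ _ _)).
  by apply: isom_susp (isom_refl _); lia.
move: (n - m)%N k0 h j hj jI jl jS nE => [//|[|k]] _ h j hj jI jl jS nE.
  (* For n - m = 1 the congruence forces eps = 1, and the module is a kernel in [extB Flm]. The
     general construction would call for [OmegaR] at index -1. *)
  case: eps h j hj jI jl jS => // _ j hj jI jl jS.
  exists C4; split.
  - exact: C4_pmod aE _.
  - exact: tab_reduced.
  - by exists A1, (fun x => iF (j x)), (@tabfun 8 4 PC); split; [apply: ses_C4 | apply: is_free_A1'].
have [|y0 [g Y]] := @ystr_R (~~ eps) k.
  (* The index drops by 2 while eps is flipped, so the residue modulo 4 is unchanged. *)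
  by case: eps h {j hj jI jl jS} => /=; rewrite ?addn0; lia.
have [[P [i [p [eta [fP S [eD ep] [e1 e2 ei]]]]]]] := link_R (~~ eps) k.
exists (extD (OmegaR (~~ eps) k)); split.
- by apply: (ED_pmod Y aE); lia.
- by apply: ext_reduced; [apply: tab_reduced | apply: reduced_R].
(* With k + 2 for n - m, the module is the kernel of [lam] on [extB N], where N has index k + 1 and
   is linked to the module of index k that is extended by D. *)
- rewrite R_E in j hj jI jl jS *.
  exists (dsum A1 (susp 4 P)), (fun x => step_i i (j x)), (step_p p eta d4_5 d4_s1 d4_s2 (tabfun QD)).
  split; last by apply: is_free_dsum (is_free_susp _ fP); apply: is_free_A1'.
  exact: (stepD_ses S eD ep e1 e2 ei (@lin2_R _ _) hj jI jl jS).
Qed.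

Unset Implicit Arguments.

Theorem theorem8p4 (m n : nat) : (1 <= m)%N -> (m < n)%N ->
  (m = 1 %[mod 2] ->
     ((n - m = 2 %[mod 4] \/ n - m = 3 %[mod 4])%N ->
        iso (Pmod (2 * m%:Z - 1) (2 * n%:Z))
            (susp (2 * m%:Z - 3) (Amod (n - m) false))) /\
     ((n - m = 0 %[mod 4] \/ n - m = 1 %[mod 4])%N ->
        iso (Pmod (2 * m%:Z - 1) (2 * n%:Z))
            (susp (2 * m%:Z - 3) (Amod (n - m) true)))) /\
  (m = 0 %[mod 2] ->
     ((n - m = 0 %[mod 4] \/ n - m = 3 %[mod 4])%N ->
        iso (Pmod (2 * m%:Z - 1) (2 * n%:Z))
            (susp (2 * m%:Z - 3) (Omega (- 1) (susp 3 (Amod (n - m) false))))) /\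
     ((n - m = 1 %[mod 4] \/ n - m = 2 %[mod 4])%N ->
        iso (Pmod (2 * m%:Z - 1) (2 * n%:Z))
            (susp (2 * m%:Z - 3) (Omega (- 1) (susp 3 (Amod (n - m) true)))))).
Proof.
move=> m0 mn; split=> hm; split=> h; apply/isomP.
- by apply: case1 => //; move: h; rewrite /=; lia.
- by apply: case1 => //; move: h; rewrite /=; lia.
- by apply: case2 => //; move: h; rewrite /=; lia.
- by apply: case2 => //; move: h; rewrite /=; lia.
Qed.
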